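(* Consider the multivariate linear structural errors-in-variables model $$y = b + C^{T} z + B^{T}\xi + e + \epsilon,\qquad x = \xi + \delta,$$ where $y,e,\epsilon$ take values in $\mathbb{R}^d$, $z$ in $\mathbb{R}^q$, $\xi,\delta,x$ in $\mathbb{R}^m$, and $b\in\mathbb{R}^d$, $C\in\mathbb{R}^{q\times d}$, $B\in\mathbb{R}^{m\times d}$ are nonrandom. Assume: (i) the random vectors $z$, $\xi$, $e$ and $(\epsilon^T,\delta^T)^T$ are independent with finite second moments ($\epsilon$ and $\delta$ may be correlated with each other); (ii) the covariance matrices $\Sigma_z=\mathbf{Cov}(z)$ and $\Sigma_x=\mathbf{Cov}(x)$ are nonsingular; (iii) $e$, $\epsilon$, $\delta$ have zero means; (iv) $\epsilon,\delta,\xi$ are jointly Gaussian. Let $(y_i,z_i,\xi_i,e_i,\epsilon_i,x_i,\delta_i)$, $i=0,1,2,\dots$, be independent copies of the model, let $\hat y_0=\mathbf{E}[y_0\mid z_0,x_0]$ be the best mean squared error predictor of $y_0$, and let $\tilde y_0=\tilde y_0^{(n)}$ be the OLS predictor built from $(y_i,z_i,x_i)$, $i=1,\dots,n$, and $(z_0,x_0)$ (defined in the context). Then $\tilde y_0\to\hat y_0$ almost surely as $n\to\infty$. Moreover, $$\forall\,\tau>0,\qquad \mathbf{P}\big(\|\tilde y_0-\hat y_0\|>\tau \,\big|\, z_0,x_0\big)\to 0\quad\text{a.s. as } n\to\infty.$$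
   Context: All vectors are columns. For variables $u,v$, $\bar u=\frac1n\sum_{i=1}^n u_i$ and $S_{uv}=\frac1n\sum_{i=1}^n (u_i-\bar u)(v_i-\bar v)^T$. $A^{+}$ denotes the (Moore–Penrose) pseudo-inverse. With $r=(z^T,x^T)^T$, the OLS estimators $\hat b_x\in\mathbb{R}^d,\hat C\in\mathbb{R}^{q\times d},\hat B_x\in\mathbb{R}^{m\times d}$ (which minimize $\sum_{i=1}^n\|y_i-b-C^Tz_i-B^Tx_i\|^2$) are given by $$\begin{pmatrix}\hat C\\ \hat B_x\end{pmatrix}=S_{rr}^{+}S_{ry},\qquad \hat b_x=\bar y-\hat C^T\bar z-\hat B_x^T\bar x .$$ The OLS predictor is $\tilde y_0=\hat b_x+\hat C^Tz_0+\hat B_x^Tx_0$. *)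

(* Defs.v *)
From HB Require Import structures.
From mathcomp Require Import all_boot all_order all_algebra.
From mathcomp Require Import finmap.
From mathcomp Require Import all_classical all_reals all_analysis.

Set Implicit Arguments.
Unset Strict Implicit.
Unset Printing Implicit Defensive.

Import Order.TTheory GRing.Theory Num.Theory.
Import numFieldNormedType.Exports.

Local Open Scope classical_set_scope.
Local Open Scope ring_scope.

(* The sigma-algebra generated by the entries, i.e. the Borel sigma-algebra of
   the finite-dimensional space of real matrices. *)
Section matrix_measurable.
Context (R : realType) (k l : nat).

Definition mx_sigma_algebra : set (set 'M[R]_(k, l)) :=
  <<s \bigcup_(ij in [set: 'I_k * 'I_l])
        preimage_set_system setT (fun A : 'M[R]_(k, l) => A ij.1 ij.2)
          measurable >>.

Let mx_set0 : mx_sigma_algebra set0.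
Proof. exact: sigma_algebra0. Qed.

Let mx_setC A : mx_sigma_algebra A -> mx_sigma_algebra (~` A).
Proof. exact: sigma_algebraC. Qed.

Let mx_bigcup (F : (set 'M[R]_(k, l))^nat) :
  (forall i, mx_sigma_algebra (F i)) -> mx_sigma_algebra (\bigcup_i F i).
Proof. exact: sigma_algebra_bigcup. Qed.

HB.instance Definition _ := @isMeasurable.Build (sigma_display mx_sigma_algebra)
  'M[R]_(k, l) mx_sigma_algebra mx_set0 mx_setC mx_bigcup.

End matrix_measurable.

Section probability_notions.
Context (R : realType) (dO : measure_display) (Omega : measurableType dO)
  (P : probability Omega R).

Definition mutually_independent (I : choiceType)
    (F : I -> set_system Omega) : Prop :=
  forall (J : {fset I}) (A : I -> set Omega),
    (forall i, i \in J -> F i (A i)) ->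
    P (\bigcap_(i in [set` J]) A i) = (\prod_(i <- J) P (A i))%E.

Definition same_law n (X Y : Omega -> 'cV[R]_n) : Prop :=
  forall A : set 'cV[R]_n, measurable A -> P (X @^-1` A) = P (Y @^-1` A).

Definition finite_second_moment n (X : Omega -> 'cV[R]_n) : Prop :=
  forall i, (fun w => X w i 0) \in Lfun P 2%:E.

Definition zero_mean n (X : Omega -> 'cV[R]_n) : Prop :=
  forall i, ('E_P[fun w => X w i 0%R] = 0)%E.

Definition cov_mx n (X : Omega -> 'cV[R]_n) : 'M[R]_n :=
  \matrix_(i, j) fine (covariance P (fun w => X w i 0) (fun w => X w j 0)).

(* Degenerate Gaussians are allowed. They need their own clause because
   [normal_prob mu 0] is by convention the uniform law on [0, 1]. *)
Definition gaussian_rv (X : Omega -> R) : Prop :=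
  exists mu sigma : R, forall A : set R, measurable A ->
    P (X @^-1` A) = if sigma == 0 then \d_mu A else normal_prob mu sigma A.

Definition gaussian_vector n (X : Omega -> 'cV[R]_n) : Prop :=
  forall a : 'cV[R]_n, gaussian_rv (fun w => (a^T *m X w) 0 0).

(* [Y] is a version of the conditional expectation of the integrable variable
   [X] given the sub-sigma-algebra [G]. *)
Definition is_cond_exp (G : set_system Omega) (X Y : Omega -> R) : Prop :=
  [/\ forall B : set R, measurable B -> G (Y @^-1` B),
      P.-integrable setT (EFin \o Y) &
      forall A, G A -> (\int[P]_(w in A) (Y w)%:E = \int[P]_(w in A) (X w)%:E)%E].

Definition is_cond_exp_vector (G : set_system Omega) n
    (X Y : Omega -> 'cV[R]_n) : Prop :=
  forall i, is_cond_exp G (fun w => X w i 0) (fun w => Y w i 0).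

Definition is_cond_prob (G : set_system Omega) (E : set Omega)
    (p : Omega -> R) : Prop :=
  is_cond_exp G \1_E p.

End probability_notions.

Section errors_in_variables.
Context (R : realType) (dO : measure_display) (Omega : measurableType dO)
  (P : probability Omega R) (d q m : nat).

Record eiv_vars := EivVars {
  vy : {RV P >-> 'cV[R]_d};
  vz : {RV P >-> 'cV[R]_q};
  vxi : {RV P >-> 'cV[R]_m};
  ve : {RV P >-> 'cV[R]_d};
  veps : {RV P >-> 'cV[R]_d};
  vx : {RV P >-> 'cV[R]_m};
  vdelta : {RV P >-> 'cV[R]_m} }.

Definition stacked (M : eiv_vars) (w : Omega) :=
  col_mx (vy M w) (col_mx (vz M w) (col_mx (vxi M w) (col_mx (ve M w)
    (col_mx (veps M w) (col_mx (vx M w) (vdelta M w)))))).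

Definition zx (M : eiv_vars) (w : Omega) : 'cV[R]_(q + m) :=
  col_mx (vz M w) (vx M w).

Definition eps_delta (M : eiv_vars) (w : Omega) : 'cV[R]_(d + m) :=
  col_mx (veps M w) (vdelta M w).

Definition eps_delta_xi (M : eiv_vars) (w : Omega) : 'cV[R]_(d + m + m) :=
  col_mx (eps_delta M w) (vxi M w).

Definition independent_blocks (M : eiv_vars) : Prop :=
  mutually_independent P
    (tnth [tuple g_sigma_algebra_preimage (vz M);
                 g_sigma_algebra_preimage (vxi M);
                 g_sigma_algebra_preimage (ve M);
                 g_sigma_algebra_preimage (eps_delta M)]).

Definition eiv_model (b : 'cV[R]_d) (C : 'M[R]_(q, d)) (B : 'M[R]_(m, d))
    (M : eiv_vars) : Prop :=
  forall w,
    vy M w = b + C^T *m vz M w + B^T *m vxi M w + ve M w + veps M w /\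
    vx M w = vxi M w + vdelta M w.

(* The model equations are not required of the copies pointwise: they follow
   almost surely from the equality of the joint laws. *)
Definition independent_copies (M : eiv_vars) (Ms : nat -> eiv_vars) : Prop :=
  (forall i, same_law P (stacked (Ms i)) (stacked M)) /\
  mutually_independent P
    (fun i => g_sigma_algebra_preimage (stacked (Ms i))).

End errors_in_variables.

Section least_squares.
Context (R : realType).

Definition enorm n (v : 'cV[R]_n) : R := Num.sqrt (\sum_i v i 0 ^+ 2).

Definition penrose k l (A : 'M[R]_(k, l)) (G : 'M[R]_(l, k)) : Prop :=
  [/\ A *m G *m A = A, G *m A *m G = G,
      (A *m G)^T = A *m G & (G *m A)^T = G *m A].

Definition mpinv k l (A : 'M[R]_(k, l)) : 'M[R]_(l, k) :=
  xget 0 [set G | penrose A G].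

Lemma penrose_unique k l (A : 'M[R]_(k, l)) (G H : 'M[R]_(l, k)) :
  penrose A G -> penrose A H -> G = H.
Proof.
move=> [AGA GAG AGT GAT] [AHA HAH AHT HAT].
have eAG : A *m G = A *m H.
  rewrite -[in LHS]AHA -(mulmxA (A *m H)) -AGT -AHT -trmx_mul.
  by rewrite mulmxA AGA AHT.
have eGA : G *m A = H *m A.
  rewrite -[in LHS]AHA !mulmxA -(mulmxA (G *m A)) -GAT -HAT -trmx_mul.
  by rewrite -(mulmxA H) (mulmxA A) AGA HAT.
by rewrite -GAG eGA -mulmxA eAG mulmxA HAH.
Qed.

Lemma gram_unitmx k l (A : 'M[R]_(k, l)) : row_free A -> A *m A^T \in unitmx.
Proof.
move=> Afree; rewrite -row_free_unit -kermx_eq0; apply/eqP/row_matrixP => i.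
rewrite row0; set u := row i _.
have uAA : u *m (A *m A^T) = 0 by rewrite /u -row_mul mulmx_ker row0.
have : (u *m A) *m (u *m A)^T = 0 by rewrite trmx_mul mulmxA -(mulmxA u) uAA mul0mx.
move/matrixP/(_ 0 0); rewrite !mxE => /eqP.
rewrite psumr_eq0; last by move=> j _; rewrite [_^T _ _]mxE -expr2 sqr_ge0.
move=> /allP uA0; apply: (row_free_inj Afree); rewrite mul0mx.
apply/rowP => j; rewrite [RHS]mxE; apply/eqP.
by have := uA0 j (mem_index_enum _); rewrite [_^T _ _]mxE mulf_eq0 orbb.
Qed.

Lemma penrose_mulmx k r l (F : 'M[R]_(k, r)) (H : 'M[R]_(r, l)) :
  row_full F -> row_free H ->
  penrose (F *m H)
    (H^T *m invmx (H *m H^T) *m (invmx (F^T *m F) *m F^T)).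
Proof.
move=> Ffull Hfree; have HH := gram_unitmx Hfree.
have FF : F^T *m F \in unitmx.
  by rewrite -{2}[F]trmxK gram_unitmx// /row_free mxrank_tr.
have HiH := mulmxV HH; have FiF := mulVmx FF.
have iHT : (invmx (H *m H^T))^T = invmx (H *m H^T).
  by rewrite trmx_inv trmx_mul trmxK.
have iFT : (invmx (F^T *m F))^T = invmx (F^T *m F).
  by rewrite trmx_inv trmx_mul trmxK.
move: (invmx (H *m H^T)) (invmx (F^T *m F)) HiH FiF iHT iFT.
move=> iH iF HiH FiF iHT iFT.
set G := H^T *m iH *m (iF *m F^T).
have AGE : F *m H *m G = F *m (iF *m F^T).
  by rewrite /G -!mulmxA (mulmxA H) (mulmxA _ iH) HiH mul1mx.
have GAE : G *m (F *m H) = H^T *m iH *m H.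
  by rewrite /G -!mulmxA (mulmxA F^T) (mulmxA iF) FiF mul1mx.
split.
- by rewrite AGE -!mulmxA (mulmxA F^T) (mulmxA iF) FiF mul1mx.
- by rewrite GAE /G -!mulmxA (mulmxA H H^T) (mulmxA (H *m H^T) iH) HiH mul1mx.
- by rewrite AGE !trmx_mul iFT trmxK mulmxA.
- by rewrite GAE !trmx_mul iHT trmxK mulmxA.
Qed.

Lemma penrose_exists k l (A : 'M[R]_(k, l)) : exists G, penrose A G.
Proof.
have := penrose_mulmx (col_base_full A) (row_base_free A).
by rewrite mulmx_base; set G := (X in penrose A X) => AG; exists G.
Qed.

Lemma mpinvP k l (A : 'M[R]_(k, l)) : penrose A (mpinv A).
Proof. by have [G AG] := penrose_exists A; exact: (xgetPex _ (ex_intro _ G AG)). Qed.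

Definition smean n k (u : nat -> 'cV[R]_k) : 'cV[R]_k :=
  n%:R^-1 *: \sum_(1 <= i < n.+1) u i.

Definition scov n k l (u : nat -> 'cV[R]_k) (v : nat -> 'cV[R]_l) :
    'M[R]_(k, l) :=
  n%:R^-1 *: \sum_(1 <= i < n.+1) (u i - smean n u) *m (v i - smean n v)^T.

Section estimators.
Variables (n d q m : nat) (y : nat -> 'cV[R]_d) (z : nat -> 'cV[R]_q)
  (x : nat -> 'cV[R]_m).

Definition ols_coef : 'M[R]_(q + m, d) :=
  let r i := col_mx (z i) (x i) in mpinv (scov n r r) *m scov n r y.

Definition ols_C : 'M[R]_(q, d) := usubmx ols_coef.

Definition ols_B : 'M[R]_(m, d) := dsubmx ols_coef.

Definition ols_b : 'cV[R]_d :=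
  smean n y - ols_C^T *m smean n z - ols_B^T *m smean n x.

Definition ols_predictor (z0 : 'cV[R]_q) (x0 : 'cV[R]_m) : 'cV[R]_d :=
  ols_b + ols_C^T *m z0 + ols_B^T *m x0.

End estimators.

End least_squares.

(* The predictor built from observations 1, ..., n, evaluated at the
   regressors of observation 0. *)
Definition eiv_ols_predictor (R : realType) (dO : measure_display)
    (Omega : measurableType dO) (P : probability Omega R) (d q m : nat)
    (Ms : nat -> eiv_vars P d q m) (n : nat) (w : Omega) : 'cV[R]_d :=
  ols_predictor n (fun i => vy (Ms i) w) (fun i => vz (Ms i) w)
    (fun i => vx (Ms i) w) (vz (Ms 0%N) w) (vx (Ms 0%N) w).

(* Main.v *)
(* By independence and the Gaussian assumption, the residual of the linear
   regression of [y] on [r = (z, x)] is the sum of [e] and of the residual of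
   [B^T xi + eps] on [x], which is Gaussian jointly with [x] and uncorrelated
   with it. So the residual has integral zero over every event of the
   sigma-algebra of [(z, x)], that is, [E[y | z, x]] is affine in [(z, x)] with
   slope [Cov(r)^-1 Cov(r, y)]. By the strong law of large numbers the sample
   moments converge almost surely, the sample covariance of [r] is eventually
   invertible, and the OLS predictor converges to the affine predictor.
   For the conditional probabilities, let [Q_N] be the union over [n >= N] of
   the events [|error_n| > tau]. A first-hitting decomposition along the
   conditional probabilities [p_n] gives [c P(sup_(n >= N) p_n > c) <= P(Q_N)],
   and [P(Q_N)] tends to [0]. *)

Require Import Defs.
From HB Require Import structures.
From mathcomp Require Import all_boot all_order all_algebra.
From mathcomp Require Import finmap.
From mathcomp Require Import all_classical all_reals all_analysis.
From mathcomp Require Import measurable_realfun.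
From mathcomp Require Import ring lra.

Set Implicit Arguments.
Unset Strict Implicit.
Unset Printing Implicit Defensive.

Import Order.TTheory GRing.Theory Num.Theory.
Import numFieldNormedType.Exports.

Local Open Scope classical_set_scope.
Local Open Scope ring_scope.

(** * Expectation *)

(** [gaussian_vector] constrains only one-dimensional projections, so independence of the residual
    [V] from [x] is not at hand; only the vanishing of [E[V 1_D]] for [D] in the sigma-algebra of
    [x] is aimed at. For a linear combination [L] of the centered [x], equality of the laws of
    [L + sV] and [L - sV] makes [sin(sV)] orthogonal to [cos L] and [sin L]; dividing by [s] and
    letting [s] tend to 0 replaces [sin(sV)] by [V]. A Fourier uniqueness argument, carried out with
    real functions, then passes from trigonometric functions to indicators. The error events involve
    the pseudo-inverse, whose measurability is never established. They are enclosed in measurable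
    events built from [det_inv], which gives the same predictor once the sample covariance is
    invertible. Convergence of the errors in probability would only make the conditional
    probabilities converge in mean. Almost sure convergence of arbitrary versions of them uses the
    almost sure convergence of the errors, through unions over all [n >= N]. *)

Section expectation_toolkit.
Context (R : realType) (dO : measure_display) (Omega : measurableType dO)
  (P : probability Omega R).
Implicit Types f g h X Y : Omega -> R.

Definition L1 f := P.-integrable setT (EFin \o f).
(** Integrability of the square gives measurability of [f ^+ 2] but not of [f], hence the first
    clause. *)
Definition L2 f := measurable_fun setT f /\ L1 (fun w => f w ^+ 2).
Definition Ex f : R := \int[P]_w f w.

Lemma L1_meas f : L1 f -> measurable_fun setT f.
Proof. by move=> /(measurable_int P) /measurable_EFinP. Qed.

Lemma eq_L1 f g : f =1 g -> L1 f -> L1 g.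
Proof. by move=> /funext ->. Qed.

Lemma eq_L2 f g : f =1 g -> L2 f -> L2 g.
Proof. by move=> /funext ->. Qed.

Lemma L1_dom f g : measurable_fun setT f -> L1 g ->
  (forall w, `|f w| <= g w) -> L1 f.
Proof.
move=> mf ig fg; apply: (@le_integrable _ _ _ P setT measurableT _ (EFin \o g)) => //.
  exact/measurable_EFinP.
by move=> w _ /=; rewrite lee_fin (le_trans (fg w))// ler_norm.
Qed.

Lemma L1_cst c : L1 (fun=> c).
Proof. exact: finite_measure_integrable_cst. Qed.

Lemma L1D f g : L1 f -> L1 g -> L1 (fun w => f w + g w).
Proof.
move=> fi gi; have := integrableD measurableT fi gi.
by apply: eq_integrable => // w _ /=.
Qed.

Lemma L1Z c f : L1 f -> L1 (fun w => c * f w).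
Proof.
move=> fi; have := integrableZl measurableT c fi.
by apply: eq_integrable => // w _ /=.
Qed.

Lemma L1N f : L1 f -> L1 (fun w => - f w).
Proof. by move=> /(L1Z (-1)); apply: eq_L1 => w; rewrite mulN1r. Qed.

Lemma L1B f g : L1 f -> L1 g -> L1 (fun w => f w - g w).
Proof. by move=> fi gi; apply: (L1D fi); exact: L1N. Qed.

Lemma L1_abs f : L1 f -> L1 (fun w => `|f w|).
Proof. exact: integrable_abse. Qed.

Lemma L1_sum I (s : seq I) (p : pred I) (F : I -> Omega -> R) :
  (forall i, p i -> L1 (F i)) -> L1 (fun w => \sum_(i <- s | p i) F i w).
Proof.
move=> Fi; elim: s => [|i s IH].
  by apply: eq_L1 (L1_cst 0) => w; rewrite big_nil.
case: (boolP (p i)) => pi_.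
  by apply: eq_L1 (L1D (Fi _ pi_) IH) => w; rewrite big_cons pi_.
by apply: eq_L1 IH => w; rewrite big_cons (negbTE pi_).
Qed.

Lemma L1_bdd f c : measurable_fun setT f -> (forall w, `|f w| <= c) -> L1 f.
Proof. by move=> mf fc; apply: (L1_dom mf (L1_cst c)). Qed.

Lemma L1_bddM f g c : L1 f -> measurable_fun setT g ->
  (forall w, `|g w| <= c) -> L1 (fun w => f w * g w).
Proof.
move=> fi mg gc; apply: (@L1_dom _ (fun w => c * `|f w|)).
- by apply: measurable_funM => //; exact: L1_meas.
- exact/L1Z/L1_abs.
- by move=> w; rewrite normrM mulrC ler_wpM2r.
Qed.

Lemma eq_Ex f g : f =1 g -> Ex f = Ex g.
Proof. by move=> fg; apply: eq_Rintegral. Qed.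

Lemma ExD f g : L1 f -> L1 g -> Ex (fun w => f w + g w) = Ex f + Ex g.
Proof. by move=> fi gi; exact: RintegralD. Qed.

Lemma ExB f g : L1 f -> L1 g -> Ex (fun w => f w - g w) = Ex f - Ex g.
Proof. by move=> fi gi; exact: RintegralB. Qed.

Lemma ExZ c f : L1 f -> Ex (fun w => c * f w) = c * Ex f.
Proof. by move=> fi; exact: RintegralZl. Qed.

Lemma Ex_cst c : Ex (fun=> c) = c.
Proof. by rewrite /Ex Rintegral_cst// /= probability_setT mulr1. Qed.

Lemma Ex_sum I (s : seq I) (p : pred I) (F : I -> Omega -> R) :
  (forall i, p i -> L1 (F i)) ->
  Ex (fun w => \sum_(i <- s | p i) F i w) = \sum_(i <- s | p i) Ex (F i).
Proof.
move=> Fi; elim: s => [|i s IH].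
  by rewrite big_nil -[RHS]Ex_cst; apply: eq_Ex => w; rewrite big_nil.
rewrite big_cons; case: ifPn => pi_.
  rewrite -IH -ExD//; [|exact: Fi|exact: L1_sum].
  by apply: eq_Ex => w; rewrite big_cons pi_.
by rewrite -IH; apply: eq_Ex => w; rewrite big_cons (negbTE pi_).
Qed.

Lemma Ex_le f g : L1 f -> L1 g -> (forall w, f w <= g w) -> Ex f <= Ex g.
Proof. by move=> fi gi fg; apply: le_Rintegral. Qed.

Lemma Ex_ge0 f : (forall w, 0 <= f w) -> 0 <= Ex f.
Proof. by move=> f0; apply: Rintegral_ge0. Qed.

Lemma EFin_Ex f : L1 f -> (Ex f)%:E = (\int[P]_w (f w)%:E)%E.
Proof. by move=> fi; rewrite /Ex /Rintegral fineK//; exact: integrable_fin_num. Qed.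

Lemma Ex_restrict f A : measurable A -> L1 f ->
  (Ex (fun w => f w * \1_A w))%:E = (\int[P]_(w in A) (f w)%:E)%E.
Proof.
move=> mA fi; rewrite EFin_Ex.
  rewrite [RHS]integral_mkcond; apply: eq_integral => w _.
  by rewrite restrict_EFin /= patchE indicE; case: ifPn; rewrite ?mulr1 ?mulr0.
apply: (@L1_bddM _ _ 1) => //.
by move=> w; rewrite indicE ger0_norm; case: (_ \in _).
Qed.

Lemma Ex_dom_cvg (F : nat -> Omega -> R) f g :
  (forall n, measurable_fun setT (F n)) -> measurable_fun setT f -> L1 g ->
  (forall n w, `|F n w| <= g w) -> (forall w, F n w @[n --> \oo] --> f w) ->
  L1 f /\ Ex (F n) @[n --> \oo] --> Ex f.
Proof.
move=> mF mf gi Fg Ff.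
have [|||||] := @dominated_convergence _ _ _ P setT measurableT
  (fun n => EFin \o F n) (EFin \o f) (EFin \o g).
- by move=> n; exact/measurable_EFinP.
- exact/measurable_EFinP.
- by apply: aeW => w _; apply: cvg_EFin; [exact: nearW|exact: Ff].
- exact: gi.
- by apply: aeW => w n _ /=; rewrite lee_fin.
move=> fi _ cF; split => //; apply: fine_cvg.
rewrite -/(Ex f) [X in _ --> X]/= fineK; last exact: integrable_fin_num.
exact: cF.
Qed.

Lemma L2_L1 f : L2 f -> L1 f.
Proof.
move=> [mf f2]; apply: (@L1_dom _ (fun w => f w ^+ 2 + 1)) => //.
  by apply: L1D => //; exact: L1_cst.
move=> w; rewrite -(real_normK (num_real (f w))).
by have := sqr_ge0 (`|f w| - 1); have := normr_ge0 (f w); nra.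
Qed.

Lemma L2M f g : L2 f -> L2 g -> L1 (fun w => f w * g w).
Proof.
move=> [mf f2] [mg g2]; apply: (@L1_dom _ (fun w => f w ^+ 2 + g w ^+ 2)).
- exact: measurable_funM.
- exact: L1D.
- move=> w; rewrite normrM -(real_normK (num_real (f w))) -(real_normK (num_real (g w))).
  by have := sqr_ge0 (`|f w| - `|g w|); have := normr_ge0 (f w); have := normr_ge0 (g w); nra.
Qed.

Lemma L2_cst c : L2 (fun=> c).
Proof. by split => //; exact: L1_cst. Qed.

Lemma L2Z c f : L2 f -> L2 (fun w => c * f w).
Proof.
move=> [mf f2]; split; first exact: measurable_funM.
by apply: eq_L1 (L1Z (c ^+ 2) f2) => w; rewrite exprMn.
Qed.

Lemma L2D f g : L2 f -> L2 g -> L2 (fun w => f w + g w).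
Proof.
move=> f2 g2; split; first by apply: measurable_funD; [case: f2|case: g2].
have [[_ ff] [_ gg]] := (f2, g2).
apply: eq_L1 (L1D (L1D ff (L1Z 2 (L2M f2 g2))) gg) => w.
by rewrite sqrrD mulr_natl.
Qed.

Lemma L2B f g : L2 f -> L2 g -> L2 (fun w => f w - g w).
Proof.
by move=> f2 g2; apply: eq_L2 (L2D f2 (L2Z (-1) g2)) => w; rewrite mulN1r.
Qed.

Lemma L2_sum I (s : seq I) (p : pred I) (F : I -> Omega -> R) :
  (forall i, p i -> L2 (F i)) -> L2 (fun w => \sum_(i <- s | p i) F i w).
Proof.
move=> Fi; elim: s => [|i s IH].
  by apply: eq_L2 (L2_cst 0) => w; rewrite big_nil.
case: (boolP (p i)) => pi_.
  by apply: eq_L2 (L2D (Fi _ pi_) IH) => w; rewrite big_cons pi_.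
by apply: eq_L2 IH => w; rewrite big_cons (negbTE pi_).
Qed.

Lemma L2_bddM f g c : L2 f -> measurable_fun setT g ->
  (forall w, `|g w| <= c) -> L2 (fun w => f w * g w).
Proof.
move=> [mf f2] mg gc; split; first exact: measurable_funM.
apply: eq_L1 (_ : L1 (fun w => f w ^+ 2 * g w ^+ 2)) => [w|].
  by rewrite exprMn.
apply: (@L1_bddM _ _ (c ^+ 2)) => //; first exact: measurable_funX.
by move=> w; rewrite normrX lerXn2r ?nnegrE// (le_trans _ (gc w)).
Qed.

Lemma L2_bdd f c : measurable_fun setT f -> (forall w, `|f w| <= c) -> L2 f.
Proof.
by move=> mf fc; apply: eq_L2 (L2_bddM (L2_cst 1) mf fc) => w; rewrite mul1r.
Qed.

Lemma Lfun2_L2 f : f \in Lfun P 2%:E -> L2 f.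
Proof.
move=> f2; split; last exact: (Lfun2_integrable_sqr f2).
by move: f2; rewrite inE => /andP[]; rewrite inE.
Qed.

Definition indep_rv X Y := forall A B : set R, measurable A -> measurable B ->
  P (X @^-1` A `&` Y @^-1` B) = (P (X @^-1` A) * P (Y @^-1` B))%E.

End expectation_toolkit.

Section product_of_independent.
Context (R : realType) (dO : measure_display) (Omega : measurableType dO)
  (P : probability Omega R).
Variables (X Y : Omega -> R).
Hypotheses (mX : measurable_fun setT X) (mY : measurable_fun setT Y).

Let X' w : measurableTypeR R := X w.
Let Y' w : measurableTypeR R := Y w.
Let XY w : measurableTypeR R * measurableTypeR R := (X w, Y w).

Let mXY : measurable_fun setT XY.
Proof. by apply/measurable_fun_pairP; split. Qed.

HB.instance Definition _ := isMeasurableFun.Build _ _ _ _ X' mX.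
HB.instance Definition _ := isMeasurableFun.Build _ _ _ _ Y' mY.
HB.instance Definition _ := isMeasurableFun.Build _ _ _ _ XY mXY.

Let PX := distribution P X'.
Let PY := distribution P Y'.
Let PXY := distribution P XY.

(** Independence says that the joint law and the product of the marginal laws agree on rectangles,
    hence everywhere; Fubini's theorem then splits the integral of the product. *)
Lemma Ex_mul_indep_meas : indep_rv P X Y -> L1 P X -> L1 P Y ->
  L1 P (fun w => X w * Y w) -> Ex P (fun w => X w * Y w) = Ex P X * Ex P Y.
Proof.
move=> iXY X1 Y1 XY1.
pose f (z : measurableTypeR R * measurableTypeR R) := (z.1 * z.2)%:E.
have mf : measurable_fun setT f.
  by apply/measurable_EFinP; apply: measurable_funM.
have eqm A : measurable A -> (PX \x PY)%E A = PXY A.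
  by apply: product_measure_unique => B C mB mC; exact: iXY.
have intf : PXY.-integrable setT f by apply: integrable_pushforward.
have intf' : (PX \x PY)%E.-integrable setT f.
  apply/integrableP; split => //; move/integrableP : intf => [_].
  by rewrite (eq_measure_integral (PX \x PY)%E)// => A mA _; exact/esym/eqm.
have idE (Z : {mfun Omega >-> measurableTypeR R}) : L1 P Z ->
    (\int[distribution P Z]_x x%:E)%E = (Ex P Z)%:E.
  move=> Z1; rewrite EFin_Ex//.
  by rewrite (@integral_distribution _ _ _ _ _ P Z EFin).
have idI (Z : {mfun Omega >-> measurableTypeR R}) : L1 P Z ->
    (distribution P Z).-integrable setT EFin.
  by move=> Z1; apply: integrable_pushforward.
apply: EFin_inj; rewrite EFin_Ex//.
transitivity (\int[PXY]_z f z)%E.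
  by rewrite (@integral_distribution _ _ _ _ _ P XY f).
rewrite (eq_measure_integral (PX \x PY)%E); last first.
  by move=> A mA _; exact/esym/eqm.
rewrite -integral12_prod_meas1// /fubini_F /f/=.
under eq_integral => x _.
  under eq_integral do rewrite EFinM.
  rewrite integralZl//; last exact: (idI Y').
  rewrite (idE Y')//.
  over.
rewrite /= integralZr//; last exact: (idI X').
by rewrite (idE X')// EFinM.
Qed.

End product_of_independent.

Lemma Ex_mul_indep (R : realType) (dO : measure_display)
    (Omega : measurableType dO) (P : probability Omega R) (X Y : Omega -> R) :
  indep_rv P X Y -> L2 P X -> L2 P Y ->
  Ex P (fun w => X w * Y w) = Ex P X * Ex P Y.
Proof.
move=> iXY X2 Y2; have [[mX _] [mY _]] := (X2, Y2).
by apply: Ex_mul_indep_meas => //; [exact: L2_L1|exact: L2_L1|exact: L2M].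
Qed.

(** * The strong law of large numbers *)

(** Every large [j] lies between [a * 2 ^ n] and [a.+1 * 2 ^ n] with [a] in a fixed window starting
    at a large [p]. The two ends have ratio at most [1 + 1 / p], so monotonicity of [s] pins
    [s j / j] near [mu]. *)
Lemma cvg_dyadic_interpolation (R : realType) (s : nat -> R) (mu : R) :
  {homo s : i j / (i <= j)%N >-> i <= j} -> (forall j, 0 <= s j) -> 0 <= mu ->
  (forall a, (0 < a)%N ->
    (fun n => s (a * 2 ^ n)%N / (a * 2 ^ n)%:R) @ \oo --> mu) ->
  (fun j => s j / j%:R) @ \oo --> mu.
Proof.
move=> ns s0 mu0 cs; apply/cvgrPdist_le => /= e e0.
(* For [a >= p] this choice makes [mu] smaller than [a * e / 4], so passing from [a] to [a.+1] is
   negligible at precision [e]. *)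
pose p := (Num.bound (4 * (mu + e) / e)).+1.
have pP : 4 * (mu + e) < p%:R * e.
  rewrite -ltr_pdivrMr// (lt_trans (archi_boundP _))//.
    by apply: divr_ge0; [apply: mulr_ge0 => //; apply: addr_ge0 => //; exact: ltW|exact: ltW].
  by rewrite ltr_nat.
(* Only finitely many [a] matter once [e] is fixed, so one rank serves them all. *)
have [N NP] : exists N, forall n a, (N <= n)%N -> (p <= a <= 2 * p)%N ->
    `|mu - s (a * 2 ^ n)%N / (a * 2 ^ n)%:R| <= e / 4.
  have e40 : 0 < e / 4 by rewrite divr_gt0.
  have /choice[F FP] : forall a, exists N, (0 < a)%N -> forall n, (N <= n)%N ->
      `|mu - s (a * 2 ^ n)%N / (a * 2 ^ n)%:R| <= e / 4.
    move=> [|a]; first by exists 0%N.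
    have /cvgrPdist_le/(_ _ e40)[N _ NP] := cs _ (ltn0Sn a).
    by exists N => _ n Nn; exact: NP.
  exists (\max_(a < (2 * p).+1) F a)%N => n a Nn /andP[pa ap].
  have a0 : (0 < a)%N by rewrite (leq_trans _ pa).
  apply: FP => //; apply: leq_trans Nn.
  by apply: (@leq_bigmax _ (fun a : 'I_(2 * p).+1 => F a) (Ordinal (_ : a < (2 * p).+1)%N)).
near=> j.
have jp : (2 ^ N * p <= j)%N by near: j; exact: nbhs_infty_ge.
have p0 : (0 < p)%N by [].
(* [n] is the largest exponent with [p * 2 ^ n <= j]; maximality forces [p <= a < 2 * p], so both
   [a] and [a.+1] stay in the window. *)
pose n := trunc_log 2 (j %/ p)%N; pose a := (j %/ 2 ^ n)%N.
have jp0 : (0 < j %/ p)%N.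
  by rewrite divn_gt0//; apply: leq_trans jp; rewrite leq_pmull ?expn_gt0.
have /andP[n1 n2] : (2 ^ n <= j %/ p < 2 ^ n.+1)%N by exact: trunc_log_bounds.
have Nn : (N <= n)%N by apply: trunc_log_max => //; rewrite leq_divRL.
have t0 : (0 < 2 ^ n)%N by rewrite expn_gt0.
have pa : (p <= a)%N by rewrite /a leq_divRL// mulnC -leq_divRL.
have ap : (a < 2 * p)%N.
  by rewrite /a ltn_divLR// mulnC mulnA -expnSr -ltn_divLR.
have aj : (a * 2 ^ n <= j)%N by exact: leq_divM.
have ja : (j <= a.+1 * 2 ^ n)%N by rewrite ltnW// ltn_ceil.
have H1 := NP n a Nn; have H2 := NP n a.+1 Nn.
have {H1} : `|mu - s (a * 2 ^ n)%N / (a * 2 ^ n)%:R| <= e / 4.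
  by apply: H1; rewrite pa ltnW.
have {H2} : `|mu - s (a.+1 * 2 ^ n)%N / (a.+1 * 2 ^ n)%:R| <= e / 4.
  by apply: H2; rewrite (leq_trans pa).
have s1 := ns _ _ aj; have s2 := ns _ _ ja.
have a0 : (0 < a)%N by exact: leq_trans pa.
have K0 : 0 < (2 ^ n)%:R :> R by rewrite ltr0n.
have A0 : (p%:R : R) <= a%:R by rewrite ler_nat.
have j0 : (0 < j)%N by apply: leq_trans aj; rewrite muln_gt0 a0.
have J1 : a%:R * (2 ^ n)%:R <= j%:R :> R by rewrite -natrM ler_nat.
have J2 : j%:R <= (a%:R + 1) * (2 ^ n)%:R :> R.
  by rewrite -(natrD _ a 1) addn1 -natrM ler_nat.
rewrite !natrM -(natr1 a).
move: K0 A0 J1 J2 s1 s2 (s0 j); set K := (2 ^ n)%:R : R.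
have : 1 <= p%:R :> R by rewrite ler1n.
have : 0 < j%:R :> R by rewrite ltr0n.
move: (s j) (s (a * 2 ^ n)%N) (s (a.+1 * 2 ^ n)%N) => S Sa Sb.
move: (j%:R) (a%:R) (p%:R : R) pP => J A q pP J0 q1 K0 A0 J1 J2 s1 s2 S0.
have A1 : 0 < A by lra.
rewrite !ler_norml !lerBlDl => /andP[b2 _] /andP[_ b1].
have {}b2 : Sb <= (mu + e / 4) * ((A + 1) * K).
  by rewrite -ler_pdivrMr ?mulr_gt0//; lra.
have {}b1 : (mu - e / 4) * (A * K) <= Sa.
  by rewrite -ler_pdivlMr ?mulr_gt0//; lra.
have H0 : 4 * (mu + e) <= A * e by apply: ltW; apply: (lt_le_trans pP); nra.
have H3 : S <= (mu + e) * J.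
  apply: (le_trans s2); apply: (le_trans b2).
  apply: (@le_trans _ _ ((mu + e) * (A * K))); last by rewrite ler_wpM2l//; lra.
  rewrite !mulrA; apply: ler_wpM2r; [exact: ltW|nra].
have H4 : (mu - e) * J <= S.
  have [mue|mue] := leP mu e.
    by apply: le_trans S0; rewrite mulr_le0_ge0 ?subr_le0//; lra.
  apply: le_trans s1; apply: le_trans b1.
  apply: (@le_trans _ _ ((mu - e) * ((A + 1) * K))); first by rewrite ler_wpM2l//; lra.
  by rewrite !mulrA; apply: ler_wpM2r; [exact: ltW|nra].
have H5 : S / J <= mu + e by rewrite ler_pdivrMr.
have H6 : mu - e <= S / J by rewrite ler_pdivlMr.
by lra.
Unshelve. all: by end_near. Qed.

Section almost_sure_summable.
Context (R : realType) (dO : measure_display) (Omega : measurableType dO)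
  (P : probability Omega R).

(** By monotone convergence the series of the [D n] is integrable, hence finite almost everywhere,
    and the terms of a convergent series tend to 0. This replaces the Chebyshev and Borel-Cantelli
    pair of the usual proof of the strong law. *)
Lemma ae_cvg0_summable (D : nat -> Omega -> R) (c : R) :
  (forall n, L1 P (D n)) -> (forall n w, 0 <= D n w) ->
  (forall N, \sum_(0 <= n < N) Ex P (D n) <= c) ->
  {ae P, forall w, D n w @[n --> \oo] --> (0 : R)}.
Proof.
move=> D1 D0 Dc.
pose G w := (\sum_(n <oo) (D n w)%:E)%E.
have mD n : measurable_fun setT (EFin \o D n).
  by apply/measurable_EFinP; exact: L1_meas (D1 n).
have G0 w : (0 <= G w)%E by apply: nneseries_ge0 => n _ _; rewrite lee_fin.
have iG : P.-integrable setT G.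
  apply/integrableP; split.
    apply: (@ge0_emeasurable_sum _ _ _ _ (fun n w => (D n w)%:E) predT).
      by move=> n w _ _; rewrite lee_fin.
    by move=> n _; exact: mD.
  under eq_integral do rewrite gee0_abs//.
  rewrite /G integral_nneseries//; last by move=> n w _; rewrite lee_fin.
  apply: (@le_lt_trans _ _ c%:E); last exact: ltry.
  apply: lime_le.
    by apply: is_cvg_nneseries => n _ _; apply: integral_ge0 => w _; rewrite lee_fin.
  apply: nearW => N; have := Dc N; rewrite -lee_fin; apply: le_trans.
  rewrite -sumEFin; apply: lee_sum => n _.
  by rewrite EFin_Ex.
have := integrable_ae measurableT iG; apply: filterS => w /(_ I) Gw.
have /cvg_series_cvg_0 : cvgn (series (D ^~ w)).
  apply: nnseries_is_cvg => //; rewrite -/(G w) -ge0_fin_numE; [exact: Gw|exact: G0].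
by [].
Qed.

End almost_sure_summable.

Section truncation.
Context (R : realType).
Implicit Types (c x : R).

(** Values above [c] are sent to 0, and nothing is cut from below: the function is meant for
    nonnegative [x]. *)
Definition trunc c x : R := x * \1_`]-oo, c] x.
Definition excess c x : R := \1_`]c, +oo[ x.

Lemma truncE c x : trunc c x = if x <= c then x else 0.
Proof.
rewrite /trunc indicE; case: ifPn => xc.
  by rewrite mem_set ?mulr1//= in_itv/=.
by rewrite memNset ?mulr0//= in_itv/=; exact/negP.
Qed.

Lemma excessE c x : excess c x = if c < x then 1 else 0.
Proof.
rewrite /excess indicE; case: ltP => xc.
  by rewrite mem_set//= in_itv/= xc.
by rewrite memNset//= in_itv/= andbT ltNge xc.
Qed.

Lemma measurable_trunc c : measurable_fun setT (trunc c).
Proof. by apply: measurable_funM => //; exact: measurable_indic. Qed.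

Lemma measurable_excess c : measurable_fun setT (excess c).
Proof. exact: measurable_indic. Qed.

Lemma excess_ge0 c x : 0 <= excess c x.
Proof. by rewrite excessE; case: ifP. Qed.

Lemma trunc_bound c x : 0 <= x -> 0 <= trunc c x <= `|c|.
Proof.
move=> x0; rewrite truncE; case: ifPn => [xc|_]; last by rewrite lexx normr_ge0.
by rewrite x0 (le_trans xc)// ler_norm.
Qed.

(** The nonzero terms are the levels below [x]; they double at each step, so their sum is at most
    twice the last one. *)
Lemma dyadic_excess_sum (a : nat) x N : 0 <= x ->
  \sum_(0 <= n < N) (a * 2 ^ n)%:R * excess (a * 2 ^ n)%:R x <= 2 * x.
Proof.
(* The bound by [2 * x] alone is not inductive. The second bound says that all earlier levels
   together do not exceed the next one. *)
move=> x0; suff : \sum_(0 <= n < N) (a * 2 ^ n)%:R * excess (a * 2 ^ n)%:R x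
    <= 2 * x /\ \sum_(0 <= n < N) (a * 2 ^ n)%:R * excess (a * 2 ^ n)%:R x
    <= (a * 2 ^ N)%:R by case.
elim: N => [|N [IH1 IH2]]; first by rewrite big_nil; split; [lra|rewrite ler0n].
rewrite big_nat_recr//= excessE.
move: IH1 IH2; set S := \sum_(0 <= _ < _) _; move=> IH1 IH2.
have -> : (a * 2 ^ N.+1)%:R = 2 * (a * 2 ^ N)%:R :> R.
  by rewrite expnS mulnCA natrM.
have : 0 <= (a * 2 ^ N)%:R :> R by rewrite ler0n.
move: ((a * 2 ^ N)%:R) IH2 => k IH2 k0.
by case: ltP => kx; rewrite ?mulr1 ?mulr0 ?addr0; split; lra.
Qed.

(** Terms vanish until the level reaches [x]; from there they are halved at each step, starting from
    a value at most [x]. *)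
Lemma dyadic_trunc_sum (a : nat) x N : (0 < a)%N -> 0 <= x ->
  \sum_(0 <= n < N) trunc (a * 2 ^ n)%:R x ^+ 2 / (a * 2 ^ n)%:R <= 2 * x.
Proof.
move=> a0 x0; pose S M := \sum_(0 <= n < M) trunc (a * 2 ^ n)%:R x ^+ 2 / (a * 2 ^ n)%:R.
(* The added quantity [2 * (x ^+ 2 / (a * 2 ^ N))] is the sum of the whole geometric tail from [N]
   on; with it the bound is preserved exactly. *)
suff : ((a * 2 ^ N)%:R < x -> S N = 0) /\
    (x <= (a * 2 ^ N)%:R -> S N + 2 * (x ^+ 2 / (a * 2 ^ N)%:R) <= 2 * x).
  move=> [h1 h2]; have [/h1|/h2] := ltP (a * 2 ^ N)%:R x.
    by rewrite -/(S N) => ->; lra.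
  rewrite -/(S N); apply: le_trans; rewrite lerDl.
  apply: mulr_ge0 => //; apply: mulr_ge0; first exact: sqr_ge0.
  by rewrite invr_ge0 ler0n.
elim: N => [|N [IH1 IH2]].
  rewrite /S big_nil expn0 muln1; split => // xa; rewrite add0r.
  rewrite ler_wpM2l// ler_pdivrMr ?ltr0n// expr2.
  exact: ler_wpM2l.
have kS : (a * 2 ^ N.+1)%:R = 2 * (a * 2 ^ N)%:R :> R.
  by rewrite expnS mulnCA natrM.
have k0 : 0 < (a * 2 ^ N)%:R :> R by rewrite ltr0n muln_gt0 a0 expn_gt0.
rewrite /S big_nat_recr//= -/(S N) kS truncE.
move: ((a * 2 ^ N)%:R) (S N) IH1 IH2 k0 => k s IH1 IH2 k0.
split=> [kx|xk].
  have kx' : k < x by lra.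
  by rewrite IH1// leNgt kx'/= expr0n/= mul0r addr0.
case: ifPn => xk'.
  have := IH2 xk'; apply: le_trans; rewrite le_eqVlt; apply/orP; left; apply/eqP.
  by field; rewrite gt_eqF.
rewrite -ltNge in xk'; rewrite IH1// expr0n/= mul0r !add0r.
rewrite ler_wpM2l// ler_pdivrMr; last by lra.
by rewrite expr2 ler_wpM2l.
Qed.

End truncation.

Section same_law_transfer.
Context (R : realType) (d1 d2 : measure_display) (O1 : measurableType d1)
  (O2 : measurableType d2) (P1 : probability O1 R) (P2 : probability O2 R)
  (d' : measure_display) (T' : measurableType d').
Variables (X : O1 -> T') (Y : O2 -> T').
Hypotheses (mX : measurable_fun setT X) (mY : measurable_fun setT Y).

HB.instance Definition _ := isMeasurableFun.Build _ _ _ _ X mX.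
HB.instance Definition _ := isMeasurableFun.Build _ _ _ _ Y mY.

Hypothesis XY : forall A, measurable A -> P1 (X @^-1` A) = P2 (Y @^-1` A).

(** The two probability spaces may differ: this serves both for copies under [P] and for comparing a
    Gaussian variable under [P] with an affine function under the standard normal law. *)
Lemma same_law_L1_Ex (g : T' -> R) : measurable_fun setT g ->
  L1 P1 (g \o X) -> L1 P2 (g \o Y) /\ Ex P2 (g \o Y) = Ex P1 (g \o X).
Proof.
move=> mg gX.
have mEg : measurable_fun setT (EFin \o g) by exact/measurable_EFinP.
have gY : L1 P2 (g \o Y).
  apply/integrableP; split; first exact: (measurableT_comp mEg mY).
  move/integrableP : gX => [_].
  have -> : (\int[P1]_x `|(EFin \o (g \o X)) x|)%E =
      (\int[distribution P1 X]_y `|(g y)%:E|)%E.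
    by rewrite ge0_integral_distribution//; exact: (measurableT_comp _ mEg).
  have -> : (\int[P2]_x `|(EFin \o (g \o Y)) x|)%E =
      (\int[distribution P2 Y]_y `|(g y)%:E|)%E.
    by rewrite ge0_integral_distribution//; exact: (measurableT_comp _ mEg).
  by rewrite (eq_measure_integral (distribution P2 Y))// => A mA _; exact: XY.
split => //; apply: EFin_inj; rewrite !EFin_Ex//.
rewrite -(@integral_distribution _ _ _ _ _ P1 X (EFin \o g))//.
rewrite -(@integral_distribution _ _ _ _ _ P2 Y (EFin \o g))//.
by rewrite [RHS](eq_measure_integral (distribution P2 Y))// => A mA _; exact: XY.
Qed.

End same_law_transfer.

Lemma measurable_preimage d d' (T : measurableType d) (T' : measurableType d')
  (f : T -> T') (A : set T') :
  measurable_fun setT f -> measurable A -> measurable (f @^-1` A).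
Proof. by move=> mf mA; rewrite -[_ @^-1` _]setTI; exact: mf. Qed.

Section strong_law.
Context (R : realType) (dO : measure_display) (Omega : measurableType dO)
  (P : probability Omega R).

Lemma indep_rv_comp (X Y : Omega -> R) (g h : R -> R) :
  measurable_fun setT g -> measurable_fun setT h -> indep_rv P X Y ->
  indep_rv P (g \o X) (h \o Y).
Proof.
move=> mg mh iXY A B mA mB.
by apply: (iXY (g @^-1` A) (h @^-1` B)); exact: measurable_preimage.
Qed.

Lemma Ex_sqr_sum_uncorrelated (F : nat -> Omega -> R) n :
  (forall i, L2 P (F i)) ->
  (forall i j, i != j -> Ex P (fun w => F i w * F j w) = 0) ->
  Ex P (fun w => (\sum_(0 <= i < n) F i w) ^+ 2) =
  \sum_(0 <= i < n) Ex P (fun w => F i w ^+ 2).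
Proof.
move=> F2 F0; elim: n => [|n IH].
  rewrite big_nil -[RHS](Ex_cst P); apply: eq_Ex => w.
  by rewrite big_nil expr0n.
have S2 : L2 P (fun w => \sum_(0 <= i < n) F i w) by exact: L2_sum.
rewrite big_nat_recr//= -IH.
have -> : Ex P (fun w => (\sum_(0 <= i < n.+1) F i w) ^+ 2) =
    Ex P (fun w => ((\sum_(0 <= i < n) F i w) ^+ 2 + F n w ^+ 2) +
      2 * \sum_(0 <= i < n) F i w * F n w).
  by apply: eq_Ex => w; rewrite big_nat_recr//= -mulr_suml; ring.
have i1 : L1 P (fun w => \sum_(0 <= i < n) F i w * F n w).
  by apply: L1_sum => i _; exact: L2M.
rewrite ExD ?ExD ?ExZ//; [|by case: S2|by case: (F2 n)| |exact: L1Z]; last first.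
  by apply: L1D; [case: S2|case: (F2 n)].
rewrite Ex_sum; last by move=> i _; exact: L2M.
rewrite big_nat big1 ?mulr0 ?addr0// => i /andP[_ ni].
by rewrite F0// neq_ltn ni.
Qed.

Section nonneg.
Variable X : nat -> Omega -> R.
Hypothesis mX : forall i, measurable_fun setT (X i).
Hypothesis idX : forall i A, measurable A -> P (X 0%N @^-1` A) = P (X i @^-1` A).
Hypothesis pwX : forall i j, i != j -> indep_rv P (X i) (X j).
Hypothesis X1 : L1 P (X 0%N).
Hypothesis X0 : forall i w, 0 <= X i w.

Let Ex_id g i : measurable_fun setT g -> L1 P (g \o X 0%N) ->
  L1 P (g \o X i) /\ Ex P (g \o X i) = Ex P (g \o X 0%N).
Proof. by move=> mg g1; apply: same_law_L1_Ex => // A; exact: idX. Qed.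

(* Truncation at the level [a * 2 ^ n]: the expected number of truncated terms
   and the variance of the truncated mean are both summable in [n]. *)
Lemma slln_nonneg_dyadic a : (0 < a)%N ->
  {ae P, forall w, (fun n => (\sum_(0 <= i < a * 2 ^ n) X i w) / (a * 2 ^ n)%:R)
    @ \oo --> Ex P (X 0%N)}.
Proof.
move=> a0; pose k n := (a * 2 ^ n)%N; pose c n : R := (k n)%:R.
have c0 n : 0 < c n by rewrite ltr0n muln_gt0 a0 expn_gt0.
pose m n := Ex P (trunc (c n) \o X 0%N).
have mtr n i : measurable_fun setT (trunc (c n) \o X i).
  by apply: measurableT_comp (mX i); exact: measurable_trunc.
have trB n i w : 0 <= trunc (c n) (X i w) <= c n.
  by have := trunc_bound (c n) (X0 i w); rewrite (gtr0_norm (c0 n)).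
have tr2 n i : L2 P (trunc (c n) \o X i).
  apply: (@L2_bdd _ _ _ _ _ (c n)) => // w /=.
  by have /andP[h1 h2] := trB n i w; rewrite ger0_norm.
have mEx n i : measurable_fun setT (excess (c n) \o X i).
  by apply: measurableT_comp (mX i); exact: measurable_excess.
have ex1 n i : L1 P (excess (c n) \o X i).
  apply: (@L1_bdd _ _ _ _ _ 1) => // w /=.
  by rewrite excessE; case: ifP; rewrite ?normr1 ?normr0.
have mE n i : Ex P (trunc (c n) \o X i) = m n.
  by apply: (Ex_id _ _ _).2; [exact: measurable_trunc|exact: L2_L1].
pose F n i w := trunc (c n) (X i w) - m n.
have F2 n i : L2 P (F n i) by apply: L2B; [exact: tr2|exact: L2_cst].
have F0 n i : Ex P (F n i) = 0.
  rewrite ExB ?Ex_cst//; [|exact: L2_L1 (tr2 n i)|exact: L1_cst].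
  by rewrite (mE n i) subrr.
have FF n i j : i != j -> Ex P (fun w => F n i w * F n j w) = 0.
  move=> ij; rewrite Ex_mul_indep// ?F0 ?mulr0//.
  pose g x := trunc (c n) x - m n.
  have mg : measurable_fun setT g.
    by apply: measurable_funB => //; exact: measurable_trunc.
  exact: (indep_rv_comp mg mg (pwX ij)).
(* One quantity controls both errors: the number of truncated terms plus the squared deviation of
   the truncated mean. Once [D n w < 1], no term at all has been truncated. *)
pose D n w := \sum_(0 <= i < k n) excess (c n) (X i w) +
  ((\sum_(0 <= i < k n) F n i w) / c n) ^+ 2.
have SF2 n : L2 P (fun w => (\sum_(0 <= i < k n) F n i w) / c n).
  apply: (@eq_L2 _ _ _ _ (fun w => (c n)^-1 * \sum_(0 <= i < k n) F n i w)).
    by move=> w; rewrite mulrC.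
  by apply: L2Z; exact: L2_sum.
have D1 n : L1 P (D n).
  apply: L1D; first by apply: L1_sum => i _; exact: ex1.
  by case: (SF2 n).
have D0 n w : 0 <= D n w.
  by rewrite addr_ge0 ?sqr_ge0// sumr_ge0// => i _; exact: excess_ge0.
(* Equal laws and pairwise independence bound the expectation of [D n] by that of [H n], which
   involves [X 0] only; pointwise, the two dyadic sums bound the series of the [H n] by
   [4 * X 0]. *)
pose H n w := c n * excess (c n) (X 0%N w) + trunc (c n) (X 0%N w) ^+ 2 / c n.
have tr2' n : L1 P (fun w => trunc (c n) (X 0%N w) ^+ 2 / c n).
  apply: (@eq_L1 _ _ _ _ (fun w => (c n)^-1 * trunc (c n) (X 0%N w) ^+ 2)).
    by move=> w; rewrite mulrC.
  by apply: L1Z; case: (tr2 n 0%N).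
have H1 n : L1 P (H n).
  by apply: L1D => //; apply: L1Z; exact: ex1.
have DH n : Ex P (D n) <= Ex P (H n).
  rewrite /D /H !ExD//; last 3 first.
  - by apply: L1Z; exact: ex1.
  - by apply: L1_sum => i _; exact: ex1.
  - by case: (SF2 n).
  apply: lerD.
    rewrite Ex_sum; last by move=> i _; exact: ex1.
    rewrite ExZ; last exact: ex1.
    rewrite (eq_bigr (fun=> Ex P (excess (c n) \o X 0%N))).
      by rewrite sumr_const_nat subn0 /c mulr_natl.
    by move=> i _; apply: (Ex_id _ _ _).2; [exact: measurable_excess|exact: ex1].
  have -> : Ex P (fun w => ((\sum_(0 <= i < k n) F n i w) / c n) ^+ 2) =
      (c n ^+ 2)^-1 * \sum_(0 <= i < k n) Ex P (fun w => F n i w ^+ 2).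
    rewrite -Ex_sqr_sum_uncorrelated//; last by move=> i j; exact: FF.
    have [_ SQ2] : L2 P (fun w => \sum_(0 <= i < k n) F n i w) by exact: L2_sum.
    rewrite -ExZ; last exact: SQ2.
    by apply: eq_Ex => w; rewrite exprMn exprVn mulrC.
  have FE i : Ex P (fun w => F n i w ^+ 2) <= Ex P (fun w => trunc (c n) (X 0%N w) ^+ 2).
    have -> : Ex P (fun w => F n i w ^+ 2) =
        Ex P (fun w => (trunc (c n) (X i w) ^+ 2 - 2 * m n * trunc (c n) (X i w)) + m n ^+ 2).
      by apply: eq_Ex => w; rewrite /F; ring.
    have t1 := L2_L1 (tr2 n i); have [_ t2] := tr2 n i.
    rewrite ExD; [|by apply: L1B => //; exact: L1Z|exact: L1_cst].
    rewrite ExB//; last exact: L1Z.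
    rewrite ExZ// Ex_cst (mE n i).
    have mg : measurable_fun setT (fun x => trunc (c n) x ^+ 2).
      by apply: measurable_funX; exact: measurable_trunc.
    have -> : Ex P (fun w => trunc (c n) (X i w) ^+ 2) =
        Ex P (fun w => trunc (c n) (X 0%N w) ^+ 2).
      by apply: (Ex_id i mg _).2; case: (tr2 n 0%N).
    by have := sqr_ge0 (m n); nra.
  rewrite -[leRHS](_ : (c n ^+ 2)^-1 *
      (c n * Ex P (fun w => trunc (c n) (X 0%N w) ^+ 2)) = _); last first.
    transitivity (Ex P (fun w => (c n)^-1 * trunc (c n) (X 0%N w) ^+ 2)).
      rewrite ExZ; last by case: (tr2 n 0%N).
      by field; rewrite gt_eqF ?c0.
    by apply: eq_Ex => w; rewrite mulrC.
  apply: ler_wpM2l; first by rewrite invr_ge0 sqr_ge0.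
  apply: (le_trans (ler_sum _ (fun i _ => FE i))).
  by rewrite sumr_const_nat subn0 /c mulr_natl.
have mcv : m n @[n --> \oo] --> Ex P (X 0%N).
  have [||||_] := @Ex_dom_cvg _ _ _ P (fun n => trunc (c n) \o X 0%N) (X 0%N) (X 0%N) _ _ X1.
  - by move=> n; exact: mtr.
  - exact: mX.
  - move=> n w /=; rewrite truncE; case: ifP => _; first by rewrite ger0_norm.
    by rewrite normr0.
  - move=> w; apply/cvgrPdist_le => e e0; near=> n => /=.
    suff Xc : X 0%N w <= c n by rewrite truncE Xc subrr normr0 ltW.
    apply: (@le_trans _ _ n%:R); first by near: n; exact: nbhs_infty_ger.
    rewrite ler_nat /k (leq_trans (ltnW (ltn_expl n (ltnSn 1))))//.
    by rewrite leq_pmull.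
  by [].
have /(ae_cvg0_summable D1 D0) : forall N, \sum_(0 <= n < N) Ex P (D n) <= 4 * Ex P (X 0%N).
  move=> N; apply: (le_trans (ler_sum _ (fun n _ => DH n))).
  rewrite -Ex_sum// -ExZ//; apply: Ex_le; [exact: L1_sum|exact: L1Z|move=> w].
  rewrite big_split/=.
  have := dyadic_excess_sum a N (X0 0%N w).
  have := dyadic_trunc_sum N a0 (X0 0%N w).
  by rewrite /c /k; lra.
apply: filterS => w Dw.
have Fw : (\sum_(0 <= i < k n) F n i w) / c n @[n --> \oo] --> (0 : R).
  apply/cvgrPdist_lt => /= e e0.
  have e20 : 0 < e ^+ 2 by rewrite exprn_gt0.
  move/cvgrPdist_lt : Dw => /(_ _ e20); apply: filterS => n /=.
  rewrite !sub0r !normrN ger0_norm// => De.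
  rewrite -ltr_sqr ?nnegrE ?normr_ge0 ?ltW// real_normK ?num_real//.
  apply: le_lt_trans De; rewrite /D lerDr sumr_ge0// => i _; exact: excess_ge0.
have : (\sum_(0 <= i < k n) F n i w) / c n + m n @[n --> \oo] --> 0 + Ex P (X 0%N).
  exact: cvgD.
rewrite add0r; apply: cvg_trans; apply: near_eq_cvg.
move/cvgrPdist_lt : Dw => /(_ _ ltr01); apply: filterS => n /=.
rewrite sub0r normrN ger0_norm// => De.
have Xc i : (i < k n)%N -> X i w <= c n.
  move=> ik; rewrite leNgt; apply/negP => cX.
  move: De; apply/negP; rewrite -leNgt.
  apply: (@le_trans _ _ (excess (c n) (X i w))); first by rewrite excessE cX.
  apply: (@le_trans _ _ (\sum_(0 <= i < k n) excess (c n) (X i w))).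
    rewrite big_mkord (bigD1 (Ordinal ik))//= lerDl.
    by apply: sumr_ge0 => j _; exact: excess_ge0.
  by rewrite lerDl sqr_ge0.
have -> : \sum_(0 <= i < k n) F n i w = \sum_(0 <= i < k n) X i w - c n * m n.
  rewrite /F big_split/= sumr_const_nat subn0 mulNrn /c mulr_natl; congr (_ - _).
  by rewrite big_nat [RHS]big_nat; apply: eq_bigr => i /andP[_ ik]; rewrite truncE Xc.
by rewrite /c -/(k n); field; rewrite gt_eqF//; exact: c0.
Unshelve. all: by end_near. Qed.

Lemma slln_nonneg : {ae P, forall w,
  (fun n => (\sum_(0 <= i < n) X i w) / n%:R) @ \oo --> Ex P (X 0%N)}.
Proof.
have : {ae P, forall w, forall a, (fun n => (\sum_(0 <= i < a.+1 * 2 ^ n) X i w) /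
    (a.+1 * 2 ^ n)%:R) @ \oo --> Ex P (X 0%N)}.
  by apply: ae_foralln => a; exact: slln_nonneg_dyadic.
apply: filterS => w cw; apply: cvg_dyadic_interpolation.
- by move=> i j ij; rewrite [leRHS](big_cat_nat (leq0n i) ij)/= lerDl sumr_ge0.
- by move=> j; rewrite sumr_ge0.
- exact: Ex_ge0.
- by case=> // a _; exact: cw.
Qed.

End nonneg.

(** Positive and negative parts inherit equality of laws and pairwise independence, so the
    nonnegative case applies to each. Pairwise independence suffices because the only joint quantity
    computed is the variance of a truncated sum. *)
Theorem strong_law_large_numbers (X : nat -> Omega -> R) :
  (forall i, measurable_fun setT (X i)) ->
  (forall i A, measurable A -> P (X 0%N @^-1` A) = P (X i @^-1` A)) ->
  (forall i j, i != j -> indep_rv P (X i) (X j)) ->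
  L1 P (X 0%N) ->
  {ae P, forall w, (fun n => (\sum_(0 <= i < n) X i w) / n%:R) @ \oo --> Ex P (X 0%N)}.
Proof.
move=> mX idX pwX X1.
pose p (x : R) := Num.max x 0; pose q (x : R) := Num.max (- x) 0.
have mp : measurable_fun setT p by exact: measurable_maxr.
have mq : measurable_fun setT q by apply: measurable_maxr => //; exact: measurable_oppr.
have pq x : x = p x - q x.
  rewrite /p /q /Num.max; case: ltP => h1; case: ltP => h2; lra.
have h (g : R -> R) : measurable_fun setT g -> (forall x, 0 <= g x <= `|x|) ->
    {ae P, forall w, (fun n => (\sum_(0 <= i < n) g (X i w)) / n%:R) @ \oo -->
      Ex P (g \o X 0%N)} /\ L1 P (g \o X 0%N).
  move=> mg g0.
  have mgX i : measurable_fun setT (g \o X i) by exact: measurableT_comp (mX i).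
  have gX1 : L1 P (g \o X 0%N).
    apply: (L1_dom (mgX 0%N) (L1_abs X1)) => w /=.
    by have /andP[h1 h2] := g0 (X 0%N w); rewrite ger0_norm.
  split => //; apply: (@slln_nonneg (fun i => g \o X i)) => //.
  - by move=> i A mA; apply: (idX i (g @^-1` A)); exact: measurable_preimage.
  - by move=> i j ij; apply: indep_rv_comp => //; exact: pwX.
  - by move=> i w /=; have /andP[] := g0 (X i w).
have [|cp p1] := h p mp.
  by move=> x; rewrite /p le_max lexx orbT ge_max ler_norm normr_ge0.
have [|cq q1] := h q mq.
  by move=> x; rewrite /q le_max lexx orbT ge_max -normrN ler_norm normr_ge0.
have -> : Ex P (X 0%N) = Ex P (p \o X 0%N) - Ex P (q \o X 0%N).
  by rewrite -ExB//; apply: eq_Ex => w /=; rewrite -pq.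
move: cq; apply: filterS2 cp => w cp cq;
have -> : (fun n => (\sum_(0 <= i < n) X i w) / n%:R) =
    (fun n => (\sum_(0 <= i < n) p (X i w)) / n%:R - (\sum_(0 <= i < n) q (X i w)) / n%:R).
  apply/funext => n; rewrite -mulrBl -sumrB.
  by congr (_ / _); apply: eq_bigr => i _; rewrite -pq.
exact: cvgB.
Qed.

End strong_law.

(** * Gaussian variables *)

Section normal_law.
Context (R : realType).
Notation N01 := (normal_prob (0 : R) 1).

(** Half-open intervals are closed under intersection, generate the Borel sets and exhaust the
    line. *)
Lemma probability_ocitv_unique (m1 m2 : probability (measurableTypeR R) R) :
  (forall a b, m1 `]a, b]%classic = m2 `]a, b]%classic) ->
  forall A : set R, measurable A -> m1 A = m2 A.
Proof.
move=> m12 A mA; apply: (@g_sigma_algebra_measure_unique _ _ (measurableTypeR R) (@ocitv R) _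
  (fun k => `]- k%:R, k%:R]%classic)) => //.
- by move=> _ [x _ <-]; exact: measurable_itv.
- by move=> i; exact: is_ocitv.
- rewrite -subTset => x _; exists (Num.bound `|x|) => //=; rewrite in_itv/=.
  have := archi_boundP (normr_ge0 x).
  by rewrite ltr_norml => /andP[-> /ltW].
- exact: ocitvI.
- by move=> _ [x _ <-]; exact: m12.
- by move=> k; rewrite (le_lt_trans (probability_le1 _ _))// ltry.
Qed.

Lemma normal_pdf_affine (m s y : R) : 0 < s ->
  normal_pdf m s (m + s * y) * s = normal_pdf 0 1 y.
Proof.
move=> s0; rewrite !normal_pdfE ?gt_eqF//= /normal_peak /normal_fun.
rewrite expr1n mul1r subr0 -mulrnAr sqrtrM ?sqr_ge0// sqrtr_sqr gtr0_norm//.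
have -> : - (m + s * y - m) ^+ 2 / (s ^+ 2 *+ 2) = - y ^+ 2 / 2.
  by field; exact: lt0r_neq0.
by rewrite invfM mulrC !mulrA mulfV ?mul1r// gt_eqF.
Qed.

Lemma normal_prob_oppr_scale (m s : R) A : normal_prob m (- s) A = normal_prob m s A.
Proof.
rewrite /normal_prob /normal_pdf oppr_eq0; apply: eq_integral => x _.
by rewrite /normal_peak /normal_fun sqrrN.
Qed.

Lemma integral_normal_affine (m s a b : R) : 0 < s -> a <= b ->
  normal_prob m s `]m + s * a, m + s * b] = N01 `]a, b].
Proof.
move=> s0 ab; rewrite /normal_prob.
have mpdf u v (D : set R) : measurable_fun D (fun x => (normal_pdf u v x)%:E).
  by apply/measurable_EFinP; apply: measurable_funTS; exact: measurable_normal_pdf.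
rewrite !integral_itv_obnd_cbnd//.
pose F y := m + s * y.
have F'E : F^`()%classic = cst s.
  apply/funext => x; rewrite /F derive1E deriveD// derive_cst add0r.
  by rewrite deriveZ// derive_id scaler1.
rewrite (@integration_by_substitution_increasing _ F)//.
- by apply: eq_integral => x _; rewrite F'E -(@normal_pdf_affine m s x).
- by move=> x y _ _ xy; rewrite /F ltrD2l ltr_pM2l.
- by rewrite F'E => ? _; exact: cvg_cst.
- by rewrite F'E; exact: is_cvg_cst.
- by rewrite F'E; exact: is_cvg_cst.
- split.
  + by move=> x _; apply: derivableD => //; apply: derivableZ.
  + apply: cvg_at_right_filter; apply: cvgD; first exact: cvg_cst.
    by apply: cvgM; [exact: cvg_cst|exact: cvg_id].
  + apply: cvg_at_left_filter; apply: cvgD; first exact: cvg_cst.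
    by apply: cvgM; [exact: cvg_cst|exact: cvg_id].
- apply: continuous_subspaceT; apply: continuous_normal_pdf.
  by rewrite gt_eqF.
Qed.

Lemma normal01_sym_itv (a b : R) : a <= b -> N01 `[-b, -a] = N01 `[a, b].
Proof.
move=> ab; rewrite /normal_prob integration_by_substitution_oppr//.
  apply: eq_integral => x _; rewrite /= !normal_pdfE//.
  by rewrite /normal_fun !subr0 sqrrN.
by apply: continuous_subspaceT; apply: continuous_normal_pdf.
Qed.

Lemma normal_prob_affine (m s : R) (A : set R) : 0 < s -> measurable A ->
  normal_prob m s A = N01 ((fun y => m + s * y) @^-1` A).
Proof.
move=> s0 mA; pose F (y : measurableTypeR R) : measurableTypeR R := m + s * y.
have mF : measurable_fun setT F.
  by apply: measurable_funD => //; exact: measurable_funM.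
pose F' : {mfun measurableTypeR R >-> measurableTypeR R} :=
  HB.pack F (isMeasurableFun.Build _ _ _ _ F mF).
have := @probability_ocitv_unique (normal_prob m s) (distribution N01 F').
apply=> // a b; rewrite /distribution/= /pushforward.
have -> : F @^-1` `]a, b]%classic = `](a - m) / s, (b - m) / s]%classic.
  apply/seteqP; split => y /=; rewrite !in_itv/= /F ltr_pdivrMr// ler_pdivlMr//;
  by rewrite ltrBlDl lerBrDl [y * s]mulrC.
have aE : a = m + s * ((a - m) / s) by field; exact: lt0r_neq0.
have bE : b = m + s * ((b - m) / s) by field; exact: lt0r_neq0.
have [ab|ba] := leP a b.
  rewrite {1}aE {1}bE integral_normal_affine//.
  by rewrite ler_pM2r ?invr_gt0// lerD2r.
rewrite !set_itv_ge ?measure0// bnd_simp -leNgt; last exact: ltW.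
by rewrite ler_pM2r ?invr_gt0// lerD2r ltW.
Qed.

Lemma normal01_opp (A : set R) : measurable A -> N01 (-%R @^-1` A) = N01 A.
Proof.
move=> mA; pose F (y : measurableTypeR R) : measurableTypeR R := - y.
have mF : measurable_fun setT F by exact: oppr_measurable.
pose F' : {mfun measurableTypeR R >-> measurableTypeR R} :=
  HB.pack F (isMeasurableFun.Build _ _ _ _ F mF).
have := @probability_ocitv_unique (distribution N01 F') N01.
apply=> // a b; rewrite /distribution/= /pushforward.
have -> : F @^-1` `]a, b]%classic = `[- b, - a[%classic.
  by apply/seteqP; split => y /=; rewrite !in_itv/= /F => /andP[h1 h2]; lra.
have [ab|ba] := leP a b; last first.
  by rewrite !set_itv_ge ?measure0// bnd_simp -leNgt ?lerN2 ltW.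
have mpdf u v (D : set R) : measurable_fun D (fun x => (normal_pdf u v x)%:E).
  by apply/measurable_EFinP; apply: measurable_funTS; exact: measurable_normal_pdf.
rewrite /normal_prob integral_itv_bndo_bndc// integral_itv_obnd_cbnd//.
exact: normal01_sym_itv.
Qed.

(** A zero second moment would concentrate the law at 0, a null set for a density. Positivity is
    enough to recover the scale of a Gaussian variable from its variance, so the value of the moment
    is never computed. *)
Lemma Ex_normal01_sqr_gt0 : L1 N01 (fun y : R => y ^+ 2) ->
  0 < Ex N01 (fun y : R => y ^+ 2).
Proof.
move=> i2; rewrite lt0r Ex_ge0 ?andbT; last by move=> y; exact: sqr_ge0.
apply/eqP => e0.
have : (\int[N01]_y `|(y ^+ 2)%:E| = 0)%E.
  rewrite -[RHS](congr1 EFin e0) EFin_Ex//.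
  by apply: eq_integral => y _; rewrite /= ger0_norm ?sqr_ge0.
have m2 : measurable_fun setT (fun y : R => (y ^+ 2)%:E) by exact: measurable_int i2.
move/(iffLR (ae_eq_integral_abs N01 measurableT m2)) => [A [mA A0 sA]].
have : N01 setT = 0%E.
  apply/eqP; rewrite eq_le measure_ge0 andbT.
  have <- : N01 ([set 0%R] `|` A) = 0%E.
    have h0 : N01 [set 0%R] = 0%E by rewrite /normal_prob integral_set1.
    by apply: null_set_setU.
  apply: le_measure; rewrite ?inE//; first exact: measurableU.
  move=> y _ /=; have [->|y0] := eqVneq y 0; [by left|right].
  apply: sA => /= /(_ I) /eqP; rewrite eqe sqrf_eq0; exact/negP.
by rewrite probability_setT => /eqP; rewrite onee_eq0.
Qed.

Lemma Ex_normal01_id : L1 N01 (fun y : R => y) -> Ex N01 (fun y : R => y) = 0.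
Proof.
move=> i1.
have mF : measurable_fun setT (fun y : measurableTypeR R => - y : measurableTypeR R).
  exact: oppr_measurable.
have mI : measurable_fun setT (fun y : measurableTypeR R => y) by exact: measurable_id.
have [||_] := @same_law_L1_Ex _ _ _ _ _ N01 N01 _ _ _ _ mI mF _ (fun y => y) _ i1.
- by move=> A mA; exact/esym/normal01_opp.
- exact: measurable_id.
have -> : Ex N01 ((fun y => y) \o (fun y : R => - y)) = - Ex N01 (fun y : R => y).
  by rewrite -mulN1r -ExZ//; apply: eq_Ex => y; rewrite mulN1r.
by move=> h; change (- Ex N01 (fun y : R => y) = Ex N01 (fun y : R => y)) in h; lra.
Qed.

End normal_law.

Section gaussian_centered_law.
Context (R : realType) (dO : measure_display) (Omega : measurableType dO)
  (P : probability Omega R).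
Notation N01 := (normal_prob (0 : R) 1).
Notation sqN := (Ex N01 (fun y : R => y ^+ 2)).

(** Pushing the standard normal law through [m + s * y] covers both clauses of [gaussian_rv], the
    scale 0 giving the Dirac mass. *)
Lemma gaussian_rv_affine (X : Omega -> R) : gaussian_rv P X ->
  exists m s : R, 0 <= s /\ forall A, measurable A ->
    P (X @^-1` A) = N01 ((fun y => m + s * y) @^-1` A).
Proof.
move=> [m [s XP]]; exists m, `|s|; split => // A mA; rewrite XP//.
have [->|s0] := eqVneq s 0.
  rewrite normr0 diracE; have [mA'|mA'] := boolP (m \in A).
    rewrite (_ : _ @^-1` _ = setT) ?probability_setT//.
    by apply/seteqP; split => // y _ /=; rewrite mul0r addr0 -in_setE.
  rewrite (_ : _ @^-1` _ = set0) ?measure0//.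
  by apply/seteqP; split => // y /=; rewrite mul0r addr0 -in_setE (negbTE mA').
rewrite -normal_prob_affine ?normr_gt0//.
by have [_|_] := ger0P s => //; rewrite normal_prob_oppr_scale.
Qed.

(** Integrability of [y] and [y ^+ 2] under the standard normal law is drawn from [X] itself by
    undoing the affine map, which requires [0 < s]. For this reason the positivity of [sqN] comes
    with that condition. *)
Lemma gaussian_rv_centered (X : Omega -> R) : gaussian_rv P X -> L2 P X ->
  exists s : R, [/\ 0 <= s, Ex P (fun w => (X w - Ex P X) ^+ 2) = s ^+ 2 * sqN,
    0 < s -> 0 < sqN & forall A, measurable A ->
    P ((fun w => X w - Ex P X) @^-1` A) = N01 ((fun y => s * y) @^-1` A)].
Proof.
move=> /gaussian_rv_affine[m [s [s0 XP]]] X2; exists s.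
have X1 := L2_L1 X2; have mX := L1_meas X1.
have mY : measurable_fun setT (fun y : measurableTypeR R => m + s * y : measurableTypeR R).
  by apply: measurable_funD => //; exact: measurable_funM.
have msq : measurable_fun setT (fun x : R => (x - m) ^+ 2).
  by apply: measurable_funX; exact: measurable_funB.
have [Y1 YE] : L1 N01 (fun y : R => m + s * y) /\ Ex N01 (fun y : R => m + s * y) = Ex P X.
  exact: (same_law_L1_Ex mX mY XP (@measurable_id _ _ _) X1).
have [Z1 ZE] : L1 N01 (fun y : R => (m + s * y - m) ^+ 2) /\
    Ex N01 (fun y : R => (m + s * y - m) ^+ 2) = Ex P (fun w => (X w - m) ^+ 2).
  apply: (same_law_L1_Ex mX mY XP msq).
  by have [_] := L2B X2 (L2_cst P m).
have i1 : 0 < s -> L1 N01 (fun y : R => y).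
  move=> s1; have e : L1 N01 (fun y : R => s^-1 * ((m + s * y) - m)).
    by apply: L1Z; apply: L1B => //; exact: L1_cst.
  by apply: eq_L1 e => y; field; exact: lt0r_neq0.
have i2 : 0 < s -> L1 N01 (fun y : R => y ^+ 2).
  move=> s1; have e : L1 N01 (fun y : R => s^-1 ^+ 2 * ((m + s * y) - m) ^+ 2).
    exact: L1Z.
  by apply: eq_L1 e => y; field; exact: lt0r_neq0.
have mE : Ex P X = m.
  rewrite -YE; move: s0; rewrite le_eqVlt => /predU1P[<-|s1].
    by rewrite -[RHS](Ex_cst N01); apply: eq_Ex => y; rewrite mul0r addr0.
  rewrite ExD ?Ex_cst ?ExZ ?Ex_normal01_id ?mulr0 ?addr0//; try exact: i1.
    exact: L1_cst.
  by apply: L1Z; exact: i1.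
split => //.
- rewrite mE -ZE; move: s0; rewrite le_eqVlt => /predU1P[<-|s1].
    rewrite expr0n mul0r -[RHS](Ex_cst N01); apply: eq_Ex => y.
    by rewrite mul0r addr0 subrr expr0n.
  rewrite -ExZ; last exact: i2.
  by apply: eq_Ex => y; rewrite addrC addKr exprMn.
- by move=> s1; apply: Ex_normal01_sqr_gt0; exact: i2.
- move=> A mA; rewrite mE.
  have := XP ((fun x => x - m) @^-1` A).
  rewrite -[X in P X]/((fun w => X w - m) @^-1` A) => ->.
    by congr (N01 _); apply/seteqP; split => y /=; rewrite addrC addKr.
  by apply: measurable_preimage mA; exact: measurable_funB.
Qed.

Lemma gaussian_rv_centered_law (X Y : Omega -> R) :
  gaussian_rv P X -> gaussian_rv P Y -> L2 P X -> L2 P Y ->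
  Ex P (fun w => (X w - Ex P X) ^+ 2) = Ex P (fun w => (Y w - Ex P Y) ^+ 2) ->
  forall A, measurable A ->
  P ((fun w => X w - Ex P X) @^-1` A) = P ((fun w => Y w - Ex P Y) @^-1` A).
Proof.
move=> gX gY X2 Y2 V A mA.
have [s [s0 Vs sp sP]] := gaussian_rv_centered gX X2.
have [t [t0 Vt tp tP]] := gaussian_rv_centered gY Y2.
suff st : s = t by rewrite sP// tP// st.
have : s ^+ 2 * sqN = t ^+ 2 * sqN by rewrite -Vs -Vt.
(* If both scales are 0, nothing is known of [sqN], which could be a default value; but if [sqN] is
   0, both scales must be 0. *)
have [k0|k0] := eqVneq sqN 0.
  have h (u : R) : 0 <= u -> (0 < u -> 0 < sqN) -> u = 0.
    by rewrite le_eqVlt => /predU1P[<-//|u0 /(_ u0)]; rewrite k0 ltxx.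
  by move=> _; rewrite (h s)// (h t).
by move=> /(mulIf k0)/eqP; rewrite eqrXn2// => /eqP.
Qed.

Lemma gaussian_rv_Ex (X Y : Omega -> R) (g : R -> R) (c : R) :
  gaussian_rv P X -> gaussian_rv P Y -> L2 P X -> L2 P Y ->
  Ex P (fun w => (X w - Ex P X) ^+ 2) = Ex P (fun w => (Y w - Ex P Y) ^+ 2) ->
  measurable_fun setT g -> (forall x, `|g x| <= c) ->
  Ex P (fun w => g (X w - Ex P X)) = Ex P (fun w => g (Y w - Ex P Y)).
Proof.
move=> gX gY X2 Y2 V mg gc.
have [mX _] := L2B X2 (L2_cst P (Ex P X)).
have [mY _] := L2B Y2 (L2_cst P (Ex P Y)).
have law := gaussian_rv_centered_law gX gY X2 Y2 V.
have [|//] := same_law_L1_Ex mX mY law mg.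
by apply: (@L1_bdd _ _ _ _ _ c) => [|w]; [exact: (measurableT_comp mg mX)|exact: gc].
Qed.

End gaussian_centered_law.

Section sign_approximation.
Context (R : realType).

(* Its iterates are polynomials that converge to the sign function on [-1, 1]. *)
Definition sign_step (u : R) : R := (3 * u - u ^+ 3) / 2.

Lemma sign_step_bound u : `|u| <= 1 -> `|sign_step u| <= 1.
Proof.
rewrite /sign_step !ler_norml => /andP[h1 h2].
(* This product equals [2 - 3 * u + u ^+ 3], that is, twice [1 - sign_step u]; [p2] is its mirror
   image at [-1]. *)
have p1 : 0 <= (1 - u) ^+ 2 * (u + 2) by rewrite mulr_ge0 ?sqr_ge0//; lra.
have p2 : 0 <= (1 + u) ^+ 2 * (2 - u) by rewrite mulr_ge0 ?sqr_ge0//; lra.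
by apply/andP; split; nra.
Qed.

Lemma iter_sign_step_bound n u : `|u| <= 1 -> `|iter n sign_step u| <= 1.
Proof. by move=> u1; elim: n => //= n; exact: sign_step_bound. Qed.

Lemma iter_sign_stepN n u : iter n sign_step (- u) = - iter n sign_step u.
Proof.
elim: n => //= n ->; rewrite /sign_step; move: (iter _ _ _) => v.
by field.
Qed.

Lemma cvg_iter_sign_step_pos u : 0 < u <= 1 ->
  iter n sign_step u @[n --> \oo] --> (1 : R).
Proof.
move=> /andP[u0 u1].
(* The distance to 1 is multiplied at each step by [(1 - v) * (2 + v) / 2], at most [1 - v / 2].
   Iterates stay above [u], so the convergence is geometric with ratio [1 - u / 2]. *)
have H n : u <= iter n sign_step u <= 1 /\
    1 - iter n sign_step u <= (1 - u / 2) ^+ n.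
  elim: n => /= [|n [/andP[h1 h2] h3]]; first by rewrite lexx u1 expr0 lerBlDr lerDl ltW.
  move: (iter n sign_step u) h1 h2 h3 => v h1 h2 h3; rewrite /sign_step; split.
    have p1 : 0 <= (1 - v) ^+ 2 * (v + 2) by rewrite mulr_ge0 ?sqr_ge0//; lra.
    have p2 : 0 <= v * ((1 - v) * (1 + v)) by rewrite mulr_ge0 ?mulr_ge0//; lra.
    by apply/andP; split; nra.
  rewrite [leRHS]exprSr.
  have -> : 1 - (3 * v - v ^+ 3) / 2 = (1 - v) * ((1 - v) * (2 + v) / 2) by field.
  apply: ler_pM => //; first lra.
    by rewrite divr_ge0// mulr_ge0; lra.
  by nra.
have c0 : (1 - u / 2) ^+ n @[n --> \oo] --> (0 : R).
  by apply: cvg_expr; rewrite ger0_norm; lra.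
apply/cvgrPdist_le => /= e e0; move/cvgrPdist_le : c0 => /(_ _ e0).
apply: filterS => n /=; have [/andP[h1 h2] h3] := H n.
rewrite sub0r normrN ger0_norm ?exprn_ge0//; last by lra.
by rewrite ger0_norm ?subr_ge0//; exact: le_trans.
Qed.

Lemma cvg_iter_sign_step u : `|u| <= 1 ->
  iter n sign_step u @[n --> \oo] --> Num.sg u.
Proof.
rewrite ler_norml => /andP[u1 u2]; have [u0|u0|->] := ltgtP u 0.
- rewrite ltr0_sg// -[u]opprK.
  have -> : (fun n => iter n sign_step (- - u)) = (fun n => - iter n sign_step (- u)).
    by apply/funext => n; rewrite iter_sign_stepN.
  by apply: cvgN; apply: cvg_iter_sign_step_pos; lra.
- by rewrite gtr0_sg//; apply: cvg_iter_sign_step_pos; rewrite u0.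
- rewrite sgr0 (_ : (fun n => _) = fun=> 0); first exact: cvg_cst.
  apply/funext; elim => //= n ->; rewrite /sign_step expr0n/=; lra.
Qed.

(** The sequence is eventually constant: the sine is positive on []0, 2[], so it has the sign of its
    argument as soon as the argument is less than 2 in absolute value. *)
Lemma cvg_sg_sin_scaled (x : R) :
  Num.sg (sin (n.+1%:R^-1 * x)) @[n --> \oo] --> Num.sg x.
Proof.
have pos (y : R) : 0 < y -> \forall n \near \oo, 0 < sin (n.+1%:R^-1 * y).
  move=> y0; near=> n; apply: sin2_gt0; rewrite mulr_gt0//=.
  rewrite mulrC ltr_pdivrMr// (@le_lt_trans _ _ n%:R)//.
    by near: n; exact: nbhs_infty_ger.
  by rewrite -natr1; have : 0 <= n%:R :> R by []; lra.
apply: cvg_near_cst; have [x0|x0|->] := ltgtP x 0.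
- have := pos (- x); rewrite oppr_gt0 => /(_ x0); apply: filterS => n.
  by rewrite mulrN sinN oppr_gt0 => h; rewrite !ltr0_sg.
- by have := pos x x0; apply: filterS => n h; rewrite !gtr0_sg.
- by apply: nearW => n; rewrite mulr0 sin0.
Unshelve. all: by end_near. Qed.

End sign_approximation.

(** * Fourier uniqueness in real form: from trigonometric functions to indicators *)

Section trigonometric_determinacy.
Context (R : realType) (dO : measure_display) (Omega : measurableType dO)
  (P : probability Omega R) (m : nat).
Variables (V : Omega -> R) (U : 'I_m -> Omega -> R).
Hypotheses (V1 : L1 P V) (mU : forall j, measurable_fun setT (U j)).

Let lin (t : 'I_m -> R) w := \sum_j t j * U j w.

Let mlin t : measurable_fun setT (lin t).
Proof. by apply: measurable_sum => j; exact: measurable_funM. Qed.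

(** In other words, the image under [U] of the signed measure with density [V * h] has zero Fourier
    transform. The bound on [h] provides integrability and domination. *)
Definition trig_orthogonal (h : Omega -> R) :=
  [/\ measurable_fun setT h, exists c : R, forall w, `|h w| <= c &
    forall t, Ex P (fun w => V w * (h w * cos (lin t w))) = 0 /\
              Ex P (fun w => V w * (h w * sin (lin t w))) = 0].

(* [sin (s * (U j - c))] is a multiplier; by iterating [sign_step] and letting
   [s] tend to [0], so is the sign of [U j - c], and the sets whose indicator is
   a multiplier form a sigma-algebra. *)
Definition trig_multiplier (g : Omega -> R) :=
  forall h, trig_orthogonal h -> trig_orthogonal (fun w => h w * g w).

Let mcos (f : Omega -> R) : measurable_fun setT f -> measurable_fun setT (fun w => cos (f w)).
Proof. by move=> mf; apply: measurableT_comp mf; apply: continuous_measurable_fun; exact: continuous_cos. Qed.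

Let msin (f : Omega -> R) : measurable_fun setT f -> measurable_fun setT (fun w => sin (f w)).
Proof. by move=> mf; apply: measurableT_comp mf; apply: continuous_measurable_fun; exact: continuous_sin. Qed.

Let iV (h g : Omega -> R) : trig_orthogonal h -> measurable_fun setT g ->
  (forall w, `|g w| <= 1) -> L1 P (fun w => V w * (h w * g w)).
Proof.
move=> [mh [c hc] _] mg g1; apply: (@L1_bddM _ _ _ _ _ _ c) => //.
  exact: measurable_funM.
move=> w; rewrite normrM -[leRHS]mulr1; apply: ler_pM => //.
Qed.

Lemma trig_orthogonal_ext (h k : Omega -> R) : h =1 k -> trig_orthogonal h -> trig_orthogonal k.
Proof. by move=> /funext ->. Qed.

Lemma trig_orthogonalD a b (h k : Omega -> R) : trig_orthogonal h -> trig_orthogonal k ->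
  trig_orthogonal (fun w => a * h w + b * k w).
Proof.
move=> Kh Kk; have [mh [ch hh] h0] := Kh; have [mk [ck hk] k0] := Kk; split.
- by apply: measurable_funD; exact: measurable_funM.
- exists (`|a| * ch + `|b| * ck) => w.
  by rewrite (le_trans (ler_normD _ _))// lerD// normrM ler_wpM2l.
- have H (g : Omega -> R) : measurable_fun setT g -> (forall w, `|g w| <= 1) ->
      Ex P (fun w => V w * (h w * g w)) = 0 -> Ex P (fun w => V w * (k w * g w)) = 0 ->
      Ex P (fun w => V w * ((a * h w + b * k w) * g w)) = 0.
    move=> mg g1 hg kg.
    transitivity (Ex P (fun w => a * (V w * (h w * g w)) + b * (V w * (k w * g w)))).
      by apply: eq_Ex => w; ring.
    by rewrite ExD ?ExZ ?hg ?kg ?mulr0 ?addr0//; try (apply: L1Z); exact: iV.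
  move=> t; have [h1 h2] := h0 t; have [k1 k2] := k0 t; split; apply: H => //.
  - exact: mcos.
  - by move=> w; exact: cos_max.
  - exact: msin.
  - by move=> w; exact: sin_max.
Qed.

(** Dominated convergence with the dominating function [c * |V|], since sines and cosines are at
    most 1. *)
Lemma trig_orthogonal_lim (h : nat -> Omega -> R) (g : Omega -> R) (c : R) :
  (forall n, trig_orthogonal (h n)) -> measurable_fun setT g ->
  (forall n w, `|h n w| <= c) -> (forall w, h n w @[n --> \oo] --> g w) ->
  trig_orthogonal g.
Proof.
move=> Kh mg hc hg.
have gc w : `|g w| <= c.
  have cn : `|h n w| @[n --> \oo] --> `|g w| by exact: cvg_norm.
  rewrite -(cvg_lim _ cn)//; apply: limr_le; first exact: cvgP cn.
  by apply: nearW => n; exact: hc.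
split => //; first by exists c.
have H (k : Omega -> R) : measurable_fun setT k -> (forall w, `|k w| <= 1) ->
    (forall n, Ex P (fun w => V w * (h n w * k w)) = 0) ->
    Ex P (fun w => V w * (g w * k w)) = 0.
  move=> mk k1 h0.
  have [||||_ cE] := @Ex_dom_cvg _ _ _ P (fun n w => V w * (h n w * k w))
    (fun w => V w * (g w * k w)) (fun w => c * `|V w|) _ _ (L1Z c (L1_abs V1)).
  - by move=> n; have [mh _ _] := Kh n; apply: measurable_funM; [exact: L1_meas V1|exact: measurable_funM].
  - by apply: measurable_funM; [exact: L1_meas V1|exact: measurable_funM].
  - move=> n w; rewrite normrM mulrC ler_wpM2r// normrM -[leRHS]mulr1.
    by apply: ler_pM.
  - by move=> w; apply: cvgM; [exact: cvg_cst|apply: cvgM; [exact: hg|exact: cvg_cst]].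
  apply/esym; apply: (cvg_unique _ _ cE) => //.
  rewrite /= (_ : (fun n => _) = fun=> 0); first exact: cvg_cst.
  by apply/funext => n; exact: h0.
move=> t; split; apply: (H _).
- exact: mcos.
- by move=> w; exact: cos_max.
- by move=> n; have [_ _ /(_ t)[]] := Kh n.
- exact: msin.
- by move=> w; exact: sin_max.
- by move=> n; have [_ _ /(_ t)[]] := Kh n.
Qed.

Lemma trig_multiplier_ext (g k : Omega -> R) : g =1 k -> trig_multiplier g -> trig_multiplier k.
Proof. by move=> /funext ->. Qed.

Lemma trig_multiplier_cst c : trig_multiplier (fun=> c).
Proof.
move=> h Kh; apply: trig_orthogonal_ext (trig_orthogonalD c 0 Kh Kh) => w.
by rewrite mul0r addr0 mulrC.
Qed.

Lemma trig_multiplierD (g k : Omega -> R) : trig_multiplier g -> trig_multiplier k ->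
  trig_multiplier (fun w => g w + k w).
Proof.
move=> Mg Mk h Kh.
apply: trig_orthogonal_ext (trig_orthogonalD 1 1 (Mg _ Kh) (Mk _ Kh)) => w.
by rewrite !mul1r mulrDr.
Qed.

Lemma trig_multiplierM (g k : Omega -> R) : trig_multiplier g -> trig_multiplier k ->
  trig_multiplier (fun w => g w * k w).
Proof.
move=> Mg Mk h Kh; apply: trig_orthogonal_ext (Mk _ (Mg _ Kh)) => w.
by rewrite mulrA.
Qed.

Lemma trig_multiplier_lim (k : nat -> Omega -> R) (g : Omega -> R) :
  (forall n, trig_multiplier (k n)) -> measurable_fun setT g ->
  (forall n w, `|k n w| <= 1) -> (forall w, k n w @[n --> \oo] --> g w) ->
  trig_multiplier g.
Proof.
move=> Mk mg k1 kg h Kh; have [mh [c hc] _] := Kh.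
apply: (@trig_orthogonal_lim (fun n w => h w * k n w) _ c).
- by move=> n; exact: Mk.
- exact: measurable_funM.
- by move=> n w; rewrite normrM -[leRHS]mulr1; apply: ler_pM.
- by move=> w; apply: cvgM; [exact: cvg_cst|exact: kg].
Qed.

(** Product-to-sum formulas: multiplying by a trigonometric function of frequency [s] turns
    frequency [t] into [t + s] and [t - s], where orthogonality is also known. The unspecified
    coefficients let one argument serve all four products. *)
Lemma trig_multiplier_cos_sin s :
  trig_multiplier (fun w => cos (lin s w)) /\ trig_multiplier (fun w => sin (lin s w)).
Proof.
have linD t w : lin (fun j => t j + s j) w = lin t w + lin s w.
  by rewrite /lin -big_split; apply: eq_bigr => j _; rewrite mulrDl.
have linB t w : lin (fun j => t j - s j) w = lin t w - lin s w.
  by rewrite /lin -sumrB; apply: eq_bigr => j _; rewrite mulrBl.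
have H (h k : Omega -> R) : trig_orthogonal h -> measurable_fun setT k -> (forall w, `|k w| <= 1) ->
    (forall t, exists a b c d : R, forall w,
      k w * cos (lin t w) = a * cos (lin (fun j => t j + s j) w) +
        b * cos (lin (fun j => t j - s j) w) + (c * sin (lin (fun j => t j + s j) w) +
        d * sin (lin (fun j => t j - s j) w))) ->
    (forall t, exists a b c d : R, forall w,
      k w * sin (lin t w) = a * cos (lin (fun j => t j + s j) w) +
        b * cos (lin (fun j => t j - s j) w) + (c * sin (lin (fun j => t j + s j) w) +
        d * sin (lin (fun j => t j - s j) w))) ->
    trig_orthogonal (fun w => h w * k w).
  move=> Kh mk k1 kc ks; have [mh [ch hh] h0] := Kh; split.
  - exact: measurable_funM.
  - by exists ch => w; rewrite normrM -[leRHS]mulr1; apply: ler_pM.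
  have G t (g : Omega -> R) : (exists a b c d : R, forall w,
      k w * g w = a * cos (lin (fun j => t j + s j) w) +
        b * cos (lin (fun j => t j - s j) w) + (c * sin (lin (fun j => t j + s j) w) +
        d * sin (lin (fun j => t j - s j) w))) ->
      Ex P (fun w => V w * (h w * k w * g w)) = 0.
    move=> [a [b [c [d kE]]]]; have [p1 p2] := h0 (fun j => t j + s j).
    have [q1 q2] := h0 (fun j => t j - s j).
    have ic t' : L1 P (fun w => V w * (h w * cos (lin t' w))).
      by apply: iV => //; [exact: mcos|move=> w; exact: cos_max].
    have is_ t' : L1 P (fun w => V w * (h w * sin (lin t' w))).
      by apply: iV => //; [exact: msin|move=> w; exact: sin_max].
    transitivity (Ex P (fun w =>
      (a * (V w * (h w * cos (lin (fun j => t j + s j) w))) +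
       b * (V w * (h w * cos (lin (fun j => t j - s j) w)))) +
      (c * (V w * (h w * sin (lin (fun j => t j + s j) w))) +
       d * (V w * (h w * sin (lin (fun j => t j - s j) w)))))).
      by apply: eq_Ex => w; rewrite -!mulrA (kE w); ring.
    by rewrite !ExD ?ExZ ?p1 ?p2 ?q1 ?q2 ?mulr0 ?addr0//;
      repeat (apply: L1D || apply: L1Z).
  by move=> t; split; apply: (G t).
split => h Kh; apply: H => //.
- exact: mcos.
- by move=> w; exact: cos_max.
- move=> t; exists 2^-1, 2^-1, 0, 0 => w; rewrite linD linB cosD cosB; lra.
- move=> t; exists 0, 0, 2^-1, 2^-1 => w; rewrite linD linB sinD sinB; lra.
- exact: msin.
- by move=> w; exact: sin_max.
- move=> t; exists 0, 0, 2^-1, (- 2^-1) => w; rewrite linD linB sinD sinB; lra.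
- move=> t; exists (- 2^-1), 2^-1, 0, 0 => w; rewrite linD linB cosD cosB; lra.
Qed.

Lemma trig_multiplier_indic (D : set Omega) :
  <<s \bigcup_(j in [set: 'I_m]) preimage_set_system setT (U j) measurable >> D ->
  measurable D /\ trig_multiplier \1_D.
Proof.
pose M := [set D : set Omega | measurable D /\ trig_multiplier \1_D].
have sM : sigma_algebra setT M.
  have MC A : M A -> M (~` A).
    move=> [mA MA]; split; first exact: measurableC.
    apply: trig_multiplier_ext (trig_multiplierD (trig_multiplier_cst 1)
      (trig_multiplierM (trig_multiplier_cst (- 1)) MA)) => w.
    by rewrite mulN1r !indicE in_setC; case: (w \in A) => /=; lra.
  have MI A B : M A -> M B -> M (A `&` B).
    move=> [mA MA] [mB MB]; split; first exact: measurableI.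
    apply: trig_multiplier_ext (trig_multiplierM MA MB) => w.
    by rewrite !indicE in_setI; case: (w \in A); case: (w \in B) => /=; lra.
  have M0 : M set0.
    split => //; apply: trig_multiplier_ext (trig_multiplier_cst 0) => w.
    by rewrite indic0.
  have MU A B : M A -> M B -> M (A `|` B).
    by move=> MA MB; rewrite -[_ `|` _]setCK setCU; apply/MC/MI; exact/MC.
  split => //; first by move=> A MA; rewrite setTD; exact: MC.
  move=> F MF; split; first by apply: bigcupT_measurable => n; have [] := MF n.
  have MUn n : M (\bigcup_(i < n) F i).
    elim: n => [|n IH]; first by rewrite bigcup_mkord big_ord0.
    by rewrite bigcup_mkord big_ord_recr/= -bigcup_mkord; apply: MU.
  (* Multipliers are closed under sums and products, which handles finite unions; their indicators
     converge pointwise to that of the countable union. *)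
  apply: (@trig_multiplier_lim (fun n => \1_(\bigcup_(i < n) F i))).
  - by move=> n; have [] := MUn n.
  - by apply: measurable_indic; apply: bigcupT_measurable => n; have [] := MF n.
  - by move=> n w; rewrite indicE; case: (_ \in _); rewrite ?normr1 ?normr0.
  - move=> w; apply: cvg_near_cst; rewrite !indicE.
    have [|nw] := boolP (w \in \bigcup_n F n).
      rewrite inE => -[k _ Fkw]; near=> n; rewrite indicE mem_set//.
      by exists k => //=; near: n; exact: nbhs_infty_gt.
    apply: nearW => n; rewrite indicE memNset// => -[k _ Fkw]; move/negP: nw; apply.
    by rewrite inE; exists k.
suff : <<s \bigcup_(j in [set: 'I_m]) preimage_set_system setT (U j) measurable >> `<=` M.
  by apply.
apply: smallest_sub => //= _ [j _ [B mB <-]]; rewrite setTI.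
have {}mB : <<s @RGenOInfty.G R >> B by rewrite -[X in X B](RGenOInfty.measurableE R).
(* [N] inherits the closure properties of [M], so only the open rays []c, +oo[] that generate the
   Borel sets remain to be treated. *)
pose N := [set B : set R | M (U j @^-1` B)].
suff : <<s @RGenOInfty.G R >> `<=` N by apply.
have [M0 MC MU] := sM.
apply: smallest_sub.
  split; first by rewrite /N/= preimage_set0.
  - by move=> A; rewrite /N/= => /MC; rewrite !setTD preimage_setC.
  - by move=> F; rewrite /N/= preimage_bigcup; exact: MU.
move=> _ [c ->]; rewrite /N/=; split.
  by apply: measurable_preimage => //; exact: measurable_itv.
(* Unlike [U j - c], this is bounded by 1, as the sign iteration requires; the subtraction formula
   writes it with [cos] and [sin] of a linear form and constants. *)
pose u n w : R := sin (n.+1%:R^-1 * (U j w - c)).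
have u1 n w : `|u n w| <= 1 by exact: sin_max.
have mu n : measurable_fun setT (u n).
  by apply: msin; apply: measurable_funM => //; exact: measurable_funB.
have Mu n : trig_multiplier (u n).
  pose t k := if k == j then n.+1%:R^-1 : R else 0.
  have linE w : lin t w = n.+1%:R^-1 * U j w.
    rewrite /lin (bigD1 j)//= /t eqxx big1 ?addr0// => k kj.
    by rewrite (negbTE kj) mul0r.
  have [Mc Ms] := trig_multiplier_cos_sin t.
  apply: trig_multiplier_ext (trig_multiplierD
    (trig_multiplierM Ms (trig_multiplier_cst (cos (n.+1%:R^-1 * c))))
    (trig_multiplierM Mc (trig_multiplier_cst (- sin (n.+1%:R^-1 * c))))) => w.
  by rewrite linE /u mulrBr sinB mulrN.
have Miter n k : measurable_fun setT (fun w => iter k (@sign_step R) (u n w)) /\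
    trig_multiplier (fun w => iter k (@sign_step R) (u n w)).
  elim: k => [|k [mk Mk]] /=; first by split; [exact: mu|exact: Mu].
  split.
    apply: measurable_funM => //; apply: measurable_funB; first exact: measurable_funM.
    exact: measurable_funX.
  apply: trig_multiplier_ext (trig_multiplierD
    (trig_multiplierM (trig_multiplier_cst (3 / 2)) Mk)
    (trig_multiplierM (trig_multiplier_cst (- 2^-1))
      (trig_multiplierM Mk (trig_multiplierM Mk Mk)))) => w.
  by rewrite /sign_step; field.
have msg (f : Omega -> R) : measurable_fun setT f -> measurable_fun setT (fun w => Num.sg (f w)).
  move=> mf; have -> : (fun w => Num.sg (f w)) =
      (fun w => \1_`]0, +oo[ (f w) - \1_`]-oo, 0[ (f w) : R).
    apply/funext => w; rewrite !indicE; have [f0|f0|->] := ltgtP (f w) 0.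
    - rewrite ltr0_sg// memNset ?mem_set/= ?in_itv/= ?f0 ?sub0r//.
      by rewrite andbT; apply/negP; rewrite -leNgt ltW.
    - rewrite gtr0_sg// mem_set ?memNset/= ?in_itv/= ?f0 ?subr0//.
      by apply/negP; rewrite -leNgt ltW.
    - by rewrite sgr0 !memNset/= ?in_itv/= ?ltxx// subr0.
  by apply: measurable_funB; apply: measurableT_comp mf; exact: measurable_indic.
have Msg n : trig_multiplier (fun w => Num.sg (u n w)).
  apply: (@trig_multiplier_lim (fun k w => iter k (@sign_step R) (u n w))).
  - by move=> k; have [] := Miter n k.
  - exact: msg.
  - by move=> k w; exact: iter_sign_step_bound.
  - by move=> w; exact: cvg_iter_sign_step.
have sg1 (x : R) : `|Num.sg x| <= 1 by rewrite normr_sg; case: (_ == _).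
have Ms : trig_multiplier (fun w => Num.sg (U j w - c)).
  apply: (@trig_multiplier_lim (fun n w => Num.sg (u n w))) => //.
  - by apply: msg; exact: measurable_funB.
  - by move=> w; exact: cvg_sg_sin_scaled.
(* For a sign [s], the polynomial [(s ^+ 2 + s) / 2] is 1 at 1 and 0 at 0 and -1, so it gives the
   indicator of the open ray. *)
apply: trig_multiplier_ext (trig_multiplierM (trig_multiplier_cst 2^-1)
  (trig_multiplierD (trig_multiplierM Ms Ms) Ms)) => w.
rewrite indicE; have [Uc|Uc] := ltP c (U j w).
  rewrite mem_set/=; last by rewrite /= in_itv/= Uc.
  by rewrite gtr0_sg ?subr_gt0//; lra.
rewrite memNset/=; last by rewrite /= in_itv/= andbT; apply/negP; rewrite -leNgt.
move: Uc; rewrite le_eqVlt => /predU1P[->|Uc]; first by rewrite subrr sgr0; lra.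
by rewrite ltr0_sg ?subr_lt0//; lra.
Unshelve. all: by end_near. Qed.

(** The hypothesis says that the constant 1 is orthogonal. Multiplying it by the indicator keeps
    orthogonality, and frequency 0, where the cosine is 1, gives the claim. *)
Lemma Ex_indic0_of_trig (D : set Omega) :
  (forall t : 'I_m -> R, Ex P (fun w => V w * cos (\sum_j t j * U j w)) = 0 /\
    Ex P (fun w => V w * sin (\sum_j t j * U j w)) = 0) ->
  <<s \bigcup_(j in [set: 'I_m]) preimage_set_system setT (U j) measurable >> D ->
  Ex P (fun w => V w * \1_D w) = 0.
Proof.
move=> V0 sD; have [mD MD] := trig_multiplier_indic sD.
have K1 : trig_orthogonal (fun=> 1).
  split => //; first by exists 1 => w; rewrite normr1.
  move=> t; have [h1 h2] := V0 t.
  by split; [rewrite -[RHS]h1|rewrite -[RHS]h2]; apply: eq_Ex => w; rewrite mul1r.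
have [_ _ /(_ (fun=> 0))[h _]] := MD _ K1.
rewrite -[RHS]h; apply: eq_Ex => w.
rewrite /lin big1 ?cos0 ?mulr1 ?mul1r// => j _; by rewrite mul0r.
Qed.

End trigonometric_determinacy.

Section sine_bounds.
Context (R : realType).

(** The intermediate point serves twice: it bounds the sine by its argument, and it tends to 0 with
    the argument, which gives the limit of [n * sin (x / n)]. *)
Lemma sin_mean_value (x : R) : exists c, `|c| <= `|x| /\ sin x = x * cos c.
Proof.
have pos (y : R) : 0 <= y -> exists c, `|c| <= `|y| /\ sin y = y * cos c.
  move=> y0; have [|c] := @MVT_segment R sin cos 0 y y0.
  - by apply: continuous_subspaceT; exact: continuous_sin.
  - rewrite in_itv/= sin0 !subr0 => /andP[c0 cy] ->; exists c.
    by rewrite !ger0_norm// mulrC.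
have [x0|x0] := leP 0 x; first exact: pos.
have [|c [cx E]] := pos (- x); first by rewrite oppr_ge0 ltW.
exists c; split; first by rewrite normrN in cx.
by move: E; rewrite sinN mulNr => /oppr_inj.
Qed.

Lemma sin_norm_le (x : R) : `|sin x| <= `|x|.
Proof.
have [c [_ ->]] := sin_mean_value x.
by rewrite normrM -[leRHS]mulr1 ler_wpM2l// cos_max.
Qed.

Lemma cvg_scaled_sin (x : R) :
  n.+1%:R * sin (n.+1%:R^-1 * x) @[n --> \oo] --> x.
Proof.
have /choice[c cP] : forall n : nat, exists c : R,
    `|c| <= `|n.+1%:R^-1 * x| /\ sin (n.+1%:R^-1 * x) = n.+1%:R^-1 * x * cos c.
  by move=> n; exact: sin_mean_value.
have -> : (fun n : nat => n.+1%:R * sin (n.+1%:R^-1 * x)) = (fun n => x * cos (c n)).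
  apply/funext => n; have [_ ->] := cP n; by rewrite !mulrA mulfV ?mul1r// pnatr_eq0.
rewrite -[X in _ --> X]mulr1; apply: cvgM; first exact: cvg_cst.
rewrite -cos0; apply: (cvg_comp c cos); last exact: continuous_cos.
apply/cvgrPdist_le => /= e e0; near=> n; rewrite sub0r normrN.
have [cn _] := cP n; apply: (le_trans cn).
rewrite normrM ger0_norm ?invr_ge0// mulrC ler_pdivrMr// mulrC -ler_pdivrMr//.
apply: (@le_trans _ _ n%:R); last by rewrite ler_nat.
by near: n; exact: nbhs_infty_ger.
Unshelve. all: by end_near. Qed.

End sine_bounds.

(** * Orthogonality of a Gaussian residual to events of its regressors *)

Section gaussian_uncorrelated.
Context (R : realType) (dO : measure_display) (Omega : measurableType dO)
  (P : probability Omega R) (m : nat).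
Variables (V : Omega -> R) (U : 'I_m -> Omega -> R).
Hypotheses (V2 : L2 P V) (U2 : forall j, L2 P (U j)).
Hypothesis gauss : forall (s : R) (t : 'I_m -> R), exists X : Omega -> R,
  [/\ gaussian_rv P X, L2 P X & forall w, s * V w + \sum_j t j * U j w = X w - Ex P X].
Hypothesis VU : forall j, Ex P (fun w => V w * U j w) = 0.

Let lin (t : 'I_m -> R) w := \sum_j t j * U j w.

Let lin2 t : L2 P (lin t).
Proof. by apply: L2_sum => j _; exact: L2Z. Qed.

Let Ex_lin s t : Ex P (fun w => (s * V w + lin t w) ^+ 2) =
  s ^+ 2 * Ex P (fun w => V w ^+ 2) + Ex P (fun w => lin t w ^+ 2).
Proof.
have [[_ v2] [_ l2]] := (V2, lin2 t).
have vl : L1 P (fun w => V w * lin t w) by exact: L2M.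
have vl0 : Ex P (fun w => V w * lin t w) = 0.
  transitivity (Ex P (fun w => \sum_j t j * (V w * U j w))).
    by apply: eq_Ex => w; rewrite mulr_sumr; apply: eq_bigr => j _; ring.
  rewrite Ex_sum => [|j _]; last by apply: L1Z; exact: L2M.
  by rewrite big1// => j _; rewrite ExZ ?VU ?mulr0//; exact: L2M.
transitivity (Ex P (fun w => (s ^+ 2 * V w ^+ 2 + (2 * s) * (V w * lin t w)) + lin t w ^+ 2)).
  by apply: eq_Ex => w; ring.
rewrite ExD ?ExD ?ExZ ?vl0 ?mulr0 ?addr0//; try exact: L1Z.
by apply: L1D; exact: L1Z.
Qed.

Let Ex_flip s t (g : R -> R) : measurable_fun setT g -> (forall x, `|g x| <= 1) ->
  Ex P (fun w => g (s * V w + lin t w)) = Ex P (fun w => g (- s * V w + lin t w)).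
Proof.
move=> mg g1; have [X [gX X2 XE]] := gauss s t; have [Y [gY Y2 YE]] := gauss (- s) t.
transitivity (Ex P (fun w => g (X w - Ex P X))).
  by apply: eq_Ex => w; rewrite -XE.
rewrite (gaussian_rv_Ex gX gY X2 Y2 _ mg g1).
  by apply: eq_Ex => w; rewrite -YE.
transitivity (Ex P (fun w => (s * V w + lin t w) ^+ 2)).
  by apply: eq_Ex => w; rewrite -XE.
rewrite Ex_lin -[s ^+ 2]sqrrN -Ex_lin.
by apply: eq_Ex => w; rewrite -YE.
Qed.

Let mcos : measurable_fun setT (@cos R).
Proof. by apply: continuous_measurable_fun; exact: continuous_cos. Qed.

Let msin : measurable_fun setT (@sin R).
Proof. by apply: continuous_measurable_fun; exact: continuous_sin. Qed.

Let bdd (g : R -> R) (f : Omega -> R) : measurable_fun setT g -> (forall x, `|g x| <= 1) ->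
  measurable_fun setT f -> L1 P (fun w => g (f w)).
Proof.
move=> mg g1 mf; apply: (@L1_bdd _ _ _ _ _ 1) => [|w]; last exact: g1.
exact: (measurableT_comp mg mf).
Qed.

(** Each product is half a difference of one function of [sV + L] and [-sV + L], and flipping the
    sign of [V] leaves the expectation unchanged. *)
Let Ex_sin_V s t : Ex P (fun w => sin (s * V w) * cos (lin t w)) = 0 /\
  Ex P (fun w => sin (s * V w) * sin (lin t w)) = 0.
Proof.
have mp u : measurable_fun setT (fun w => u * V w + lin t w).
  by apply: measurable_funD; [apply: measurable_funM => //; case: V2|case: (lin2 t)].
split.
  transitivity (Ex P (fun w => 2^-1 * (sin (s * V w + lin t w) - sin (- s * V w + lin t w)))).
    by apply: eq_Ex => w; rewrite mulNr !sinD sinN cosN; field.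
  have i u := bdd msin (@sin_max R) (mp u).
  rewrite ExZ; last exact: L1B.
  by rewrite ExB// (Ex_flip s t msin (@sin_max R)) subrr mulr0.
transitivity (Ex P (fun w => 2^-1 * (cos (- s * V w + lin t w) - cos (s * V w + lin t w)))).
  by apply: eq_Ex => w; rewrite mulNr !cosD sinN cosN; field.
have i u := bdd mcos (@cos_max R) (mp u).
rewrite ExZ; last exact: L1B.
by rewrite ExB// (Ex_flip s t mcos (@cos_max R)) subrr mulr0.
Qed.

(** This differentiates the hypothesis in [s] at 0: [n * sin (V / n)] tends to [V] and is dominated
    by [|V|]. *)
Let Ex_V_lim (k : Omega -> R) : measurable_fun setT k -> (forall w, `|k w| <= 1) ->
  (forall s, Ex P (fun w => sin (s * V w) * k w) = 0) ->
  Ex P (fun w => V w * k w) = 0.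
Proof.
move=> mk k1 sk; have [mV _] := V2.
have msV s : measurable_fun setT (fun w => sin (s * V w)).
  by apply: (measurableT_comp msin); exact: measurable_funM.
have [||||_ cE] := @Ex_dom_cvg _ _ _ P
  (fun n w => n.+1%:R * sin (n.+1%:R^-1 * V w) * k w)
  (fun w => V w * k w) (fun w => `|V w|) _ _ (L1_abs (L2_L1 V2)).
- by move=> n; apply: measurable_funM => //; apply: measurable_funM.
- exact: measurable_funM.
- move=> n w; rewrite normrM -[leRHS]mulr1; apply: ler_pM => //.
  rewrite normrM normr_nat (le_trans (ler_wpM2l _ (sin_norm_le _)))//.
  by rewrite normrM normfV normr_nat mulrA mulfV ?mul1r// pnatr_eq0.
- by move=> w; apply: cvgM; [exact: cvg_scaled_sin|exact: cvg_cst].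
apply/esym; apply: (cvg_unique _ _ cE) => //.
rewrite /= (_ : (fun n => _) = fun=> 0); first exact: cvg_cst.
apply/funext => n.
transitivity (Ex P (fun w => n.+1%:R * (sin (n.+1%:R^-1 * V w) * k w))).
  by apply: eq_Ex => w; rewrite mulrA.
rewrite ExZ ?sk ?mulr0//; apply: (@L1_bdd _ _ _ _ _ 1).
  exact: measurable_funM.
by move=> w; rewrite normrM -[leRHS]mulr1; apply: ler_pM => //; exact: sin_max.
Qed.

(* The laws of [L + sV] and [L - sV] coincide for every linear combination [L]
   of the [U j], since they are Gaussian with equal mean and variance. *)
Lemma gaussian_uncorrelated_Ex_indic (D : set Omega) :
  <<s \bigcup_(j in [set: 'I_m]) preimage_set_system setT (U j) measurable >> D ->
  Ex P (fun w => V w * \1_D w) = 0.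
Proof.
apply: Ex_indic0_of_trig => [||t].
- exact: L2_L1.
- by move=> j; case: (U2 j).
have mlin : measurable_fun setT (lin t) by case: (lin2 t).
split; apply: Ex_V_lim => [|w|s].
- exact: (measurableT_comp mcos mlin).
- exact: cos_max.
- by have [] := Ex_sin_V s t.
- exact: (measurableT_comp msin mlin).
- exact: sin_max.
- by have [] := Ex_sin_V s t.
Qed.

End gaussian_uncorrelated.

(** * Matrices *)

Section entrywise_convergence.
Context (R : realType).

(** Products, determinants and adjugates are polynomial in the entries, so in this form their limits
    are limits of real sequences; [mx_cvgP] returns to the matrix topology. *)
Definition mx_cvg k l (F : nat -> 'M[R]_(k, l)) (A : 'M[R]_(k, l)) :=
  forall i j, F n i j @[n --> \oo] --> A i j.

Lemma mx_cvgP k l (F : nat -> 'M[R]_(k, l)) (A : 'M[R]_(k, l)) :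
  mx_cvg F A -> F n @[n --> \oo] --> A.
Proof.
move=> FA B [Q AQ QB].
have : \forall n \near \oo, forall ij : 'I_k * 'I_l, Q ij.1 ij.2 (F n ij.1 ij.2).
  by apply: filter_forall => -[i j]; exact: FA (AQ i j).
by apply: filterS => n nQ; apply: QB => i j; exact: (nQ (i, j)).
Qed.

Lemma mx_cvg_cst k l (A : 'M[R]_(k, l)) : mx_cvg (fun=> A) A.
Proof. by move=> i j; exact: cvg_cst. Qed.

Lemma mx_cvgD k l (F G : nat -> 'M[R]_(k, l)) A B :
  mx_cvg F A -> mx_cvg G B -> mx_cvg (fun n => F n + G n) (A + B).
Proof.
move=> FA GB i j; rewrite mxE.
by under eq_fun do rewrite mxE; apply: cvgD; [exact: FA|exact: GB].
Qed.

Lemma mx_cvgB k l (F G : nat -> 'M[R]_(k, l)) A B :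
  mx_cvg F A -> mx_cvg G B -> mx_cvg (fun n => F n - G n) (A - B).
Proof.
move=> FA GB i j; rewrite !mxE.
by under eq_fun do rewrite !mxE; apply: cvgB; [exact: FA|exact: GB].
Qed.

Lemma mx_cvgM k l p (F : nat -> 'M[R]_(k, l)) (G : nat -> 'M[R]_(l, p)) A B :
  mx_cvg F A -> mx_cvg G B -> mx_cvg (fun n => F n *m G n) (A *m B).
Proof.
move=> FA GB i j; rewrite mxE.
under eq_fun do rewrite mxE.
apply: cvg_big => [|s _].
- exact: add_continuous.
- by apply: cvgM; [exact: FA|exact: GB].
Qed.

Lemma mx_cvg_tr k l (F : nat -> 'M[R]_(k, l)) A :
  mx_cvg F A -> mx_cvg (fun n => (F n)^T) A^T.
Proof. by move=> FA i j; rewrite mxE; under eq_fun do rewrite mxE; exact: FA. Qed.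

Lemma cvg_det k (F : nat -> 'M[R]_k) A :
  mx_cvg F A -> \det (F n) @[n --> \oo] --> \det A.
Proof.
move=> FA; rewrite /determinant.
apply: cvg_big => [|s _]; first exact: add_continuous.
apply: cvgM; first exact: cvg_cst.
apply: cvg_big => [|i _]; first exact: mul_continuous.
exact: FA.
Qed.

Lemma mx_cvg_adj k (F : nat -> 'M[R]_k) A :
  mx_cvg F A -> mx_cvg (fun n => \adj (F n)) (\adj A).
Proof.
move=> FA i j; rewrite mxE; under eq_fun do rewrite mxE.
rewrite /cofactor; apply: cvgM; first exact: cvg_cst.
by apply: cvg_det => a b; rewrite !mxE; under eq_fun do rewrite !mxE; exact: FA.
Qed.

(* Equal to [invmx A] when [A] is invertible and to [0] otherwise; unlike
   [mpinv], it is clearly measurable in [A]. *)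
Definition det_inv k (A : 'M[R]_k) := (\det A)^-1 *: \adj A.

Lemma mx_cvg_det_inv k (F : nat -> 'M[R]_k) A : A \in unitmx ->
  mx_cvg F A -> mx_cvg (fun n => det_inv (F n)) (det_inv A).
Proof.
rewrite unitmxE unitfE => A0 FA i j; rewrite mxE; under eq_fun do rewrite mxE.
by apply: cvgM; [apply: cvgV => //; exact: cvg_det|exact: mx_cvg_adj].
Qed.

Lemma mpinv_unit k (A : 'M[R]_k) : A \in unitmx -> mpinv A = det_inv A.
Proof.
move=> uA; have -> : det_inv A = invmx A by rewrite /invmx uA.
apply: (penrose_unique (mpinvP A)).
by split; rewrite ?(mulmxV uA) ?(mulVmx uA) ?mul1mx ?trmx1.
Qed.

Lemma near_unitmx k (F : nat -> 'M[R]_k) A : A \in unitmx -> mx_cvg F A ->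
  \forall n \near \oo, F n \in unitmx.
Proof.
rewrite unitmxE unitfE => A0 FA; have := cvg_det FA.
move/cvgrPdist_lt => /(_ `|\det A|); rewrite normr_gt0 => /(_ A0).
apply: filterS => n; rewrite unitmxE unitfE => h; apply: contraTneq h => ->.
by rewrite subr0 ltxx.
Qed.

End entrywise_convergence.

Section entrywise_measurability.
Context (R : realType) (dO : measure_display) (Omega : measurableType dO).

Definition mx_meas k l (F : Omega -> 'M[R]_(k, l)) :=
  forall i j, measurable_fun setT (fun w => F w i j).

Lemma measurable_fun_prod_seq I (s : seq I) (F : I -> Omega -> R) :
  (forall i, measurable_fun setT (F i)) ->
  measurable_fun setT (fun w => \prod_(i <- s) F i w).
Proof.
move=> mF; elim: s => [|i s IH].
  rewrite (_ : (fun w => _) = fun=> 1); first exact: measurable_cst.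
  by apply/funext => w; rewrite big_nil.
rewrite (_ : (fun w => _) = fun w => F i w * \prod_(j <- s) F j w).
  exact: measurable_funM.
by apply/funext => w; rewrite big_cons.
Qed.

(** Inversion is the pointwise limit of the continuous functions [x / (x ^+ 2 + 1 / n.+1)], also at
    0, where these vanish and the inverse is 0 by convention. *)
Lemma measurable_invr : measurable_fun setT (@GRing.inv R).
Proof.
pose f n (x : R) := x * (x ^+ 2 + n.+1%:R^-1)^-1.
have p0 (x : R) n : 0 < x ^+ 2 + n.+1%:R^-1.
  by rewrite ltr_wpDl ?sqr_ge0// invr_gt0.
apply: (@measurable_fun_cvg _ _ _ _ f) => [n|x _].
  apply: continuous_measurable_fun => x; apply: cvgM; first exact: cvg_id.
  apply: cvgV; first by rewrite gt_eqF.
  by apply: cvgD; [exact: exprn_continuous|exact: cvg_cst].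
have [->|x0] := eqVneq x 0.
  by rewrite invr0 /f; under eq_fun do rewrite mul0r; exact: cvg_cst.
have -> : x^-1 = x * (x ^+ 2 + 0)^-1 by rewrite addr0; field.
apply: cvgM; first exact: cvg_cst.
apply: cvgV; first by rewrite addr0 sqrf_eq0.
apply: cvgD; first exact: cvg_cst.
apply/cvgrPdist_le => /= e e0; near=> n; rewrite sub0r normrN ger0_norm//.
rewrite invf_ple ?posrE// (@le_trans _ _ n%:R) ?ler_nat//.
by near: n; exact: nbhs_infty_ger.
Unshelve. all: by end_near. Qed.

Lemma mx_measD k l (F G : Omega -> 'M[R]_(k, l)) :
  mx_meas F -> mx_meas G -> mx_meas (fun w => F w + G w).
Proof. by move=> mF mG i j; under eq_fun do rewrite mxE; exact: measurable_funD. Qed.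

Lemma mx_measB k l (F G : Omega -> 'M[R]_(k, l)) :
  mx_meas F -> mx_meas G -> mx_meas (fun w => F w - G w).
Proof. by move=> mF mG i j; under eq_fun do rewrite !mxE; exact: measurable_funB. Qed.

Lemma mx_measZ k l (c : R) (F : Omega -> 'M[R]_(k, l)) :
  mx_meas F -> mx_meas (fun w => c *: F w).
Proof. by move=> mF i j; under eq_fun do rewrite mxE; exact: measurable_funM. Qed.

Lemma mx_meas_sum I (s : seq I) k l (F : I -> Omega -> 'M[R]_(k, l)) :
  (forall i, mx_meas (F i)) -> mx_meas (fun w => \sum_(i <- s) F i w).
Proof.
move=> mF a b; under eq_fun do rewrite summxE.
by apply: measurable_sum => i; exact: mF.
Qed.

Lemma mx_measM k l p (F : Omega -> 'M[R]_(k, l)) (G : Omega -> 'M[R]_(l, p)) :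
  mx_meas F -> mx_meas G -> mx_meas (fun w => F w *m G w).
Proof.
move=> mF mG i j; under eq_fun do rewrite mxE.
by apply: measurable_sum => s; exact: measurable_funM.
Qed.

Lemma mx_meas_tr k l (F : Omega -> 'M[R]_(k, l)) :
  mx_meas F -> mx_meas (fun w => (F w)^T).
Proof. by move=> mF i j; under eq_fun do rewrite mxE; exact: mF. Qed.

Lemma mx_meas_col k l p (F : Omega -> 'M[R]_(k, p)) (G : Omega -> 'M[R]_(l, p)) :
  mx_meas F -> mx_meas G -> mx_meas (fun w => col_mx (F w) (G w)).
Proof.
move=> mF mG i j; rewrite -(splitK i); case: (fintype.split i) => a /=.
  by under eq_fun do rewrite col_mxEu; exact: mF.
by under eq_fun do rewrite col_mxEd; exact: mG.
Qed.

Lemma measurable_det k (F : Omega -> 'M[R]_k) :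
  mx_meas F -> measurable_fun setT (fun w => \det (F w)).
Proof.
move=> mF; rewrite /determinant; apply: measurable_sum => s.
apply: measurable_funM; first exact: measurable_cst.
by apply: measurable_fun_prod_seq => i; exact: mF.
Qed.

Lemma mx_meas_det_inv k (F : Omega -> 'M[R]_k) :
  mx_meas F -> mx_meas (fun w => det_inv (F w)).
Proof.
move=> mF i j; under eq_fun do rewrite !mxE.
apply: measurable_funM.
  exact: (measurableT_comp measurable_invr (measurable_det mF)).
rewrite /cofactor; apply: measurable_funM => //; apply: measurable_det => a b.
by under eq_fun do rewrite !mxE; exact: mF.
Qed.

Lemma measurable_enorm k (F : Omega -> 'cV[R]_k) :
  mx_meas F -> measurable_fun setT (fun w => enorm (F w)).
Proof.
move=> mF; rewrite /enorm; apply: (@measurableT_comp _ _ _ _ _ _ (@Num.sqrt R)).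
  by apply: continuous_measurable_fun; exact: sqrt_continuous.
by apply: measurable_sum => i; apply: measurable_funX; exact: mF.
Qed.

Lemma measurable_fun_mxP k l (F : Omega -> 'M[R]_(k, l)) :
  mx_meas F -> measurable_fun setT F.
Proof.
move=> mF _ A mA; rewrite setTI.
suff : mx_sigma_algebra (R := R) (k := k) (l := l) `<=` [set B | measurable (F @^-1` B)].
  exact.
apply: smallest_sub; first split => /=.
- by rewrite preimage_set0.
- by move=> B mB; rewrite setTD preimage_setC; exact: measurableC.
- by move=> B mB; rewrite preimage_bigcup; exact: bigcupT_measurable.
move=> _ [ij _ [B mB <-]]; rewrite setTI /=.
exact: (measurable_preimage (mF ij.1 ij.2) mB).
Qed.

End entrywise_measurability.

Lemma measurable_mx_entry (R : realType) k l i j :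
  measurable_fun setT (fun A : 'M[R]_(k, l) => A i j).
Proof.
move=> _ B mB; apply: sub_sigma_algebra; exists (i, j) => //.
by exists B.
Qed.

Lemma mx_meas_comp (R : realType) (dO : measure_display) (Omega : measurableType dO)
  k l (F : Omega -> 'M[R]_(k, l)) : measurable_fun setT F -> mx_meas F.
Proof. by move=> mF i j; exact: (measurableT_comp (measurable_mx_entry i j) mF). Qed.

(** * Least-squares algebra *)

Section least_squares_algebra.
Context (R : realType).

Lemma smeanE n k (u : nat -> 'cV[R]_k) i :
  smean n u i 0 = (\sum_(1 <= s < n.+1) u s i 0) / n%:R.
Proof. by rewrite /smean mxE summxE mulrC. Qed.

(** In this form every term is an average over the sample, to which the strong law applies. *)
Lemma scovE n k l (u : nat -> 'cV[R]_k) (v : nat -> 'cV[R]_l) i j :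
  scov n u v i j =
  (\sum_(1 <= s < n.+1) u s i 0 * v s j 0) / n%:R - smean n u i 0 * smean n v j 0.
Proof.
have E (U a : 'cV[R]_k) (V b : 'cV[R]_l) : ((U - a) *m (V - b)^T) i j =
    U i 0 * V j 0 - U i 0 * b j 0 - (a i 0 * V j 0 - a i 0 * b j 0).
  by rewrite mxE big_ord_recl big_ord0 addr0 !mxE; ring.
rewrite /scov mxE summxE; under eq_bigr do rewrite E.
(* With [n = 0] both sides are 0, since the inverse of 0 is 0. *)
case: n => [|n]; first by rewrite !smeanE invr0 !mul0r !mulr0 subr0.
have n0 : n.+1%:R != 0 :> R by rewrite pnatr_eq0.
have sumE k' (u' : nat -> 'cV[R]_k') i' :
    \sum_(1 <= s < n.+2) u' s i' 0 = n.+1%:R * smean n.+1 u' i' 0.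
  by rewrite smeanE mulrC divfK.
rewrite !sumrB -mulr_suml -mulr_sumr !sumE sumr_const_nat subn1 /= -mulr_natl.
by field.
Qed.

Lemma ols_predictorE n d q m (y : nat -> 'cV[R]_d) (z : nat -> 'cV[R]_q)
    (x : nat -> 'cV[R]_m) z0 x0 :
  ols_predictor n y z x z0 x0 = smean n y + (ols_coef n y z x)^T *m
    (col_mx z0 x0 - smean n (fun i => col_mx (z i) (x i))).
Proof.
rewrite /ols_predictor /ols_b /ols_C /ols_B.
have -> : smean n (fun i => col_mx (z i) (x i)) = col_mx (smean n z) (smean n x).
  rewrite /smean -scale_col_mx; congr (_ *: _).
  apply/matrixP => i j; rewrite summxE -(splitK i).
  case: (fintype.split i) => a /=.
    by rewrite col_mxEu summxE; apply: eq_bigr => s _; rewrite col_mxEu.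
  by rewrite col_mxEd summxE; apply: eq_bigr => s _; rewrite col_mxEd.
rewrite -[in RHS](vsubmxK (ols_coef n y z x)) tr_col_mx opp_col_mx add_col_mx.
rewrite mul_row_col !mulmxBr.
by apply/matrixP => i j; rewrite !mxE; ring.
Qed.

(** This is the OLS predictor with [det_inv] in place of the pseudo-inverse: measurable in the data,
    and the same as soon as the sample covariance is invertible. *)
Definition unit_predictor n d p (y : nat -> 'cV[R]_d) (r : nat -> 'cV[R]_p) (r0 : 'cV[R]_p) :=
  smean n y + (det_inv (scov n r r) *m scov n r y)^T *m (r0 - smean n r).

Lemma ols_predictor_unit n d q m (y : nat -> 'cV[R]_d) (z : nat -> 'cV[R]_q)
    (x : nat -> 'cV[R]_m) z0 x0 (r := fun i => col_mx (z i) (x i)) :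
  scov n r r \in unitmx ->
  ols_predictor n y z x z0 x0 = unit_predictor n y r (col_mx z0 x0).
Proof. by move=> u; rewrite ols_predictorE /ols_coef mpinv_unit. Qed.

(** Writing the limit of the cross-covariances as [S *m K] presents the slope [K] directly as the
    solution of the limiting normal equations. *)
Lemma cvg_unit_predictor d p (y : nat -> 'cV[R]_d) (r : nat -> 'cV[R]_p)
    (r0 er : 'cV[R]_p) (ey : 'cV[R]_d) (S : 'M[R]_p) (K : 'M[R]_(p, d)) :
  S \in unitmx -> mx_cvg (fun n => smean n r) er -> mx_cvg (fun n => smean n y) ey ->
  mx_cvg (fun n => scov n r r) S -> mx_cvg (fun n => scov n r y) (S *m K) ->
  mx_cvg (fun n => unit_predictor n y r r0) (ey + K^T *m (r0 - er)).
Proof.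
move=> uS cr cy cS cK.
apply: mx_cvgD => //; apply: mx_cvgM; last by apply: mx_cvgB => //; exact: mx_cvg_cst.
apply: mx_cvg_tr; rewrite -[K]mul1mx -(mulVmx uS) -mulmxA.
apply: mx_cvgM => //; have -> : invmx S = det_inv S by rewrite /invmx uS.
exact: mx_cvg_det_inv.
Qed.

End least_squares_algebra.

(** * The model *)

Section independence.
Context (R : realType) (dO : measure_display) (Omega : measurableType dO)
  (P : probability Omega R).

Lemma indep_event_setC (E D : set Omega) : measurable E -> measurable D ->
  P (E `&` D) = (P E * P D)%E -> P (E `&` ~` D) = (P E * P (~` D))%E.
Proof.
move=> mE mD ED.
have -> : P (E `&` ~` D) = (P E - P (E `&` D))%E.
  by rewrite -setDE; apply: measureD => //; rewrite -ge0_fin_numE// fin_num_measure.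
have -> : P (~` D) = (1 - P D)%E by exact: probability_setC.
rewrite ED muleBr ?mule1//; first exact: fin_num_measure.
Qed.

Lemma indep_event_g_sigma (G : set_system Omega) (E : set Omega) :
  setI_closed G -> G `<=` measurable -> measurable E ->
  (forall D, G D -> P (E `&` D) = (P E * P D)%E) ->
  forall D, <<s G >> D -> measurable D /\ P (E `&` D) = (P E * P D)%E.
Proof.
move=> GI Gm mE PG D; rewrite -(setI_closed_g_dynkin_g_sigma_algebra GI).
pose H := [set D | measurable D /\ P (E `&` D) = (P E * P D)%E].
suff : <<d G >> `<=` H by apply.
apply: smallest_sub; last by move=> A GA; split; [exact: Gm|exact: PG].
split.
- by split => //; rewrite setIT probability_setT mule1.
- by move=> A [mA PA]; split; [exact: measurableC|exact: indep_event_setC].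
- move=> F tF HF; have mF n : measurable (F n) by have [] := HF n.
  have mEF n : measurable (E `&` F n) by exact: measurableI.
  split; first exact: bigcupT_measurable.
  rewrite setI_bigcupr.
  have -> : P (\bigcup_n (E `&` F n)) = (\sum_(n <oo) P (E `&` F n))%E.
    by apply: measure_semi_bigcup => //; [exact: trivIset_setIl|exact: bigcupT_measurable].
  have -> : P (\bigcup_n F n) = (\sum_(n <oo) P (F n))%E.
    by apply: measure_semi_bigcup => //; exact: bigcupT_measurable.
  rewrite -(@fineK _ (P E)) ?fin_num_measure// -nneseriesZl//.
  by apply: eq_eseriesr => n _; rewrite fineK ?fin_num_measure//; have [] := HF n.
Qed.

Lemma indep_rv_indic (X : Omega -> R) (E : set Omega) :
  measurable_fun setT X -> measurable E ->
  (forall B, measurable B -> P (X @^-1` B `&` E) = (P (X @^-1` B) * P E)%E) ->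
  indep_rv P X \1_E.
Proof.
move=> mX mE XE A B mA mB; have mXA := measurable_preimage mX mA.
rewrite preimage_indic; case: ifP => _; case: ifP => _.
- by rewrite setIT probability_setT mule1.
- exact: XE.
- exact/indep_event_setC/XE.
- by rewrite setI0 measure0 mule0.
Qed.

Lemma indic_le1 (A : set Omega) w : `|\1_A w : R| <= 1.
Proof. by rewrite indicE; case: (_ \in _); rewrite ?normr1 ?normr0. Qed.

(** A Dynkin class argument; the zero total expectation puts the whole space in the class and gives
    complements. *)
Lemma Ex_mul_indic_g_sigma (G : set_system Omega) (f : Omega -> R) :
  L1 P f -> setI_closed G -> G `<=` measurable -> Ex P f = 0 ->
  (forall D, G D -> Ex P (fun w => f w * \1_D w) = 0) ->
  forall D, <<s G >> D -> measurable D /\ Ex P (fun w => f w * \1_D w) = 0.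
Proof.
move=> f1 GI Gm f0 fG D; rewrite -(setI_closed_g_dynkin_g_sigma_algebra GI).
pose H := [set D | measurable D /\ Ex P (fun w => f w * \1_D w) = 0].
suff : <<d G >> `<=` H by apply.
have L1i A : measurable A -> L1 P (fun w => f w * \1_A w).
  by move=> mA; apply: (@L1_bddM _ _ _ _ _ _ 1) => // w; exact: indic_le1.
apply: smallest_sub; last by move=> A GA; split; [exact: Gm|exact: fG].
split.
- by split => //; rewrite -[RHS]f0; apply: eq_Ex => w; rewrite indicT mulr1.
- move=> A [mA fA]; split; first exact: measurableC.
  transitivity (Ex P (fun w => f w - f w * \1_A w)).
    by apply: eq_Ex => w; rewrite !indicE in_setC; case: (w \in A); rewrite /=; ring.
  by rewrite ExB// ?f0 ?fA ?subr0//; exact: L1i.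
- move=> F tF HF; have mF n : measurable (F n) by have [] := HF n.
  have mU : measurable (\bigcup_n F n) by exact: bigcupT_measurable.
  split => //; apply: EFin_inj; rewrite Ex_restrict// integral_bigcup//; last first.
    exact: integrableS f1.
  by apply: eseries0 => n _ _; rewrite -Ex_restrict//; have [_ ->] := HF n.
Qed.

Lemma indep_rv_sym (X Y : Omega -> R) : indep_rv P X Y -> indep_rv P Y X.
Proof. by move=> XY A B mA mB; rewrite setIC XY// muleC. Qed.

Lemma Ex_covE (X Y : Omega -> R) : L2 P X -> L2 P Y ->
  Ex P (fun w => (X w - Ex P X) * (Y w - Ex P Y)) =
  Ex P (fun w => X w * Y w) - Ex P X * Ex P Y.
Proof.
move=> X2 Y2; have X1 := L2_L1 X2; have Y1 := L2_L1 Y2; have XY := L2M X2 Y2.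
transitivity (Ex P (fun w => (X w * Y w - Ex P Y * X w) - (Ex P X * Y w - Ex P X * Ex P Y))).
  by apply: eq_Ex => w; ring.
rewrite !ExB ?ExZ ?Ex_cst//; try exact: L1Z; try exact: L1_cst.
- by ring.
- by apply: L1B => //; exact: L1Z.
- by apply: L1B; [exact: L1Z|exact: L1_cst].
Qed.

Lemma cov_mxE n (X : Omega -> 'cV[R]_n) i j :
  cov_mx P X i j = Ex P (fun w => (X w i 0 - Ex P (fun w => X w i 0)) *
                                  (X w j 0 - Ex P (fun w => X w j 0))).
Proof. by rewrite /cov_mx mxE unlock unlock. Qed.

Lemma zero_mean_Ex n (X : Omega -> 'cV[R]_n) i :
  zero_mean P X -> Ex P (fun w => X w i 0) = 0.
Proof. by move=> /(_ i); rewrite unlock /Ex /Rintegral => ->. Qed.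

End independence.

(** * The conditional mean of the response in the model *)

Section model.
Context (R : realType) (dO : measure_display) (Omega : measurableType dO)
  (P : probability Omega R) (d q m : nat).
Variables (b : 'cV[R]_d) (C : 'M[R]_(q, d)) (B : 'M[R]_(m, d))
  (M : eiv_vars P d q m).
Hypotheses (hmodel : eiv_model b C B M) (hindep : independent_blocks M)
  (hz2 : finite_second_moment P (vz M)) (hxi2 : finite_second_moment P (vxi M))
  (he2 : finite_second_moment P (ve M))
  (hepsdelta2 : finite_second_moment P (eps_delta M))
  (hSz : cov_mx P (vz M) \in unitmx) (hSx : cov_mx P (vx M) \in unitmx)
  (he0 : zero_mean P (ve M)) (hgauss : gaussian_vector P (eps_delta_xi M)).

Let zz j w : R := vz M w j 0.
Let xi k w : R := vxi M w k 0.
Let ee i w : R := ve M w i 0.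
Let ep i w : R := veps M w i 0.
Let dl k w : R := vdelta M w k 0.
Let xx k w : R := vx M w k 0.
Let yy i w : R := vy M w i 0.

Let mZ : measurable_fun setT (vz M). Proof. exact: measurable_funPT. Qed.
Let mE : measurable_fun setT (ve M). Proof. exact: measurable_funPT. Qed.
Let mXi : measurable_fun setT (vxi M). Proof. exact: measurable_funPT. Qed.
Let mED : measurable_fun setT (eps_delta M).
Proof.
apply: measurable_fun_mxP; apply: mx_meas_col; apply: mx_meas_comp; exact: measurable_funPT.
Qed.

Let zz2 j : L2 P (zz j). Proof. exact/Lfun2_L2/hz2. Qed.
Let xi2 k : L2 P (xi k). Proof. exact/Lfun2_L2/hxi2. Qed.
Let ee2 i : L2 P (ee i). Proof. exact/Lfun2_L2/he2. Qed.
Let ep2 i : L2 P (ep i).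
Proof.
apply: eq_L2 (Lfun2_L2 (hepsdelta2 (lshift m i))) => w.
by rewrite /eps_delta col_mxEu.
Qed.
Let dl2 k : L2 P (dl k).
Proof.
apply: eq_L2 (Lfun2_L2 (hepsdelta2 (rshift d k))) => w.
by rewrite /eps_delta col_mxEd.
Qed.

Let xxE k w : xx k w = xi k w + dl k w.
Proof. by rewrite /xx; have [_ ->] := hmodel w; rewrite mxE. Qed.

(** The part of [y] that may be correlated with [x]. Like [x], it is linear in [(eps, delta, xi)],
    so the two are jointly Gaussian. *)
Let W i w := \sum_k B k i * xi k w + ep i w.

Let yyE i w : yy i w = b i 0 + \sum_j C j i * zz j w + W i w + ee i w.
Proof.
rewrite /yy; have [-> _] := hmodel w; rewrite !mxE /W.
under eq_bigr do rewrite mxE.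
under [X in _ + X + _ + _]eq_bigr do rewrite mxE.
rewrite -!/(zz _ _) /xi /ee /ep /zz.
move: (\sum_j _) (\sum_j _) => u v; ring.
Qed.

Let xx2 k : L2 P (xx k).
Proof. by apply: eq_L2 (L2D (xi2 k) (dl2 k)) => w; rewrite xxE. Qed.
Let W2 i : L2 P (W i).
Proof. by apply: L2D => //; apply: L2_sum => k _; exact: L2Z. Qed.

Let sz := g_sigma_algebra_preimage (vz M).
Let sxi := g_sigma_algebra_preimage (vxi M).
Let se := g_sigma_algebra_preimage (ve M).
Let sed := g_sigma_algebra_preimage (eps_delta M).

(** A family closed under intersection that generates the sigma-algebra of [(xi, eps, delta)], for
    which [x] and [W] are measurable. *)
Let G : set_system Omega := [set D | exists A1 A2, [/\ sxi A1, sed A2 & D = A1 `&` A2]].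

Let blocks_prod A1 A2 A3 A4 : sz A1 -> sxi A2 -> se A3 -> sed A4 ->
  P (A1 `&` A2 `&` (A3 `&` A4)) = (P A1 * P A2 * (P A3 * P A4))%E.
Proof.
move=> s1 s2 s3 s4.
pose F := tnth [tuple A1; A2; A3; A4].
pose J : {fset 'I_4} := [fset i in enum 'I_4]%fset.
have JT i : i \in J by rewrite /J in_fset mem_enum.
have := hindep (J := J) (A := F).
have -> : \bigcap_(i in [set` J]) F i = A1 `&` A2 `&` (A3 `&` A4).
  apply/seteqP; split => w.
    move=> h; have {}h i : F i w by apply: h; rewrite /= JT.
    by split; split; [exact: (h 0)|exact: (h 1)|exact: (h 2)|exact: (h 3)].
  move=> [[w1 w2] [w3 w4]] i _; rewrite /F.
  by case: i => -[|[|[|[|//]]]] i4; rewrite (tnth_nth set0).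
move=> ->; last first.
  move=> i _; rewrite /F; case: i => -[|[|[|[|//]]]] i4;
    [exact: s1|exact: s2|exact: s3|exact: s4].
have pJ : perm_eq J (index_enum 'I_4).
  by apply: uniq_perm; [exact: fset_uniq|exact: index_enum_uniq|move=> i; rewrite JT mem_index_enum].
rewrite (perm_big _ pJ)/= !big_ord_recl big_ord0 mule1 /F !(tnth_nth set0) /=.
by rewrite !muleA.
Qed.

Let sz_meas A : sz A -> measurable A. Proof. by move=> [A' mA' <-]; exact: mZ. Qed.
Let sxi_meas A : sxi A -> measurable A. Proof. by move=> [A' mA' <-]; exact: mXi. Qed.
Let se_meas A : se A -> measurable A. Proof. by move=> [A' mA' <-]; exact: mE. Qed.
Let sed_meas A : sed A -> measurable A. Proof. by move=> [A' mA' <-]; exact: mED. Qed.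

Let szT : sz setT. Proof. by exists setT; rewrite ?setTI ?preimage_setT. Qed.
Let sxiT : sxi setT. Proof. by exists setT; rewrite ?setTI ?preimage_setT. Qed.
Let seT : se setT. Proof. by exists setT; rewrite ?setTI ?preimage_setT. Qed.
Let sedT : sed setT. Proof. by exists setT; rewrite ?setTI ?preimage_setT. Qed.

Let blocks_ze A A' : sz A -> se A' -> P (A `&` A') = (P A * P A')%E.
Proof.
move=> sA sA'; have := blocks_prod sA sxiT sA' sedT.
by rewrite !setIT probability_setT !mule1.
Qed.

(** Grouping of independent blocks. Fixing an event of [z] and one of [e] together gives at once the
    independence of [z] from [G], of [e] from [G], and of [e] from pairs of an event of [z] and one
    of [x]. *)
Let blocks_indep A A' D : sz A -> se A' -> <<s G >> D ->
  measurable D /\ P (A `&` A' `&` D) = (P A * P A' * P D)%E.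
Proof.
move=> sA sA' sD; rewrite -blocks_ze//.
apply: (indep_event_g_sigma _ _ _ _ sD).
- move=> _ _ [A1 [A2 [[B1 mB1 <-] [B2 mB2 <-] ->]]] [A3 [A4 [[B3 mB3 <-] [B4 mB4 <-] ->]]].
  exists (vxi M @^-1` (B1 `&` B3)), (eps_delta M @^-1` (B2 `&` B4)); split.
  + by exists (B1 `&` B3); [exact: measurableI|rewrite setTI].
  + by exists (B2 `&` B4); [exact: measurableI|rewrite setTI].
  + by rewrite !setTI !preimage_setI setIACA.
- by move=> _ [A1 [A2 [s1 s2 ->]]]; apply: measurableI; [exact: sxi_meas|exact: sed_meas].
- by apply: measurableI; [exact: sz_meas|exact: se_meas].
- move=> _ [A1 [A2 [s1 s2 ->]]].
  rewrite setIACA (blocks_prod sA s1 sA' s2) blocks_ze//.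
  have := blocks_prod szT s1 seT s2; rewrite !setTI probability_setT !mul1e => ->.
  by rewrite muleACA.
Qed.

Notation OG := (g_sigma_algebraType G).

Let blocks_zD A D : sz A -> <<s G >> D -> P (A `&` D) = (P A * P D)%E.
Proof.
move=> sA sD; have [_] := blocks_indep sA seT sD.
by rewrite setIT probability_setT mule1.
Qed.

Let blocks_eD A D : se A -> <<s G >> D -> P (A `&` D) = (P A * P D)%E.
Proof.
move=> sA sD; have [_] := blocks_indep szT sA sD.
by rewrite setTI probability_setT mul1e.
Qed.

Let OG_xi k : measurable_fun [set: OG] (xi k : OG -> R).
Proof.
move=> _ D mD; rewrite setTI; apply: sub_sigma_algebra.
exists (xi k @^-1` D), setT; split; rewrite ?setIT//.
exists [set v : 'cV[R]_m | D (v k 0)]; last by rewrite setTI.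
by apply: (measurable_preimage (measurable_mx_entry k 0)).
Qed.

Let OG_ed k : measurable_fun [set: OG] ((fun w => eps_delta M w k 0) : OG -> R).
Proof.
move=> _ D mD; rewrite setTI; apply: sub_sigma_algebra.
exists setT, ((fun w => eps_delta M w k 0) @^-1` D); split; rewrite ?setTI//.
exists [set v : 'cV[R]_(d + m) | D (v k 0)]; last by rewrite setTI.
by apply: (measurable_preimage (measurable_mx_entry k 0)).
Qed.

Let OG_ep i : measurable_fun [set: OG] (ep i : OG -> R).
Proof.
apply: eq_measurable_fun (OG_ed (lshift m i)) => w _.
by rewrite /eps_delta col_mxEu.
Qed.

Let OG_dl k : measurable_fun [set: OG] (dl k : OG -> R).
Proof.
apply: eq_measurable_fun (OG_ed (rshift d k)) => w _.
by rewrite /eps_delta col_mxEd.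
Qed.

Let OG_xx k : measurable_fun [set: OG] (xx k : OG -> R).
Proof.
by apply: eq_measurable_fun (measurable_funD (OG_xi k) (OG_dl k)) => w _; rewrite /= xxE.
Qed.

Let OG_W i : measurable_fun [set: OG] (W i : OG -> R).
Proof.
apply: measurable_funD; last exact: OG_ep.
by apply: measurable_sum => k; apply: measurable_funM => //; exact: OG_xi.
Qed.

Let OG_vx A : measurable A -> <<s G >> (vx M @^-1` A).
Proof.
move=> mA; have : measurable_fun [set: OG] (vx M : OG -> 'cV[R]_m).
  by apply: measurable_fun_mxP => k j; rewrite ord1; exact: OG_xx.
by move=> /measurable_preimage; apply.
Qed.

Let sz_zz j D : measurable D -> sz (zz j @^-1` D).
Proof.
move=> mD; exists [set v : 'cV[R]_q | D (v j 0)]; last by rewrite setTI.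
by apply: (measurable_preimage (measurable_mx_entry j 0)).
Qed.

Let se_ee i D : measurable D -> se (ee i @^-1` D).
Proof.
move=> mD; exists [set v : 'cV[R]_d | D (v i 0)]; last by rewrite setTI.
by apply: (measurable_preimage (measurable_mx_entry i 0)).
Qed.

Let indep_z_OG j (f : Omega -> R) : measurable_fun [set: OG] (f : OG -> R) ->
  indep_rv P (zz j) f.
Proof.
move=> mf D D' mD mD'; apply: blocks_zD; first exact: sz_zz.
exact: (measurable_preimage mf mD').
Qed.

Let indep_e_OG i (f : Omega -> R) : measurable_fun [set: OG] (f : OG -> R) ->
  indep_rv P (ee i) f.
Proof.
move=> mf D D' mD mD'; apply: blocks_eD; first exact: se_ee.
exact: (measurable_preimage mf mD').
Qed.

Let indep_z_e j i : indep_rv P (zz j) (ee i).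
Proof. by move=> D D' mD mD'; apply: blocks_ze; [exact: sz_zz|exact: se_ee]. Qed.

Let U k w : R := xx k w - Ex P (xx k).
(** The slope of the linear regression of [W] on [x], with residual [V]. [W] may stay uncentered in
    the cross-covariance because [U] is centered. *)
Let K : 'M[R]_(m, d) := invmx (cov_mx P (vx M)) *m
  \matrix_(k, i) Ex P (fun w => U k w * W i w).
Let V i w : R := (W i w - Ex P (W i)) - \sum_k K k i * U k w.

Let U2 k : L2 P (U k). Proof. by apply: L2B => //; exact: L2_cst. Qed.

Let Ex_U k : Ex P (U k) = 0.
Proof. by rewrite ExB ?Ex_cst ?subrr//; [exact: L2_L1|exact: L1_cst]. Qed.

Let V2 i : L2 P (V i).
Proof.
apply: L2B; first by apply: L2B => //; exact: L2_cst.
by apply: L2_sum => k _; exact: L2Z.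
Qed.

Let Ex_V i : Ex P (V i) = 0.
Proof.
rewrite ExB; last 2 first.
- by apply: L2_L1; apply: L2B => //; exact: L2_cst.
- by apply: L1_sum => k _; apply: L1Z; exact: L2_L1.
rewrite ExB ?Ex_cst ?subrr ?sub0r; [|exact: L2_L1|exact: L1_cst].
rewrite Ex_sum; last by move=> k _; apply: L1Z; exact: L2_L1.
by rewrite big1 ?oppr0// => k _; rewrite ExZ ?Ex_U ?mulr0//; exact: L2_L1.
Qed.

Let cov_xxE k l : cov_mx P (vx M) k l = Ex P (fun w => U k w * U l w).
Proof. exact: cov_mxE. Qed.

Let Ex_VU i k : Ex P (fun w => V i w * U k w) = 0.
Proof.
have UU l : L1 P (fun w => U k w * U l w) by exact: L2M.
transitivity (Ex P (fun w => (U k w * W i w - Ex P (W i) * U k w) -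
    \sum_l K l i * (U k w * U l w))).
  apply: eq_Ex => w; rewrite /V mulrBl mulr_suml; congr (_ - _); first by ring.
  by apply: eq_bigr => l _; ring.
have kw : L1 P (fun w => U k w * W i w) by exact: L2M.
have u1 : L1 P (fun w => Ex P (W i) * U k w) by apply: L1Z; exact: L2_L1.
rewrite ExB ?ExB ?ExZ ?Ex_U ?mulr0 ?subr0//; last 3 first.
- exact: L2_L1.
- exact: L1B.
- by apply: L1_sum => l _; exact: L1Z.
rewrite Ex_sum; last by move=> l _; exact: L1Z.
have : (cov_mx P (vx M) *m K) k i = Ex P (fun w => U k w * W i w).
  by rewrite /K mulmxA mulmxV// mul1mx mxE.
rewrite mxE => <-; rewrite -sumrB big1// => l _.
by rewrite ExZ// cov_xxE mulrC subrr.
Qed.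

Let gauss_comb i (s : R) (t : 'I_m -> R) : exists X : Omega -> R,
  [/\ gaussian_rv P X, L2 P X &
      forall w, s * V i w + \sum_k t k * U k w = X w - Ex P X].
Proof.
(* Expanding [V] leaves [s] on [W] and [c] on [x]. Since [x = xi + delta], the vector [a] below then
   has [s] on the [i]-th entry of [eps], [c] on [delta], and [s * B + c] on [xi]. *)
pose c k := t k - s * K k i.
pose X w := s * W i w + \sum_k c k * xx k w.
have X2 : L2 P X by apply: L2D; [exact: L2Z|apply: L2_sum => k _; exact: L2Z].
exists X; split => //.
- pose a : 'cV[R]_(d + m + m) := col_mx (col_mx (s *: delta_mx i 0) (\col_k c k))
    (\col_k (s * B k i + c k)).
  have := hgauss a; congr (gaussian_rv P _); apply/funext => w.
  rewrite /eps_delta_xi /eps_delta /a !tr_col_mx !mul_row_col.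
  rewrite linearZ/= -scalemxAl trmx_delta -rowE !mxE.
  rewrite /X /W mulrDr [_ + s * ep i w]addrC -!addrA; congr (_ + _).
  rewrite mulr_sumr -!big_split/=.
  by apply: eq_bigr => k _; rewrite !mxE xxE /xi /dl; ring.
- move=> w; have -> : Ex P X = s * Ex P (W i) + \sum_k c k * Ex P (xx k).
    rewrite ExD ?ExZ ?Ex_sum//; try exact: L2_L1.
    + by congr (_ + _); apply: eq_bigr => k _; rewrite ExZ//; exact: L2_L1.
    + by move=> k _; apply: L1Z; exact: L2_L1.
    + by apply: L1Z; exact: L2_L1.
    + by apply: L1_sum => k _; apply: L1Z; exact: L2_L1.
  rewrite /V /X mulrBr mulr_sumr -addrA -sumrN -big_split/=.
  rewrite opprD addrACA -mulrBr -sumrB; congr (_ + _).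
  by apply: eq_bigr => k _; rewrite /c /U; ring.
Qed.

(** [x] and its centered version [U] differ by constants, so events of [x] belong to the
    sigma-algebra generated by [U]. *)
Let Ex_V_vx i A : measurable A -> Ex P (fun w => V i w * \1_(vx M @^-1` A) w) = 0.
Proof.
move=> mA; apply: (gaussian_uncorrelated_Ex_indic (V2 i) U2 (gauss_comb i) (Ex_VU i)).
set H := \bigcup_(j in _) _.
have mU k : measurable_fun [set: g_sigma_algebraType H] (U k : g_sigma_algebraType H -> R).
  by move=> _ D mD; apply: sub_sigma_algebra; exists k => //; exists D.
have : measurable_fun [set: g_sigma_algebraType H] (vx M : g_sigma_algebraType H -> 'cV[R]_m).
  apply: measurable_fun_mxP => k j; rewrite ord1.
  apply: eq_measurable_fun (measurable_funD (mU k) (measurable_cst (Ex P (xx k)))) => w _.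
  by rewrite /U /= subrK.
by move=> /measurable_preimage; apply.
Qed.

Let res i w : R := ee i w + V i w.

Let Ex_ee i : Ex P (ee i) = 0. Proof. exact: zero_mean_Ex. Qed.

Let res_L1 i : L1 P (res i).
Proof. by apply: L1D; exact: L2_L1. Qed.

Let OG_V i : measurable_fun [set: OG] (V i : OG -> R).
Proof.
apply: measurable_funB; first by apply: measurable_funB => //; exact: OG_W.
apply: measurable_sum => k; apply: measurable_funM => //.
by apply: measurable_funB => //; exact: OG_xx.
Qed.

(** The two parts of the residual vanish for different reasons: [e] is centered and independent of
    [(z, x)], while for [V] the event of [z] factors out by independence and leaves the Gaussian
    orthogonality on an event of [x]. *)
Let Ex_res_rect i A1 A2 : measurable A1 -> measurable A2 ->
  Ex P (fun w => res i w * \1_(vz M @^-1` A1 `&` vx M @^-1` A2) w) = 0.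
Proof.
move=> mA1 mA2; set E1 := vz M @^-1` A1; set E2 := vx M @^-1` A2.
have sE1 : sz E1 by exists A1 => //; rewrite setTI.
have sE2 : <<s G >> E2 by exact: OG_vx.
have mE1 : measurable E1 by exact: sz_meas.
have mE2 : measurable E2 by have [] := blocks_indep szT seT sE2.
have mE12 : measurable (E1 `&` E2) by exact: measurableI.
have V1 := L2_L1 (V2 i); have ee1 := L2_L1 (ee2 i).
transitivity (Ex P (fun w => ee i w * \1_(E1 `&` E2) w +
                             \1_E1 w * (V i w * \1_E2 w))).
  apply: eq_Ex => w; rewrite /res !indicE in_setI.
  by case: (w \in E1); case: (w \in E2); rewrite /=; ring.
have VE2 : L2 P (fun w => V i w * \1_E2 w).
  by apply: (@L2_bddM _ _ _ _ _ _ 1) => // w; exact: indic_le1.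
have iE1 : L2 P \1_E1 by apply: (@L2_bdd _ _ _ _ _ 1) => // w; exact: indic_le1.
have iE12 : L2 P \1_(E1 `&` E2) by apply: (@L2_bdd _ _ _ _ _ 1) => // w; exact: indic_le1.
rewrite ExD; [|exact: L2M|exact: L2M].
rewrite Ex_mul_indep//; last first.
  apply: indep_rv_indic => // [|D mD]; first by case: (ee2 i).
  have [_] := blocks_indep sE1 (se_ee i mD) sE2.
  by rewrite (blocks_zD sE1 sE2) setIA [_ `&` E1]setIC => ->; rewrite -muleA muleCA.
rewrite Ex_ee mul0r add0r Ex_mul_indep//; first by rewrite Ex_V_vx// mulr0.
apply: indep_rv_sym; apply: indep_rv_indic => //; first by case: VE2.
move=> D mD; rewrite setIC muleC; apply: blocks_zD => //.
have mVE2 : measurable_fun [set: OG] ((fun w => V i w * \1_E2 w) : OG -> R).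
  by apply: measurable_funM; [exact: OG_V|exact: measurable_indic].
exact: (measurable_preimage mVE2 mD).
Qed.

Let Ex_res_zx i A : measurable A -> Ex P (fun w => res i w * \1_(zx M @^-1` A) w) = 0.
Proof.
pose H := [set D | exists A1 A2, [/\ measurable A1, measurable A2 &
  D = vz M @^-1` A1 `&` vx M @^-1` A2]].
move=> mA; have HE : <<s H >> (zx M @^-1` A).
  have Hz k : measurable_fun [set: g_sigma_algebraType H] (zz k : g_sigma_algebraType H -> R).
    move=> _ D mD; rewrite setTI; apply: sub_sigma_algebra.
    exists [set v : 'cV[R]_q | D (v k 0)], setT; split => //; last by rewrite preimage_setT setIT.
    by apply: (measurable_preimage (measurable_mx_entry k 0)).
  have Hx k : measurable_fun [set: g_sigma_algebraType H] (xx k : g_sigma_algebraType H -> R).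
    move=> _ D mD; rewrite setTI; apply: sub_sigma_algebra.
    exists setT, [set v : 'cV[R]_m | D (v k 0)]; split => //; last by rewrite preimage_setT setTI.
    by apply: (measurable_preimage (measurable_mx_entry k 0)).
  have : measurable_fun [set: g_sigma_algebraType H]
      (zx M : g_sigma_algebraType H -> 'cV[R]_(q + m)).
    apply: measurable_fun_mxP; apply: mx_meas_col => k j; rewrite ord1; [exact: Hz|exact: Hx].
  by move=> /measurable_preimage; apply.
have mX : measurable_fun setT (vx M) by exact: measurable_funPT.
suff [//] : measurable (zx M @^-1` A) /\ Ex P (fun w => res i w * \1_(zx M @^-1` A) w) = 0.
apply: (Ex_mul_indic_g_sigma _ _ _ _ _ HE) => //.
- move=> _ _ [A1 [A2 [mA1 mA2 ->]]] [A3 [A4 [mA3 mA4 ->]]].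
  exists (A1 `&` A3), (A2 `&` A4); split; [exact: measurableI|exact: measurableI|].
  by rewrite !preimage_setI setIACA.
- by move=> _ [A1 [A2 [mA1 mA2 ->]]]; apply: measurableI; exact: measurable_preimage.
- by rewrite /res ExD ?Ex_V ?Ex_ee ?addr0//; exact: L2_L1.
- by move=> _ [A1 [A2 [mA1 mA2 ->]]]; exact: Ex_res_rect.
Qed.

Let yyD i w : yy i w = Ex P (yy i) + \sum_j C j i * (zz j w - Ex P (zz j)) +
  \sum_k K k i * U k w + res i w.
Proof.
have CZ : L1 P (fun w => \sum_j C j i * zz j w).
  by apply: L1_sum => j _; apply: L1Z; exact: L2_L1.
have -> : Ex P (yy i) = b i 0 + \sum_j C j i * Ex P (zz j) + Ex P (W i).
  transitivity (Ex P (fun w => b i 0 + \sum_j C j i * zz j w + W i w + ee i w)).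
    exact: eq_Ex.
  have W1 := L2_L1 (W2 i); have b1 := @L1_cst _ _ _ P (b i 0); have e1 := L2_L1 (ee2 i).
  rewrite (ExD (L1D (L1D b1 CZ) W1) e1) (ExD (L1D b1 CZ) W1) (ExD b1 CZ).
  rewrite Ex_cst Ex_ee addr0 Ex_sum; last by move=> j _; apply: L1Z; exact: L2_L1.
  congr (_ + _ + _); apply: eq_bigr => j _; rewrite ExZ//; exact: L2_L1.
rewrite yyE /res /V.
under [\sum_j C j i * (_ - _)]eq_bigr do rewrite mulrBr.
by rewrite sumrB; ring.
Qed.

Lemma L2_response i : L2 P (yy i).
Proof.
apply: eq_L2 (_ : L2 P (fun w => b i 0 + \sum_j C j i * zz j w + W i w + ee i w)) => [w|].
  by rewrite yyE.
apply: L2D => //; apply: L2D => //; apply: L2D; first exact: L2_cst.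
by apply: L2_sum => j _; exact: L2Z.
Qed.

Let r k w : R := zx M w k 0.
Let rz j : r (lshift m j) = zz j.
Proof. by apply/funext => w; rewrite /r /zx col_mxEu. Qed.
Let rx k : r (rshift q k) = xx k.
Proof. by apply/funext => w; rewrite /r /zx col_mxEd. Qed.

Lemma L2_regressor k : L2 P (fun w => zx M w k 0).
Proof.
by rewrite -[fun w => _]/(r k) -(splitK k); case: (fintype.split k) => a /=; rewrite ?rz ?rx.
Qed.

(** Independence of [z] and [x] makes this covariance block diagonal, with the two covariances
    assumed nonsingular as its blocks. *)
Lemma cov_zx_unit : cov_mx P (zx M) \in unitmx.
Proof.
have zx0 j k : Ex P (fun w => (zz j w - Ex P (zz j)) * (xx k w - Ex P (xx k))) = 0.
  rewrite Ex_covE// Ex_mul_indep ?subrr//; exact: indep_z_OG.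
suff -> : cov_mx P (zx M) = block_mx (cov_mx P (vz M)) 0 0 (cov_mx P (vx M)).
  by move: hSz hSx; rewrite !unitmxE det_ublock unitrM => -> ->.
have covE k l : cov_mx P (zx M) k l =
    Ex P (fun w => (r k w - Ex P (r k)) * (r l w - Ex P (r l))) by exact: cov_mxE.
apply/matrixP => k l; rewrite covE -(splitK k) -(splitK l).
case: (fintype.split k) => k'; case: (fintype.split l) => l' /=.
- by rewrite block_mxEul cov_mxE !rz.
- by rewrite block_mxEur mxE !rz !rx zx0.
- by rewrite block_mxEdl mxE !rz !rx -[RHS](zx0 l' k'); apply: eq_Ex => w; rewrite mulrC.
- by rewrite block_mxEdr cov_mxE !rx.
Qed.

(** The slope is [C] on [z] and, because of the measurement error, [K] rather than [B] on [x]. What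
    follows needs only the two stated properties of the slope: the normal equations, which identify
    the OLS limit, and orthogonality, which identifies the conditional mean. *)
Lemma linear_conditional_mean : exists L : 'M[R]_(q + m, d),
  (forall k i, Ex P (fun w => zx M w k 0 * vy M w i 0) -
     Ex P (fun w => zx M w k 0) * Ex P (fun w => vy M w i 0) =
     (cov_mx P (zx M) *m L) k i) /\
  (forall i A, measurable A -> Ex P (fun w => (vy M w i 0 -
     (Ex P (fun w => vy M w i 0) +
      \sum_k L k i * (zx M w k 0 - Ex P (fun w => zx M w k 0)))) *
     \1_(zx M @^-1` A) w) = 0).
Proof.
exists (col_mx C K).
have yyL i w : yy i w - (Ex P (yy i) + \sum_k col_mx C K k i * (r k w - Ex P (r k))) =
    res i w.
  have -> : \sum_k col_mx C K k i * (r k w - Ex P (r k)) =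
      \sum_j C j i * (zz j w - Ex P (zz j)) + \sum_k K k i * U k w.
    rewrite big_split_ord; congr (_ + _); apply: eq_bigr => k _.
      by rewrite col_mxEu rz.
    by rewrite col_mxEd rx.
  by rewrite yyD; ring.
split; last first.
  move=> i A mA; rewrite -[RHS](Ex_res_zx i mA); apply: eq_Ex => w.
  by rewrite -yyL.
move=> k i; rewrite -![fun w => vy M w i 0]/(yy i) -![fun w => zx M w k 0]/(r k).
have r2 l : L2 P (r l) by exact: L2_regressor.
have rD2 l : L2 P (fun w => r l w - Ex P (r l)) by apply: L2B => //; exact: L2_cst.
have res2 : L2 P (res i) by exact: L2D.
(* This is equivalent to the normal equations: [e] is independent of the regressors, and [V] is
   independent of [z] and, by the choice of [K], uncorrelated with [x]. *)
have rres : Ex P (fun w => (r k w - Ex P (r k)) * res i w) = 0.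
  transitivity (Ex P (fun w => (r k w - Ex P (r k)) * ee i w + V i w * (r k w - Ex P (r k)))).
    by apply: eq_Ex => w; rewrite /res; ring.
  rewrite ExD; [|exact: L2M|exact: L2M].
  have rD0 : Ex P (fun w => r k w - Ex P (r k)) = 0.
    by rewrite ExB ?Ex_cst ?subrr//; [exact: L2_L1|exact: L1_cst].
  have mD (c : R) : measurable_fun setT (fun x : R => x - c) by exact: measurable_funB.
  rewrite Ex_mul_indep//; last first.
    rewrite -(splitK k); case: (fintype.split k) => a /=; rewrite ?rz ?rx.
      exact: (indep_rv_comp (g := fun x => x - _) (h := id) (mD _) _ (indep_z_e a i)).
    apply: indep_rv_sym; apply: indep_e_OG.
    by apply: measurable_funB => //; exact: OG_xx.
  rewrite rD0 mul0r add0r.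
  rewrite -(splitK k); case: (fintype.split k) => a /=; rewrite ?rz ?rx; last exact: Ex_VU.
  rewrite Ex_mul_indep ?Ex_V ?mul0r//; last by apply: L2B => //; exact: L2_cst.
  apply: indep_rv_sym.
  exact: (indep_rv_comp (g := fun x => x - _) (h := id) (mD _) _ (indep_z_OG a (OG_V i))).
have y2 := L2_response i.
rewrite -Ex_covE//; last exact: L2_regressor.
transitivity (Ex P (fun w => \sum_l col_mx C K l i * ((r k w - Ex P (r k)) * (r l w - Ex P (r l))) +
   (r k w - Ex P (r k)) * res i w)).
  apply: eq_Ex => w; rewrite -yyL -/(yy i w).
  under eq_bigr do rewrite mulrCA.
  by rewrite -mulr_sumr -[LHS]/((r k w - Ex P (r k)) * (yy i w - Ex P (yy i))); ring.
have rr l : L1 P (fun w => (r k w - Ex P (r k)) * (r l w - Ex P (r l))) by exact: L2M.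
rewrite ExD; [|by apply: L1_sum => l _; exact: L1Z|exact: L2M].
rewrite rres addr0 Ex_sum; last by move=> l _; exact: L1Z.
by rewrite mxE; apply: eq_bigr => l _; rewrite ExZ// cov_mxE mulrC.
Qed.

End model.

(** * Conditional probabilities *)

Section conditional_expectation.
Context (R : realType) (dO : measure_display) (Omega : measurableType dO)
  (P : probability Omega R).

Lemma Ex_eq0_ae (f : Omega -> R) : L1 P f -> (forall w, 0 <= f w) -> Ex P f = 0 ->
  {ae P, forall w, f w = 0}.
Proof.
move=> f1 f0 Ef; have mf : measurable_fun setT (EFin \o f) by exact: measurable_int f1.
have : (\int[P]_w `|(EFin \o f) w|)%E = 0%E.
  under eq_integral => w _ do rewrite /= ger0_norm//.
  by rewrite -EFin_Ex// Ef.
move/(ae_eq_integral_abs _ measurableT mf); apply: filterS => w /(_ I).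
by case.
Qed.

(* [E] need not be measurable: the error events of the theorem involve [mpinv]. *)
Lemma integral_indic_le (A E F : set Omega) : E `<=` F ->
  (\int[P]_(w in A) (\1_E w)%:E <= \int[P]_(w in A) (\1_F w)%:E)%E.
Proof.
move=> EF; rewrite !ge0_integralE; try by move=> w _; rewrite lee_fin.
apply: ereal_sup_le => _ [h hE <-]; exists h => // w.
apply: le_trans (hE w) _; rewrite !patchE; case: ifP => // _.
rewrite lee_fin !indicE; case: (boolP (w \in E)) => //.
by rewrite inE => /EF Fw; rewrite mem_set.
Qed.

Context (d' : measure_display) (T' : measurableType d') (Z : Omega -> T').
Hypothesis mZ : measurable_fun setT Z.

Let G := g_sigma_algebra_preimage Z.
Let GT := g_sigma_algebra_preimageType Z.

Lemma g_sigma_algebra_preimage_meas D : G D -> measurable D.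
Proof. by move=> [A mA <-]; exact: mZ. Qed.

Lemma g_sigma_algebra_preimage_fun (Y : Omega -> R) :
  (forall B, measurable B -> G (Y @^-1` B)) -> measurable_fun [set: GT] (Y : GT -> R).
Proof. by move=> mY _ B mB; rewrite setTI; exact: mY. Qed.

(** Testing against the event where [f] is positive and against its complement gives [E|f| = 0].
    This is the almost sure uniqueness of conditional expectations. *)
Lemma orthogonal_ae0 (f : Omega -> R) : measurable_fun [set: GT] (f : GT -> R) -> L1 P f ->
  (forall D, G D -> Ex P (fun w => f w * \1_D w) = 0) -> {ae P, forall w, f w = 0}.
Proof.
move=> mf f1 fG; pose D := f @^-1` `]0, +oo[.
have GD : G D by apply: (measurable_preimage mf).
have GC : G (~` D) by exact: (@measurableC _ GT).
have f1D E : G E -> L1 P (fun w => f w * \1_E w).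
  move=> GE; apply: (@L1_bddM _ _ _ _ _ _ 1) => //; last by move=> w; exact: indic_le1.
  by apply: measurable_indic; exact: g_sigma_algebra_preimage_meas.
have fE w : `|f w| = f w * \1_D w - f w * \1_(~` D) w.
  rewrite !indicE in_setC; case: (boolP (w \in D)); rewrite /= ?inE.
    by rewrite /D /= in_itv/= andbT => /gtr0_norm ->; ring.
  move/negP; rewrite inE /D /= in_itv/= andbT => /negP; rewrite -leNgt => /ler0_norm ->.
  by ring.
have : {ae P, forall w, `|f w| = 0}.
  apply: Ex_eq0_ae => //; first exact: L1_abs.
  by rewrite (eq_Ex _ fE) ExB ?fG ?subrr//; exact: f1D.
by apply: filterS => w /normr0_eq0.
Qed.

(** A version may be negative on a null set, whereas the maximal inequality bounds it only from
    above. Testing on the event where [p] is negative settles the sign. *)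
Lemma cond_prob_ge0 (E : set Omega) (p : Omega -> R) : is_cond_prob P G E p ->
  {ae P, forall w, 0 <= p w}.
Proof.
move=> [mp ip Ep]; pose D := p @^-1` `]-oo, 0[.
have GD : G D by apply: mp.
have mD := g_sigma_algebra_preimage_meas GD.
have p1D : L1 P (fun w => p w * \1_D w).
  by apply: (@L1_bddM _ _ _ _ _ _ 1) => // w; exact: indic_le1.
have DE w : w \in D = (p w < 0) by apply/idP/idP; rewrite inE /D /= in_itv.
have pD0 w : 0 <= - (p w * \1_D w).
  by rewrite indicE DE oppr_ge0; case: ltP => [/ltW|_]; rewrite ?mulr1 ?mulr0.
have : {ae P, forall w, - (p w * \1_D w) = 0}.
  apply: Ex_eq0_ae => //; first exact: L1N.
  apply: le_anti; rewrite Ex_ge0// andbT.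
  have -> : Ex P (fun w => - (p w * \1_D w)) = - Ex P (fun w => p w * \1_D w).
    by rewrite -mulN1r -ExZ//; apply: eq_Ex => w; rewrite mulN1r.
  rewrite oppr_le0 -lee_fin Ex_restrict// Ep//.
  by apply: integral_ge0 => w _; rewrite lee_fin.
apply: filterS => w; rewrite indicE DE; case: ltP => // pw.
by rewrite mulr1 => /eqP; rewrite oppr_eq0 => /eqP pw0; move: pw; rewrite pw0 ltxx.
Qed.

(* Decomposing according to the first [k >= N] with [p k > c] keeps every
   piece in [G]. *)
Lemma cond_prob_maximal (E F : nat -> set Omega) (p : nat -> Omega -> R) (c : R) N :
  (forall n, is_cond_prob P G (E n) (p n)) -> (forall n, measurable (F n)) ->
  (forall n, E n `<=` F n) -> 0 <= c ->
  (c%:E * P (\bigcup_(n in [set n | (N <= n)%N]) [set w | (c < p n w)%R]) <=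
   P (\bigcup_(n in [set n | (N <= n)%N]) F n))%E.
Proof.
move=> Ep mF EF c0; set Q := (X in (_ <= P X)%E).
have mQ : measurable Q by exact: bigcup_measurable.
(* Emptying the indices below [N] makes [seqDU B k] the event that the first crossing of [c] from
   time [N] on occurs at [k]. *)
pose B k : set Omega := if (N <= k)%N then p k @^-1` `]c, +oo[ else set0.
have BE k : (N <= k)%N -> B k = [set w | c < p k w].
  by move=> Nk; rewrite /B Nk; apply/seteqP; split => w /=; rewrite in_itv/= andbT.
have -> : \bigcup_(n in [set n | (N <= n)%N]) [set w | c < p n w] = \bigcup_k seqDU B k.
  rewrite -seqDU_bigcup_eq; apply/seteqP; split => w [k].
    by move=> /= Nk pw; exists k => //; rewrite BE.
  by rewrite /B; case: ifPn => // Nk _ pw; exists k => //=; move: pw; rewrite /= in_itv/= andbT.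
have GB k : G (B k).
  rewrite /B; case: ifP => _; last exact: (@measurable0 _ GT).
  by have [mp _ _] := Ep k; exact: mp.
have GA k : G (seqDU B k) by apply: (@seqDU_measurable _ GT).
have mA k := g_sigma_algebra_preimage_meas (GA k).
have tA := @trivIset_seqDU _ B.
have step k : (c%:E * P (seqDU B k) <= P (Q `&` seqDU B k))%E.
  case: (leqP N k) => Nk; last first.
    have -> : seqDU B k = set0.
      by rewrite /seqDU /B leqNgt Nk set0D.
    by rewrite measure0 mule0.
  have [mp ip pE] := Ep k.
  apply: (@le_trans _ _ (\int[P]_(w in seqDU B k) (p k w)%:E)%E).
    rewrite -integral_cst//; apply: ge0_le_integral => //.
    - exact: measurable_funS (measurable_int P ip).
    - by move=> w [+ _]; rewrite BE//= => cw; rewrite lee_fin ltW.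
  (* The piece lies in [G], so the defining identity of [p k] applies to it; passing from [E k] to
     [F k] makes the integral a probability. *)
  rewrite pE//; apply: le_trans (integral_indic_le _ (EF k)) _.
  rewrite integral_indic//; apply: le_measure; rewrite ?inE; try exact: measurableI.
  by apply: setSI => w Fw; exists k.
have -> : P (\bigcup_k seqDU B k) = (\sum_(k <oo) P (seqDU B k))%E.
  by apply: measure_semi_bigcup => //; exact: bigcupT_measurable.
rewrite -nneseriesZl//; apply: (@le_trans _ _ (\sum_(k <oo) P (Q `&` seqDU B k))%E).
  apply: lee_nneseries => [k _ _|k _]; last exact: step.
  by rewrite mule_ge0.
have <- : P (\bigcup_k (Q `&` seqDU B k)) = (\sum_(k <oo) P (Q `&` seqDU B k))%E.
  apply: measure_semi_bigcup => //.
  - by move=> k; exact: measurableI.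
  - exact: trivIset_setIl.
  - by apply: bigcupT_measurable => k; exact: measurableI.
rewrite -setI_bigcupr; apply: le_measure; rewrite ?inE//.
by apply: measurableI => //; exact: bigcupT_measurable.
Qed.

(** For fixed [c > 0] the event that [p n > c] infinitely often has probability at most
    [P (Q N) / c] for every [N], hence is null. The countably many levels [1 / k.+1] then give
    convergence. *)
Lemma cond_prob_cvg0 (E F : nat -> set Omega) (p : nat -> Omega -> R) :
  (forall n, is_cond_prob P G (E n) (p n)) -> (forall n, measurable (F n)) ->
  (forall n, E n `<=` F n) -> {ae P, forall w, \forall n \near \oo, ~ F n w} ->
  {ae P, forall w, p n w @[n --> \oo] --> (0 : R)}.
Proof.
move=> Ep mF EF FE.
pose Q N := \bigcup_(n in [set n | (N <= n)%N]) F n.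
have mQ N : measurable (Q N) by exact: bigcup_measurable.
have Q0 : P (Q N) @[N --> \oo] --> 0%E.
  have -> : 0%E = P (\bigcap_N Q N).
    apply/esym/measure_negligible; first exact: bigcapT_measurable.
    move: FE; apply: negligibleS => w Qw /= [N _ FN].
    have [n /= Nn Fn] := Qw N I.
    exact: (FN n Nn).
  apply: nonincreasing_cvg_mu => //.
  - exact: (le_lt_trans (probability_le1 P (mQ 0%N)) (ltry 1)).
  - exact: bigcapT_measurable.
  - move=> N N' NN'; apply/subsetPset => w [n /= Nn Fn]; exists n => //=.
    exact: leq_trans Nn.
pose H (c : R) N := \bigcup_(n in [set n | (N <= n)%N]) [set w | c < p n w].
have mp n : measurable_fun setT (p n).
  by have [_ ip _] := Ep n; apply/measurable_EFinP; exact: measurable_int ip.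
have mH c N : measurable (H c N).
  apply: bigcup_measurable => n _.
  have -> : [set w | c < p n w] = p n @^-1` `]c, +oo[.
    by apply/seteqP; split => w /=; rewrite in_itv/= andbT.
  exact: measurable_preimage.
have H0 (c : R) : 0 < c -> {ae P, forall w, exists N, ~ H c N w}.
  move=> c0; suff PH : P (\bigcap_N H c N) = 0%E.
    exists (\bigcap_N H c N); split; [exact: bigcapT_measurable|by []|].
    by move=> w /= nH N _; apply: contrapT => HN; apply: nH; exists N.
  apply: le_anti; rewrite measure_ge0 andbT.
  rewrite -(@lee_pmul2l _ c%:E)// mule0.
  rewrite -(cvg_lim (@ereal_hausdorff R) Q0); apply: lime_ge; first by apply/cvg_ex; exists 0%E.
  apply: nearW => N; apply: le_trans (cond_prob_maximal N Ep mF EF (ltW c0)).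
  rewrite lee_pmul2l//; apply: le_measure; rewrite ?inE.
  - exact: bigcapT_measurable.
  - exact: (mH c N).
  - by move=> w; apply.
have pH : {ae P, forall w, forall k, exists N, ~ H k.+1%:R^-1 N w}.
  by apply: ae_foralln => k; exact: H0.
have p0 : {ae P, forall w, forall n, 0 <= p n w}.
  by apply: ae_foralln => n; exact: (cond_prob_ge0 (Ep n)).
apply: filterS2 pH p0 => w Hw pw.
apply/cvgrPdist_le => e e0; have [k ke] := ltr_add_invr e0.
have [N HN] := Hw k.
exists N => // n /= Nn; rewrite sub0r normrN ger0_norm//.
rewrite leNgt; apply/negP => epn; apply: HN; exists n => //=.
by apply: lt_trans epn; rewrite -[X in X < _]add0r.
Qed.

End conditional_expectation.

(** * Convergence of the predictor *)

Section copies.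
Context (R : realType) (dO : measure_display) (Omega : measurableType dO)
  (P : probability Omega R) (N : nat).
Variables (S0 : Omega -> 'cV[R]_N) (S : nat -> Omega -> 'cV[R]_N).
Hypotheses (mS0 : measurable_fun setT S0) (mS : forall i, measurable_fun setT (S i))
  (lawS : forall i, same_law P (S i) S0)
  (indepS : mutually_independent P (fun i => g_sigma_algebra_preimage (S i))).

Lemma indep_copies i j (A B : set 'cV[R]_N) : i != j -> measurable A -> measurable B ->
  P (S i @^-1` A `&` S j @^-1` B) = (P (S i @^-1` A) * P (S j @^-1` B))%E.
Proof.
move=> ij mA mB; pose D k := if k == i then S i @^-1` A else S j @^-1` B.
have := @indepS [fset i; j]%fset D.
have -> : \bigcap_(k in [set` [fset i; j]%fset]) D k = S i @^-1` A `&` S j @^-1` B.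
  apply/seteqP; split => w.
    move=> h; split.
      by have := h i; rewrite /D eqxx; apply; rewrite /= !inE eqxx.
    by have := h j; rewrite /D eq_sym (negbTE ij); apply; rewrite /= !inE eqxx orbT.
  by move=> [wi wj] k; rewrite /= !inE /D => /orP[]/eqP ->; [rewrite eqxx|rewrite eq_sym (negbTE ij)].
rewrite big_fsetU1 ?inE//= big_seq_fset1 /D eqxx eq_sym (negbTE ij); apply => k.
rewrite !inE => /orP[]/eqP ->; [rewrite eqxx|rewrite eq_sym (negbTE ij)].
- by exists A; rewrite ?setTI.
- by exists B; rewrite ?setTI.
Qed.

Lemma slln_copies (g : 'cV[R]_N -> R) : measurable_fun setT g -> L1 P (g \o S0) ->
  {ae P, forall w, (\sum_(1 <= i < n.+1) g (S i w)) / n%:R @[n --> \oo] --> Ex P (g \o S0)}.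
Proof.
(* The shift leaves out copy 0, which is kept for the prediction. *)
move=> mg g1; pose X i w := g (S i.+1 w).
have law1 A : measurable A -> P (S0 @^-1` A) = P (S 1%N @^-1` A) by move=> mA; rewrite lawS.
have [gS1 ES1] := same_law_L1_Ex mS0 (mS 1%N) law1 mg g1.
rewrite -ES1.
have mX i : measurable_fun setT (X i) by exact: measurableT_comp mg (mS i.+1).
have mgA (A : set R) : measurable A -> measurable (g @^-1` A) by exact: measurable_preimage.
have idX i A : measurable A -> P (X 0%N @^-1` A) = P (X i @^-1` A).
  by move=> mA; rewrite (lawS 1%N (mgA _ mA)) (lawS i.+1 (mgA _ mA)).
have indepX i j : i != j -> indep_rv P (X i) (X j).
  move=> ij A B mA mB.
  by apply: (indep_copies (A := g @^-1` A) (B := g @^-1` B)); rewrite ?eqSS//; exact: mgA.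
apply: filterS (strong_law_large_numbers mX idX indepX gS1) => w.
suff -> : (fun n => (\sum_(1 <= i < n.+1) g (S i w)) / n%:R) =
  (fun n => (\sum_(0 <= i < n) X i w) / n%:R) by [].
by apply/funext => n; rewrite big_add1.
Qed.

(** All first and second moments of the selected coordinates converge on one almost sure event,
    since finitely many are involved. *)
Lemma slln_copies_coord (I : finType) (c : I -> 'I_N) (f0 : Omega -> I -> R)
    (f : nat -> Omega -> I -> R) :
  (forall w a, S0 w (c a) 0 = f0 w a) -> (forall i w a, S i w (c a) 0 = f i w a) ->
  (forall a, L2 P (f0 ^~ a)) ->
  {ae P, forall w, forall a b,
  ((\sum_(1 <= i < n.+1) f i w a) / n%:R @[n --> \oo] --> Ex P (f0 ^~ a)) /\
  ((\sum_(1 <= i < n.+1) f i w a * f i w b) / n%:R @[n --> \oo] -->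
     Ex P (fun w => f0 w a * f0 w b))}.
Proof.
move=> f0E fE; have {f0E} <- : (fun w a => S0 w (c a) 0) = f0.
  by apply/funext => w; apply/funext.
have {fE} <- : (fun i w a => S i w (c a) 0) = f.
  by apply/funext => i; apply/funext => w; apply/funext.
move=> f2; apply: filter_forall => a; apply: filter_forall => b.
have ma x := @measurable_mx_entry R N 1 x 0.
have := slln_copies (ma (c a)) (L2_L1 (f2 a)).
have := slln_copies (measurable_funM (ma (c a)) (ma (c b))) (L2M (f2 a) (f2 b)).
by apply: filterS2 => w hab ha; split.
Qed.

End copies.

Lemma cvg_enorm0 (R : realType) k (F : nat -> 'cV[R]_k) (A : 'cV[R]_k) :
  mx_cvg F A -> enorm (F n - A) @[n --> \oo] --> 0.
Proof.
move=> FA; rewrite /enorm -[X in _ --> X](@sqrtr0 R).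
apply: (@continuous_cvg _ _ _ _ _ _ (@Num.sqrt R)); first exact: sqrt_continuous.
rewrite [X in _ --> X](_ : 0 = \sum_(i < k) (0 : R)); last by rewrite big1.
apply: cvg_big => [|i _]; first exact: add_continuous.
rewrite [X in _ --> X](_ : 0 = 0 ^+ 2); last by rewrite expr0n.
under eq_fun do rewrite !mxE.
apply: (@continuous_cvg _ _ _ _ _ _ (fun x : R => x ^+ 2)); first exact: exprn_continuous.
by rewrite -(subrr (A i 0)); apply: cvgB; [exact: FA|exact: cvg_cst].
Qed.

Section sample_moments.
Context (R : realType) (dO : measure_display) (Omega : measurableType dO).

Lemma mx_meas_smean n k (u : nat -> Omega -> 'cV[R]_k) : (forall i, mx_meas (u i)) ->
  mx_meas (fun w => smean n (u ^~ w)).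
Proof. by move=> mu; apply: mx_measZ; exact: mx_meas_sum. Qed.

Lemma mx_meas_scov n k l (u : nat -> Omega -> 'cV[R]_k) (v : nat -> Omega -> 'cV[R]_l) :
  (forall i, mx_meas (u i)) -> (forall i, mx_meas (v i)) ->
  mx_meas (fun w => scov n (u ^~ w) (v ^~ w)).
Proof.
move=> mu mv; apply: mx_measZ; apply: mx_meas_sum => i.
apply: mx_measM; first by apply: mx_measB => //; exact: mx_meas_smean.
by apply: mx_meas_tr; apply: mx_measB => //; exact: mx_meas_smean.
Qed.

End sample_moments.

Section predictor.
Context (R : realType) (dO : measure_display) (Omega : measurableType dO)
  (P : probability Omega R) (d q m : nat).
Implicit Types M : eiv_vars P d q m.

Let N := (d + (q + (m + (d + (d + (m + m))))))%N.

Lemma measurable_stacked M : measurable_fun setT (stacked M : Omega -> 'cV[R]_N).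
Proof.
apply: measurable_fun_mxP; do 6! [apply: mx_meas_col; first by
  apply: mx_meas_comp; exact: measurable_funPT].
by apply: mx_meas_comp; exact: measurable_funPT.
Qed.

Let iy (i : 'I_d) : 'I_N := lshift _ i.
Let ir (k : 'I_(q + m)) : 'I_N := rshift d
  match fintype.split k with
  | inl a => lshift _ a
  | inr a => rshift q (rshift m (rshift d (rshift d (lshift m a))))
  end.

Let stacked_y M w i : stacked M w (iy i) 0 = vy M w i 0.
Proof. by rewrite /stacked col_mxEu. Qed.

Let stacked_zx M w k : stacked M w (ir k) 0 = zx M w k 0.
Proof.
rewrite /stacked /ir /zx col_mxEd [RHS]mxE; case: (fintype.split k) => a.
  by rewrite col_mxEu.
by rewrite !col_mxEd col_mxEu.
Qed.

Variables (M : eiv_vars P d q m) (Ms : nat -> eiv_vars P d q m) (L : 'M[R]_(q + m, d)).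
Let er : 'cV[R]_(q + m) := \col_k Ex P (fun w => zx M w k 0).
Let ey : 'cV[R]_d := \col_i Ex P (fun w => vy M w i 0).
Let lin (v : 'cV[R]_(q + m)) := ey + L^T *m (v - er).

Hypotheses (copies : independent_copies M Ms)
  (r2 : forall k, L2 P (fun w => zx M w k 0)) (y2 : forall i, L2 P (fun w => vy M w i 0))
  (ucov : cov_mx P (zx M) \in unitmx)
  (covL : forall k i, Ex P (fun w => zx M w k 0 * vy M w i 0) -
     Ex P (fun w => zx M w k 0) * Ex P (fun w => vy M w i 0) = (cov_mx P (zx M) *m L) k i)
  (condL : forall i A, measurable A -> Ex P (fun w => (vy M w i 0 -
     (Ex P (fun w => vy M w i 0) +
      \sum_k L k i * (zx M w k 0 - Ex P (fun w => zx M w k 0)))) *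
     \1_(zx M @^-1` A) w) = 0).

Let pred n w := unit_predictor n (fun i => vy (Ms i) w) (fun i => zx (Ms i) w) (zx (Ms 0%N) w).
Let Srr n w := scov n (fun i => zx (Ms i) w) (fun i => zx (Ms i) w).

(** On the almost sure event where the sample moments converge, the limit is taken with the
    regressors of copy 0 held fixed. Eventual invertibility is recorded because it turns [pred] back
    into the OLS predictor. *)
Lemma pred_cvg : {ae P, forall w, (\forall n \near \oo, Srr n w \in unitmx) /\
  mx_cvg (fun n => pred n w) (lin (zx (Ms 0%N) w))}.
Proof.
have [law ind] := copies.
pose f M w (s : 'I_(q + m) + 'I_d) : R :=
  match s with inl k => zx M w k 0 | inr i => vy M w i 0 end.
pose c (s : 'I_(q + m) + 'I_d) := match s with inl k => ir k | inr i => iy i end.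
have fE M' w s : stacked M' w (c s) 0 = f M' w s.
  by case: s => [k|i]; [exact: stacked_zx|exact: stacked_y].
have f2 s : L2 P (f M ^~ s) by case: s => [k|i]; [exact: r2|exact: y2].
have := slln_copies_coord (measurable_stacked M) (fun i => measurable_stacked (Ms i))
  law ind (fE M) (fun i => fE (Ms i)) f2.
apply: filterS => w cw.
have csr : mx_cvg (fun n => smean n (fun i => zx (Ms i) w)) er.
  move=> k j; rewrite ord1 mxE; under eq_fun do rewrite smeanE.
  exact: (cw (inl k) (inl k)).1.
have csy : mx_cvg (fun n => smean n (fun i => vy (Ms i) w)) ey.
  move=> k j; rewrite ord1 mxE; under eq_fun do rewrite smeanE.
  exact: (cw (inr k) (inr k)).1.
have cSrr : mx_cvg (fun n => Srr n w) (cov_mx P (zx M)).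
  move=> k l; rewrite cov_mxE Ex_covE//; under eq_fun do rewrite /Srr scovE.
  apply: cvgB; first exact: (cw (inl k) (inl l)).2.
  have := cvgM (csr k 0) (csr l 0); rewrite !mxE; exact.
have cSry : mx_cvg (fun n => scov n (fun i => zx (Ms i) w) (fun i => vy (Ms i) w))
    (cov_mx P (zx M) *m L).
  move=> k i; rewrite -covL; under eq_fun do rewrite scovE.
  apply: cvgB; first exact: (cw (inl k) (inr i)).2.
  have := cvgM (csr k 0) (csy i 0); rewrite !mxE; exact.
split; first exact: near_unitmx cSrr.
exact: cvg_unit_predictor ucov csr csy cSrr cSry.
Qed.

Let mx_meas_lin dT (T : measurableType dT) (F : T -> 'cV[R]_(q + m)) :
  mx_meas F -> mx_meas (fun t => lin (F t)).
Proof.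
move=> mF; apply: mx_measD; first by move=> ? ?; exact: measurable_cst.
apply: mx_measM; first by move=> ? ?; exact: measurable_cst.
by apply: mx_measB => // ? ?; exact: measurable_cst.
Qed.

(** Orthogonality is known for [M] and needed for copy 0. Each quantity is a measurable function of
    the stacked vector, so equality of the joint laws carries it over. *)
Lemma lin_cond_exp i A : measurable A ->
  [/\ L1 P (fun w => lin (zx (Ms 0%N) w) i 0), L1 P (fun w => vy (Ms 0%N) w i 0) &
  Ex P (fun w => (lin (zx (Ms 0%N) w) i 0 - vy (Ms 0%N) w i 0) *
                 \1_(zx (Ms 0%N) @^-1` A) w) = 0].
Proof.
move=> mA; have [law _] := copies.
pose rv (v : 'cV[R]_N) : 'cV[R]_(q + m) := \col_k v (ir k) 0.
have mrv : measurable_fun setT rv.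
  apply: measurable_fun_mxP => k j; under eq_fun do rewrite mxE.
  exact: measurable_mx_entry.
have rvE M' w : rv (stacked M' w) = zx M' w.
  by apply/colP => k; rewrite mxE stacked_zx.
pose l (v : 'cV[R]_N) : R := lin (rv v) i 0; pose y (v : 'cV[R]_N) : R := v (iy i) 0.
have my : measurable_fun setT y by exact: measurable_mx_entry.
have ml : measurable_fun setT l by apply: mx_meas_lin; exact: mx_meas_comp.
have lawC D : measurable D -> P (stacked M @^-1` D) = P (stacked (Ms 0%N) @^-1` D).
  by move=> mD; rewrite law.
have linE M' w : lin (zx M' w) i 0 =
    Ex P (fun w => vy M w i 0) + \sum_k L k i * (zx M' w k 0 - Ex P (fun w => zx M w k 0)).
  by rewrite !mxE; congr (_ + _); apply: eq_bigr => k _; rewrite !mxE.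
have l1 : L1 P (l \o stacked M).
  apply: eq_L1 (_ : L1 P (fun w => Ex P (fun w => vy M w i 0) +
      \sum_k L k i * (zx M w k 0 - Ex P (fun w => zx M w k 0)))) => [w|].
    by rewrite /l /= rvE linE.
  apply: L1D; first exact: L1_cst.
  apply: L1_sum => k _; apply: L1Z; apply: L1B; last exact: L1_cst.
  exact: L2_L1.
have y1 : L1 P (y \o stacked M).
  by apply: eq_L1 (L2_L1 (y2 i)) => w; rewrite /y /= stacked_y.
pose h (v : 'cV[R]_N) : R := (l v - y v) * \1_(rv @^-1` A) v.
have mA1 : measurable_fun setT (\1_(rv @^-1` A) : 'cV[R]_N -> R).
  by apply: measurable_indic; exact: measurable_preimage.
have mh : measurable_fun setT h by apply: measurable_funM => //; exact: measurable_funB.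
have h1 : L1 P (h \o stacked M).
  apply: (@L1_bddM _ _ _ _ _ _ 1); [exact: L1B| |by move=> w; exact: indic_le1].
  exact: measurableT_comp mA1 (measurable_stacked M).
have hE M' w : h (stacked M' w) = (lin (zx M' w) i 0 - vy M' w i 0) * \1_(zx M' @^-1` A) w.
  rewrite /h /l /y stacked_y rvE !indicE; congr (_ * (nat_of_bool _)%:R).
  by apply/idP/idP; rewrite !inE /= rvE.
have mS M' := measurable_stacked M'.
have [l01 _] := same_law_L1_Ex (mS M) (mS (Ms 0%N)) lawC ml l1.
have [y01 _] := same_law_L1_Ex (mS M) (mS (Ms 0%N)) lawC my y1.
have [_ h0] := same_law_L1_Ex (mS M) (mS (Ms 0%N)) lawC mh h1.
split.
- by apply: eq_L1 l01 => w; rewrite /l /= rvE.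
- by apply: eq_L1 y01 => w; rewrite /y /= stacked_y.
transitivity (Ex P (h \o stacked (Ms 0%N))); first by apply: eq_Ex => w; rewrite /= hE.
apply/eqP; rewrite h0 -oppr_eq0 -mulN1r -ExZ//; apply/eqP.
rewrite -[RHS](condL i mA); apply: eq_Ex => w.
by rewrite /= hE linE mulN1r -mulNr opprB.
Qed.

Variable yhat : Omega -> 'cV[R]_d.
Hypothesis hyhat : is_cond_exp_vector P (g_sigma_algebra_preimage (zx (Ms 0%N)))
  (vy (Ms 0%N)) yhat.

Let mzx0 : measurable_fun setT (zx (Ms 0%N)).
Proof.
by apply: measurable_fun_mxP; apply: mx_meas_col; apply: mx_meas_comp; exact: measurable_funPT.
Qed.

(** Both sides are versions of the same conditional expectation, so their difference is measurable
    in the regressors of copy 0 and orthogonal to all their events. *)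
Lemma yhat_ae : {ae P, forall w, lin (zx (Ms 0%N) w) = yhat w}.
Proof.
suff : {ae P, forall w, forall i : 'I_d, lin (zx (Ms 0%N) w) i 0 - yhat w i 0 = 0}.
  by apply: filterS => w h; apply/colP => i; apply/eqP; rewrite -subr_eq0 h.
apply: filter_forall => i; have [my y1 yE] := hyhat i.
have [lin1 y01 _] := lin_cond_exp i (@measurableT _ _).
apply: (orthogonal_ae0 mzx0).
- apply: measurable_funB; last exact: g_sigma_algebra_preimage_fun.
  have mG : measurable_fun [set: g_sigma_algebra_preimageType (zx (Ms 0%N))]
      (zx (Ms 0%N) : g_sigma_algebra_preimageType (zx (Ms 0%N)) -> _).
    by move=> _ A mA; exists A.
  by apply: mx_meas_lin; exact: mx_meas_comp.
- exact: L1B.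
- move=> D GD; have mD := g_sigma_algebra_preimage_meas mzx0 GD.
  have [A mA DE] := GD; rewrite setTI in DE.
  have [_ _ linA] := lin_cond_exp i mA; rewrite DE in linA.
  have mD1 (f : Omega -> R) : L1 P f -> L1 P (fun w => f w * \1_D w).
    by move=> f1; apply: (@L1_bddM _ _ _ _ _ _ 1) => // w; exact: indic_le1.
  have yD : Ex P (fun w => yhat w i 0 * \1_D w) = Ex P (fun w => vy (Ms 0%N) w i 0 * \1_D w).
    by apply: EFin_inj; rewrite !Ex_restrict// yE.
  transitivity (Ex P (fun w => (lin (zx (Ms 0%N) w) i 0 - vy (Ms 0%N) w i 0) * \1_D w +
      (vy (Ms 0%N) w i 0 * \1_D w - yhat w i 0 * \1_D w))).
    by apply: eq_Ex => w; ring.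
  rewrite ExD ?ExB ?linA ?yD ?subrr ?addr0//; try exact: mD1.
  + by apply: mD1; exact: L1B.
  + by apply: L1B; exact: mD1.
Qed.

Let pred_ols n w : Srr n w \in unitmx -> eiv_ols_predictor Ms n w = pred n w.
Proof. by move=> u; rewrite /eiv_ols_predictor ols_predictor_unit. Qed.

Lemma ols_cvg : {ae P, forall w, (fun n => eiv_ols_predictor Ms n w) @ \oo --> yhat w}.
Proof.
apply: filterS2 pred_cvg yhat_ae => w [u cw] <-.
apply: cvg_trans (mx_cvgP cw); apply: near_eq_cvg.
by apply: filterS u => n /pred_ols ->.
Qed.

Let mzx i : mx_meas (zx (Ms i)).
Proof. by apply: mx_meas_col; apply: mx_meas_comp; exact: measurable_funPT. Qed.

Let mx_meas_pred n : mx_meas (fun w => pred n w - yhat w).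
Proof.
have my i : mx_meas (vy (Ms i)) by apply: mx_meas_comp; exact: measurable_funPT.
apply: mx_measB; last first.
  move=> i j; rewrite ord1; have [_ y1 _] := hyhat i.
  by apply/measurable_EFinP; exact: measurable_int y1.
apply: mx_measD; first exact: mx_meas_smean.
apply: mx_measM; last by apply: mx_measB => //; exact: mx_meas_smean.
apply: mx_meas_tr; apply: mx_measM; last exact: mx_meas_scov.
by apply: mx_meas_det_inv; exact: mx_meas_scov.
Qed.

Lemma ols_cond_prob (tau : R) (p : nat -> Omega -> R) : 0 < tau ->
  (forall n, is_cond_prob P (g_sigma_algebra_preimage (zx (Ms 0%N)))
     [set w | tau < enorm (eiv_ols_predictor Ms n w - yhat w)] (p n)) ->
  {ae P, forall w, (fun n => p n w) @ \oo --> (0 : R)}.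
Proof.
move=> tau0 hp.
(* Off the singular event the OLS predictor is [pred], so this measurable set contains the error
   event; almost surely it occurs only finitely often. *)
pose F n : set Omega := [set w | Srr n w \notin unitmx] `|`
  (fun w => enorm (pred n w - yhat w)) @^-1` `]tau, +oo[.
apply: (cond_prob_cvg0 mzx0 (F := F) hp).
- move=> n; apply: measurableU; last first.
    by apply: measurable_preimage => //; exact: measurable_enorm.
  rewrite (_ : [set w | _] = (fun w => \det (Srr n w)) @^-1` [set 0]).
    by apply: measurable_preimage => //; apply: measurable_det; exact: mx_meas_scov.
  by apply/seteqP; split => w /=; rewrite unitmxE unitfE negbK => /eqP.
- move=> n w /= tw; case: (boolP (Srr n w \in unitmx)) => u; last by left.
  by right; rewrite /= in_itv/= andbT -pred_ols.
- apply: filterS2 pred_cvg yhat_ae => w [u cw] hw.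
  have /cvgrPdist_lt /(_ _ tau0) := cvg_enorm0 cw; rewrite hw.
  apply: filterS2 u => n u; rewrite sub0r normrN => tn [/negP //|].
  rewrite /= in_itv/= andbT => /(lt_trans (le_lt_trans (ler_norm _) tn)).
  by rewrite ltxx.
Qed.

End predictor.

Theorem theorem1 (R : realType) (dO : measure_display)
    (Omega : measurableType dO) (P : probability Omega R) (d q m : nat)
    (b : 'cV[R]_d) (C : 'M[R]_(q, d)) (B : 'M[R]_(m, d))
    (M : eiv_vars P d q m) (Ms : nat -> eiv_vars P d q m)
    (yhat : Omega -> 'cV[R]_d)
    (hmodel : eiv_model b C B M)
    (hindep : independent_blocks M)
    (hz2 : finite_second_moment P (vz M))
    (hxi2 : finite_second_moment P (vxi M))
    (he2 : finite_second_moment P (ve M))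
    (hepsdelta2 : finite_second_moment P (eps_delta M))
    (hSz : cov_mx P (vz M) \in unitmx)
    (hSx : cov_mx P (vx M) \in unitmx)
    (he0 : zero_mean P (ve M))
    (heps0 : zero_mean P (veps M))
    (hdelta0 : zero_mean P (vdelta M))
    (hgauss : gaussian_vector P (eps_delta_xi M))
    (hcopies : independent_copies M Ms)
    (hyhat : is_cond_exp_vector P (g_sigma_algebra_preimage (zx (Ms 0%N)))
       (vy (Ms 0%N)) yhat) :
  {ae P, forall w, (fun n => eiv_ols_predictor Ms n w) @ \oo --> yhat w} /\
  (forall tau : R, 0 < tau ->
   forall p : nat -> Omega -> R,
     (forall n, is_cond_prob P (g_sigma_algebra_preimage (zx (Ms 0%N)))
        [set w | tau < enorm (eiv_ols_predictor Ms n w - yhat w)] (p n)) ->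
   {ae P, forall w, (fun n => p n w) @ \oo --> (0 : R)}).
Proof.
have [L [covL condL]] :=
  linear_conditional_mean hmodel hindep hz2 hxi2 he2 hepsdelta2 hSx he0 hgauss.
have r2 := L2_regressor hmodel hz2 hxi2 hepsdelta2.
have y2 := L2_response hmodel hz2 hxi2 he2 hepsdelta2.
have ucov := cov_zx_unit hmodel hindep hz2 hxi2 hepsdelta2 hSz hSx.
split; first by have := ols_cvg hcopies r2 y2 ucov covL condL hyhat.
move=> tau tau0 p hp.
by have := ols_cond_prob hcopies r2 y2 ucov covL condL hyhat tau0 hp.
Qed.
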